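(* Let $\alpha,\beta,s,p_0,\dots,p_{s-1},K,l$ and Problem A with initial function $\varphi$ be as in the context. If there is a solution to Problem A, then it is unique; that is, any two solutions of Problem A with the same initial function $\varphi$ coincide on $\overline\Omega$.
   Context: Let $0<\alpha<1$, $\beta\in\mathbb{R}$ with $\beta>-\alpha$, $s\in\mathbb{N}$, $s\ge1$, and $p_j\in C^j([0,1])$ real-valued, $j=0,1,\dots,s-1$. Let $\Omega=(0,1)\times(0,1)$ with points $(x,y)$. The differential expression $l$ acts in the variable $y$: $$l(u)=(-1)^s\frac{\partial^{2s}u}{\partial y^{2s}}+\sum_{j=1}^{s-1}(-1)^j\frac{\partial^j}{\partial y^j}\Big(p_j(y)\frac{\partial^ju}{\partial y^j}\Big)+p_0(y)u$$ (and the same formula with ordinary derivatives for functions of $y$ only). Let $K\in C[0,1]$ be sufficiently smooth on $(0,1]$, with $K(y)>0$ for $y\in(0,1]$, $K(0)=0$, and $K^{(i)}(y)=O(y^{m-i})$ as $y\to+0$, $i=0,1,\dots$, for some $m$ with $0\le m<s$. The Caputo derivative of order $\alpha$ in $x$ is $${}_CD_{0x}^\alpha u(x,y)=\frac1{\Gamma(1-\alpha)}\int_0^x\frac{\partial_\tau u(\tau,y)}{(x-\tau)^\alpha}\,d\tau.$$ Standing assumptions: all eigenvalues $\lambda$ of the spectral problem $l(Y(y))=\lambda Y(y)/K(y)$ on $(0,1)$, $Y^{(j)}(0)=Y^{(j)}(1)=0$ for $j=0,\dots,s-1$, are positive (this holds, for example, if all $p_j\ge0$), so that $l$ with these boundary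 conditions has a continuous symmetric Green's function $G(y,\xi)$; and the kernel $\bar G(y,\xi)=G(y,\xi)/\sqrt{K(y)K(\xi)}$ is symmetric and continuous in both variables (extended by continuity to $[0,1]^2$). Problem A (with initial function $\varphi$, a sufficiently smooth function on $[0,1]$ satisfying the matching conditions with the boundary data): find a function $u$ with $${}_CD_{0x}^\alpha u\in C(\Omega),\quad u\in C(\overline\Omega),\quad \frac{\partial^{2s-1}u}{\partial y^{2s-1}}\in C(\overline\Omega),\quad \frac{\partial^{2s}u}{\partial y^{2s}}\in C(\Omega),$$ satisfying the equation $${}_CD_{0x}^\alpha u(x,y)+x^\beta K(y)\,l(u(x,y))=0\quad\text{in }\Omega,$$ the boundary conditions $$\frac{\partial^ju(x,0)}{\partial y^j}=\frac{\partial^ju(x,1)}{\partial y^j}=0,\quad 0\le x\le1,\ j=0,1,\dots,s-1,$$ and the initial condition $u(0,y)=\varphi(y)$, $0\le y\le 1$. *)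

(* Defs.v *)
From HB Require Import structures.
From mathcomp Require Import all_boot all_order all_algebra.
From mathcomp Require Import all_classical all_reals all_analysis.
Set Implicit Arguments.
Unset Strict Implicit.
Unset Printing Implicit Defensive.
Import Order.TTheory GRing.Theory Num.Theory.
Import numFieldNormedType.Exports.
Local Open Scope classical_set_scope.
Local Open Scope ring_scope.

Section Defs.
Context {R : realType}.
Implicit Types (D : set R) (f K : R -> R) (p : nat -> R -> R) (s n : nat).
Implicit Types (u G : R -> R -> R).

(* Derivative of f regarded as a function on D: the points z of the difference
   quotient stay in D. It is the ordinary derivative at interior points of D
   and the one-sided derivative at the end points of an interval. *)
Definition diffquo_in D f (x : R) : set_system R :=
  (f z - f x) / (z - x) @[z --> within D x^'].

Definition derivable_in D f (x : R) : Prop := cvg (diffquo_in D f x).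

Definition derive_in D f (x : R) : R := lim (diffquo_in D f x).

Definition derive_in_n D n f : R -> R := iter n (derive_in D) f.

(* f is of class C^n on D *)
Definition contdiff_in D n f : Prop :=
  (forall k, (k < n)%N -> forall x, D x -> derivable_in D (derive_in_n D k f) x)
  /\ {within D, continuous (derive_in_n D n f)}.

Definition I01 : set R := `[0, 1].
Definition O01 : set R := `]0, 1[.

Definition lexpr D s p f (y : R) : R :=
  (-1) ^+ s * derive_in_n D s.*2 f y
  + (\sum_(1 <= j < s)
       (-1) ^+ j * derive_in_n D j (fun z => p j z * derive_in_n D j f z) y)
  + p 0%N y * f y.

Definition boundary_cond s f : Prop :=
  forall j, (j < s)%N ->
    derive_in_n I01 j f 0 = 0 /\ derive_in_n I01 j f 1 = 0.

(* Real eigenvalues with real eigenfunctions suffice, the problem being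
   self-adjoint. The regularity asked of Y is the one asked of the solutions of
   Problem A in the variable y. *)
Definition eigenvalue_of s p K (lam : R) : Prop :=
  exists Y : R -> R,
    [/\ contdiff_in I01 s.*2.-1 Y,
        (forall y, O01 y -> derivable_in I01 (derive_in_n I01 s.*2.-1 Y) y),
        (forall y, O01 y -> lexpr I01 s p Y y = lam * Y y / K y),
        boundary_cond s Y
      & exists2 y, I01 y & Y y != 0].

(* G(y, xi) is a continuous Green's function of l with the boundary conditions:
   as a function of y it is C^(2s-2), it solves l = 0 on both sides of xi, and
   its (2s-1)-st derivative jumps at xi by the inverse (-1)^s of the leading
   coefficient of l. *)
Definition green_function s p G : Prop :=
  {within I01 `*` I01, continuous (fun q : R * R => G q.1 q.2)} /\
  forall xi, O01 xi -> let g := fun y => G y xi in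
    [/\ contdiff_in I01 s.*2.-2 g,
        contdiff_in `[0, xi] s.*2 g /\ contdiff_in `[xi, 1] s.*2 g,
        (forall y, 0 <= y <= xi -> lexpr `[0, xi] s p g y = 0) /\
        (forall y, xi <= y <= 1 -> lexpr `[xi, 1] s p g y = 0),
        derive_in_n `[xi, 1] s.*2.-1 g xi
          - derive_in_n `[0, xi] s.*2.-1 g xi = (-1) ^+ s
      & boundary_cond s g].

(* the kernel G(y, xi) / sqrt (K(y) K(xi)), defined on (0,1]^2 as K(0) = 0,
   extends to a symmetric continuous kernel on [0,1]^2 *)
Definition weighted_kernel_continuous K G : Prop :=
  exists Gbar : R -> R -> R,
    [/\ (forall y xi, 0 < y <= 1 -> 0 < xi <= 1 ->
           Gbar y xi = G y xi / Num.sqrt (K y * K xi)),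
        (forall y xi, I01 y -> I01 xi -> Gbar y xi = Gbar xi y)
      & {within I01 `*` I01, continuous (fun q : R * R => Gbar q.1 q.2)}].

Definition Gamma (a : R) : R :=
  \int[lebesgue_measure]_(t in `]0, +oo[) (t `^ (a - 1) * expR (- t)).

(* The Caputo derivative in x makes sense at (x, y): the partial derivative in
   x exists along (0, x] and the singular integrand is Lebesgue integrable. *)
Definition caputo_integrand alpha u (x y t : R) : R :=
  derive1 (fun r => u r y) t / (x - t) `^ alpha.

Definition caputo_exists alpha u (x y : R) : Prop :=
  (forall t, 0 < t <= x -> derivable (fun r => u r y) t 1) /\
  (@lebesgue_measure R).-integrable `]0, x[
    (fun t => (caputo_integrand alpha u x y t)%:E).

Definition caputo alpha u (x y : R) : R :=
  (Gamma (1 - alpha))^-1 *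
  \int[lebesgue_measure]_(t in `]0, x[) caputo_integrand alpha u x y t.

(* Problem A. Only the values of u on the closed square matter. *)
Definition problemA alpha beta s p K (phi : R -> R) u : Prop :=
  [/\ (forall x y, O01 x -> O01 y -> caputo_exists alpha u x y) /\
      {within O01 `*` O01, continuous (fun q : R * R => caputo alpha u q.1 q.2)},
      {within I01 `*` I01, continuous (fun q : R * R => u q.1 q.2)},
      (forall k, (k < s.*2.-1)%N -> forall x y, I01 x -> I01 y ->
         derivable_in I01 (derive_in_n I01 k (u x)) y) /\
      {within I01 `*` I01, continuous
         (fun q : R * R => derive_in_n I01 s.*2.-1 (u q.1) q.2)},
      (forall x y, O01 x -> O01 y ->
         derivable_in I01 (derive_in_n I01 s.*2.-1 (u x)) y) /\
      {within O01 `*` O01, continuous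
         (fun q : R * R => derive_in_n I01 s.*2 (u q.1) q.2)}
    & [/\ (forall x y, O01 x -> O01 y ->
             caputo alpha u x y + x `^ beta * K y * lexpr I01 s p (u x) y = 0),
          (forall x, I01 x -> boundary_cond s (u x))
        & (forall y, I01 y -> u 0 y = phi y)]].

End Defs.

(* Main.v *)
Require Import Defs.
From HB Require Import structures.
From mathcomp Require Import all_boot all_order all_algebra.
From mathcomp Require Import all_classical all_reals all_analysis.
From mathcomp Require Import measurable_realfun ring lra zify.
Set Implicit Arguments.
Unset Strict Implicit.
Unset Printing Implicit Defensive.
Import Order.TTheory GRing.Theory Num.Theory.
Import numFieldNormedType.Exports.
Local Open Scope classical_set_scope.
Local Open Scope ring_scope.

(** Let u be the difference of two solutions, so that u(0, y) = 0, and write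
    k(t) = t^(-alpha), c0 = 1 / Gamma(1 - alpha), v = u / sqrt K, * for the
    convolution in x and Gbar for the weighted Green function. The differential
    operators are inverted in both variables, which leads to an integral
    equation for v, and a growth argument shows that v = 0. Eigenfunction
    expansions are avoided.

    In the variable x, the Caputo derivative of u is c0 d with d = k * u', and
    associativity of the convolution gives k * u = 1 * d (conv_pow_caputo).
    All that is known of u' is that it exists everywhere and is integrable;
    u = 1 * u' is therefore the fundamental theorem of calculus for
    everywhere differentiable functions with integrable derivative
    (integral_derive1).

    In the variable y, integrating by parts against the Green function on both
    sides of its singularity xi gives
      int_a^b G(y, xi) l(w)(y) dy = w(xi) + boundary terms at a and b
    (green_estimate). The boundary terms tend to 0 as a and b tend to 0 and 1,
    uniformly over the functions w that satisfy the boundary conditions and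
    whose derivatives up to order 2s - 1 have a given bound. The slices
    u(x, .) are such functions, with one bound for all x, since intermediate
    derivatives are controlled by u and its derivative of order 2s - 1
    (problemA_admissible, intermediate_derivatives_bound).

    The function v is bounded (admissible_le_kap): u is O(y^s) at 0, and
    y^s (1 - y)^s is itself represented by the Green function, which is at
    most N sqrt (K(y) K(xi)), whence y^s (1 - y)^s <= C sqrt (K(y)).

    Integrating the equation, multiplied by G, over x and y now gives the
    evolution equation (evolution_identity)
      c0 T((k * v)(x)) = - int_0^x t^beta v(t) dt,
    where T is the integral operator with the bounded symmetric kernel Gbar.

    To see that v = 0 (evolution_eq0), pair the equation with a test function
    phi. For f_phi(x) = <v(x), phi> it says c0 (k * f_(T phi)) =
    - 1 * (t^beta f_phi), and Abel inversion (abel_inversion) bounds f_(T phi)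
    by f_phi: the n-th application of T to phi gains a factor
    eps_n x^(alpha + beta), where eps_n tends to 0 because alpha + beta > 0.
    For phi = v(x) the symmetry of T gives |T^n phi|^2 = f_(T^(2n) phi)(x), so
    these norms decay faster than any geometric sequence. By the
    Cauchy-Schwarz inequality they are log-convex in n, which forces
    T v(x) = 0 for all x (logconvex_subgeometric_eq0), and the evolution
    equation leaves only v = 0. *)

(** * Affine change of variable in Lebesgue integrals *)

Section change_of_variable.
Context {R : realType}.
Notation mu := (@lebesgue_measure R).
Notation RT := (measurableTypeR R).

(** The scaled push-forward gives each half-open interval its length, and this
    determines a measure. *)
Lemma lebesgue_measure_affine (a b : R) (A : set RT) : a != 0 ->
  measurable A ->
  (`|a|%:E * pushforward mu ((fun t => a * t + b)%R : RT -> RT) A = mu A)%E.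
Proof.
move=> a0 mA.
have mf : measurable_fun [set: RT] ((fun t => a * t + b) : RT -> RT).
  by apply: measurable_funD => //; exact: measurable_funM.
pose f : {mfun RT >-> RT} :=
  HB.pack ((fun t => a * t + b) : RT -> RT) (isMeasurableFun.Build _ _ _ _ _ mf).
apply/esym.
apply: (lebesgue_measure_unique (mu := mscale (NngNum (normr_ge0 a)) (pushforward mu f))) => // _ [[c d]] _ <-.
change (mu `]c, d] = `|a|%:E * mu ((fun t => a * t + b)%R @^-1` `]c, d]))%E.
have [a_gt0|a_lt0|/eqP] := ltrgtP 0 a; last by rewrite eq_sym (negbTE a0).
- have -> : (fun t => a * t + b) @^-1` `]c, d] = `](c - b) / a, (d - b) / a]%classic.
    by apply/seteqP; split => t; rewrite /= !in_itv/= [a * t]mulrC ltr_pdivrMr// ler_pdivlMr// ltrBlDr lerBrDr.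
  rewrite !lebesgue_measure_itv/= !lte_fin ltr_pM2r ?invr_gt0// ltrD2r gtr0_norm//.
  case: ifP => // _; last by rewrite mule0.
  by rewrite -!EFinB -EFinM; congr EFin; field.
- have -> : (fun t => a * t + b) @^-1` `]c, d] = `[(d - b) / a, (c - b) / a[%classic.
    by apply/seteqP; split => t; rewrite /= !in_itv/= [a * t]mulrC ler_ndivrMr// ltr_ndivlMr// lerBrDr ltrBlDr andbC.
  rewrite !lebesgue_measure_itv/= !lte_fin ltr_nM2r ?invr_lt0// ltrD2r ltr0_norm//.
  case: ifP => // _; last by rewrite mule0.
  by rewrite -!EFinB -EFinM; congr EFin; field.
Qed.

(** Transport of measure gives the formula for nonnegative integrands; the
    general case follows through positive and negative parts, without any
    continuity of the integrand. *)
Lemma integral_affine (a b : R) (D : set RT) (g : RT -> \bar R) : a != 0 ->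
  measurable D -> measurable_fun D g ->
  (\int[mu]_(t in D) g t =
   `|a|%:E * \int[mu]_(t in (fun t => (a * t + b)%R) @^-1` D) g (a * t + b)%R)%E.
Proof.
move=> a0 mD mg.
have mf : measurable_fun [set: RT] ((fun t => a * t + b) : RT -> RT).
  by apply: measurable_funD => //; exact: measurable_funM.
have pos (h : R -> \bar R) : measurable_fun D h -> (forall t, 0 <= h t)%E ->
    (\int[mu]_(t in D) h t =
     `|a|%:E * \int[mu]_(t in (fun t => (a * t + b)%R) @^-1` D) h (a * t + b)%R)%E.
  move=> mh h0.
  rewrite -[X in (_ = _ * X)%E](ge0_integral_pushforward mf)//.
  rewrite -(ge0_integral_mscale _ _ (NngNum (normr_ge0 a)))//.
  apply: eq_measure_integral => A mA _; apply/esym.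
  exact: lebesgue_measure_affine.

have a_gt0 : 0 < `|a| by rewrite normr_gt0.
have distr (x y : \bar R) : (0 <= x)%E -> (0 <= y)%E ->
    (`|a|%:E * x - `|a|%:E * y = `|a|%:E * (x - y))%E.
  case: x => [x| |]//; case: y => [y| |]// _ _.
  - by rewrite [RHS]muleBr.
  - by rewrite /= gt0_muley// gt0_muleNy.
  - by rewrite /= gt0_muley.
  - by rewrite /= gt0_muley// gt0_muleNy.
rewrite integralE (pos _ (measurable_funepos mg))//.
rewrite (pos _ (measurable_funeneg mg))//.
rewrite [X in (_ = _ * X)%E]integralE distr; [|exact: integral_ge0..].
by congr (_ * (_ - _))%E; apply: eq_integral => t _; rewrite ?(funepos_comp g (fun t => a * t + b)) ?(funeneg_comp g (fun t => a * t + b)).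
Qed.

Lemma integrable_affine (a b : R) (D : set RT) (g : RT -> \bar R) : a != 0 ->
  measurable D -> mu.-integrable D g ->
  mu.-integrable ((fun t => a * t + b) @^-1` D) (fun t => g (a * t + b)).
Proof.
move=> a0 mD ig.
have mg := measurable_int _ ig.
have mf : measurable_fun [set: R] (fun t : R => a * t + b).
  by apply: measurable_funD => //; exact: measurable_funM.
have mD' : measurable ((fun t : R => a * t + b) @^-1` D).
  by rewrite -[X in measurable X]setTI; exact: mf.
have mg' : measurable_fun ((fun t => a * t + b) @^-1` D) (fun t => g (a * t + b)).
  apply: (measurable_comp mD) => //; first by move=> _ /= [t ht <-].
  exact: measurable_funTS.
apply/integrableP; split => //.
have /integrableP[_] := ig.
rewrite (@integral_affine a b)//; last exact: measurableT_comp.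
have : (0 <= \int[mu]_(t in (fun t => (a * t + b)%R) @^-1` D) `|g (a * t + b)%R|)%E.
  exact: integral_ge0.
by case: (\int[mu]_(_ in _) _)%E => [r| |]//; rewrite ?ltry// gt0_muley// lte_fin normr_gt0.
Qed.

Lemma preimage_reflect (x : R) : (fun t => -1 * t + x) @^-1` `]0, x[ = `]0, x[%classic.
Proof.
by apply/seteqP; split => t /=; rewrite !in_itv/= => /andP[h1 h2]; apply/andP; split; lra.
Qed.

Lemma integral_reflect (x : R) (g : RT -> \bar R) : measurable_fun `]0, x[ g ->
  (\int[mu]_(t in `]0%R, x[) g (x - t)%R = \int[mu]_(t in `]0%R, x[) g t)%E.
Proof.
move=> mg; rewrite [RHS](@integral_affine (-1) x)// ?oppr_eq0//.
rewrite preimage_reflect normrN1 mul1e.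
by apply: eq_integral => t _; rewrite mulN1r addrC.
Qed.

Lemma integrable_reflect (x : R) (g : RT -> \bar R) : mu.-integrable `]0, x[ g ->
  mu.-integrable `]0, x[ (fun t => g (x - t)).
Proof.
have N10 : (-1 : R) != 0 by rewrite oppr_eq0.
move=> /(integrable_affine x N10 (measurable_itv _)).
rewrite preimage_reflect; apply: eq_integrable => // t _.
by rewrite mulN1r addrC.
Qed.

Lemma preimage_scale (x y : R) : 0 < x ->
  (fun t => x * t + 0) @^-1` `]0, x * y[ = `]0, y[%classic.
Proof.
move=> x0; apply/seteqP; split => t /=; rewrite !in_itv/= addr0.
  by rewrite pmulr_rgt0// ltr_pM2l.
by rewrite pmulr_rgt0// ltr_pM2l.
Qed.

Lemma integral_scale (x y : R) (g : RT -> \bar R) : 0 < x -> measurable_fun `]0, x * y[ g ->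
  (\int[mu]_(t in `]0%R, (x * y)%R[) g t = x%:E * \int[mu]_(t in `]0%R, y[) g (x * t)%R)%E.
Proof.
move=> x0 mg; rewrite [LHS](@integral_affine x 0)// ?gt_eqF//.
rewrite preimage_scale// gtr0_norm//; congr (_ * _)%E.
by apply: eq_integral => t _; rewrite addr0.
Qed.

Lemma integrable_scale (x y : R) (g : RT -> \bar R) : 0 < x ->
  mu.-integrable `]0, x * y[ g <-> mu.-integrable `]0, y[ (fun t => g (x * t)).
Proof.
have H (x' y' : R) g' : 0 < x' -> mu.-integrable `]0, x' * y'[ g' ->
    mu.-integrable `]0, y'[ (fun t => g' (x' * t)).
  move=> x0; have xN0 : x' != 0 by rewrite gt_eqF.
  move=> /(integrable_affine 0 xN0 (measurable_itv _)).
  rewrite preimage_scale//; apply: eq_integrable => // t _.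
  by rewrite addr0.
move=> x0; split; first exact: H.
move=> ig; have := H x^-1 (x * y) (fun t => g (x * t)).
rewrite invr_gt0 x0 mulKf ?gt_eqF// => /(_ isT ig).
by apply: eq_integrable => // t _; rewrite mulVKf ?gt_eqF.
Qed.

Lemma integral_shift (r x : R) (g : RT -> \bar R) : measurable_fun `]r, x[ g ->
  (\int[mu]_(t in `]r, x[) g t = \int[mu]_(t in `]0%R, (x - r)%R[) g (t + r)%R)%E.
Proof.
move=> mg; rewrite [LHS](@integral_affine 1 r)// normr1 mul1e.
have -> : (fun t => 1 * t + r) @^-1` `]r, x[ = `]0, x - r[%classic.
  by apply/seteqP; split => t /=; rewrite !in_itv/= mul1r => /andP[h1 h2]; apply/andP; split; lra.
by apply: eq_integral => t _; rewrite mul1r.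
Qed.

End change_of_variable.

(** * Power functions *)

Section power_kernels.
Context {R : realType}.
Notation mu := (@lebesgue_measure R).

Lemma continuous_powR (a : R) (x : R) : 0 < x -> {for x, continuous (fun t => t `^ a)}.
Proof.
move=> x0; apply/differentiable_continuous/derivable1_diffP.
by apply: derivable_powR; rewrite in_itv/= x0.
Qed.

Lemma integral_powR_le (a e : R) : -1 < a -> 0 < e < 1 ->
  (\int[mu]_(t in `[e, 1%R]) (t `^ a)%:E <= ((a + 1)^-1)%:E)%E.
Proof.
move=> a1 /andP[e0 e1].
have a10 : 0 < a + 1 by lra.
have cont b x : 0 < x -> {for x, continuous (fun t : R => (b + 1)^-1 * t `^ (b + 1))}.
  move=> x0; apply: continuousM; first exact: cst_continuous.
  exact: continuous_powR.
rewrite (@continuous_FTC2 _ _ (fun t => (a + 1)^-1 * t `^ (a + 1)))//.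
- by rewrite powR1 mulr1 -EFinB lee_fin gerBl mulr_ge0 ?invr_ge0 ?powR_ge0// ltW.
- apply: continuous_in_subspaceT => x; rewrite inE/= in_itv/= => /andP[ex _].
  by apply: continuous_powR; lra.
- split => [x| |].
  + rewrite in_itv/= => /andP[ex _]; apply: derivableM => //.
    by apply: derivable_powR; rewrite in_itv/=; apply/andP; split => //; lra.
  + by apply: cvg_at_right_filter; apply: cont.
  + by apply: cvg_at_left_filter; apply: cont.
- move=> x; rewrite in_itv/= => /andP[ex _].
  have x0 : x \in `]0, +oo[ by rewrite in_itv/=; apply/andP; split => //; lra.
  rewrite derive1Ml; last exact: derivable_powR.
  by rewrite powR_derive1// addrK mulrA mulVf ?mul1r// gt_eqF.
Qed.

(** Monotone convergence along the intervals [1/n, 1], on which the explicit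
    primitive bounds the integrals uniformly in n. *)
Lemma integrable_powR (a : R) : -1 < a ->
  mu.-integrable `]0, 1[ (fun t => (t `^ a)%:E).
Proof.
move=> a1.
have mp D : measurable_fun D (fun t : R => (t `^ a)%:E).
  by apply/measurable_EFinP; apply: measurable_funTS; exact: measurable_powR.
suff : mu.-integrable `]0, 1] (fun t => (t `^ a)%:E).
  by apply: integrableS => //; exact: subset_itv_oo_oc.
apply/integrableP; split; first exact: mp.
pose F n := `[(n.+2%:R)^-1, 1 : R]%classic : set (measurableTypeR R).
have UF : \bigcup_n F n = `]0, 1]%classic.
  apply/seteqP; split => [x [n _]|x]; rewrite /F /= !in_itv/=.
    by move=> /andP[h ->]; rewrite andbT (lt_le_trans _ h)// invr_gt0.
  move=> /andP[x0 x1]; exists (Num.truncn x^-1) => //=; rewrite in_itv/= x1 andbT.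
  rewrite invf_ple ?posrE//; apply/ltW/(lt_trans (truncnS_gt _)).
  by rewrite ltr_nat.
have ndF : nondecreasing_seq F.
  move=> m n mn; apply/subsetPset; apply: subset_itvr.
  by rewrite bnd_simp lef_pV2 ?posrE// ler_nat ltnS ltnS.
have := @ge0_nondecreasing_set_cvg_integral _ (measurableTypeR R) _ F (fun t => `|(t `^ a)%:E|)%E mu ndF.
rewrite UF => /(_ _ _ _)/(cvg_lim _) <- //; last first.
- by move=> n; apply: measurableT_comp => //; exact: mp.
- by move=> n; exact: measurable_itv.
- apply: (@le_lt_trans _ _ ((a + 1)^-1)%:E); last exact: ltry.
  apply: lime_le.
    apply: ereal_nondecreasing_is_cvgn.
    apply: ge0_nondecreasing_set_nondecreasing_integral => // n.
      exact: measurable_itv.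
    by apply: measurableT_comp => //; exact: mp.
  apply: nearW => n.
  under eq_integral do rewrite gee0_abs ?lee_fin ?powR_ge0//.
  apply: integral_powR_le => //; rewrite invr_gt0 ltr0n/=.
  by rewrite invf_lt1 ?ltr1n.
Qed.

End power_kernels.

(** * Integrals of functions of two variables *)

Section product_integrals.
Context {R : realType}.
Notation mu := (@lebesgue_measure R).
Notation RT := (measurableTypeR R).

(** One of s and 1 - s is at least 1/2, so that its power is bounded by a
    constant: the product of two singular factors is dominated by a sum of
    factors with a single singularity each. *)
Lemma beta_kernel_bound (a b s : R) : 0 < s < 1 ->
  (1 - s) `^ a * s `^ b <=
  2 `^ (`|a| + `|b|) * (s `^ b + (1 - s) `^ a).
Proof.
have half (c r : R) : 2^-1 <= r < 1 -> r `^ c <= 2 `^ `|c|.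
  move=> /andP[r2 r1].
  have r0 : 0 < r by rewrite (lt_le_trans _ r2)// invr_gt0.
  apply: (@le_trans _ _ (r `^ (- `|c|))).
    by apply: ger_powR; [rewrite r0 /= ltW|rewrite lerNl -normrN ler_norm].
  rewrite powRN -[leRHS]invrK lef_pV2 ?posrE ?invr_gt0 ?powR_gt0//.
  rewrite -powRN -(powR_inv1 (ler0n _ 2)) in r2 *.
  rewrite -mulN1r powRrM; apply: ge0_ler_powR => //; rewrite ?nnegrE ?powR_ge0//.
  exact: ltW.
have ge1 (c d : R) : 2 `^ `|c| <= 2 `^ (`|c| + `|d|).
  by apply: ler_powR; [lra|rewrite lerDl].
move=> /andP[s0 s1]; have s10 : 0 < 1 - s by lra.
have [s2|s2] := leP 2^-1 s.
- apply: (@le_trans _ _ (2 `^ (`|a| + `|b|) * (1 - s) `^ a)).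
    rewrite mulrC ler_wpM2r ?powR_ge0// addrC; apply: le_trans (ge1 _ _).
    by apply: half; rewrite s2.
  by rewrite ler_wpM2l ?powR_ge0// lerDr powR_ge0.
- apply: (@le_trans _ _ (2 `^ (`|a| + `|b|) * s `^ b)).
    rewrite ler_wpM2r ?powR_ge0//; apply: le_trans (ge1 _ _).
    by apply: half; apply/andP; split; lra.
  by rewrite ler_wpM2l ?powR_ge0// lerDl powR_ge0.
Qed.

Lemma measurable_powR_onem (D : set RT) (a : R) : measurable_fun D (fun s : R => (1 - s) `^ a).
Proof.
apply: (@measurableT_comp _ _ _ _ _ _ (@powR R ^~ a)) => //.
by apply: measurable_funTS; apply: measurable_funB.
Qed.

Lemma integrable_beta_kernel (a b : R) : -1 < a -> -1 < b ->
  mu.-integrable `]0, 1[ (fun s => ((1 - s) `^ a * s `^ b)%:E).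
Proof.
move=> a1 b1.
have i1 := integrable_powR b1.
have i2 := integrable_reflect (integrable_powR a1).
have i3 : mu.-integrable `]0, 1[ (fun s => (2 `^ (`|a| + `|b|))%:E *
    ((s `^ b)%:E + ((1 - s) `^ a)%:E))%E.
  by apply: integrableZl => //; apply: integrableD.
apply: le_integrable i3 => //.
  apply/measurable_EFinP; apply: measurable_funM; first exact: measurable_powR_onem.
  by apply: measurable_funTS; exact: measurable_powR.
move=> s /=; rewrite in_itv/= => s01; rewrite lee_fin.
rewrite [leLHS]ger0_norm ?mulr_ge0 ?powR_ge0//.
exact: le_trans (beta_kernel_bound a b s01) (ler_norm _).
Qed.

(** Around each of its points an open set of the plane contains a rectangle
    with rational corners, and these are countably many. *)
Lemma open_measurable_prod (W : set (R * R)) : open W -> measurable (W : set (RT * RT)).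
Proof.
move=> oW.
pose F (r : rat * rat * rat * rat) : set (RT * RT) :=
  let B := (`](ratr r.1.1.1 : R), (ratr r.1.1.2 : R)[ `*` `](ratr r.1.2 : R), (ratr r.2 : R)[) in
  if pselect (B `<=` W) then B else set0.
suff -> : W = \bigcup_r F r.
  apply: countable_bigcupT_measurable => [|r]; first exact: countableP.
  rewrite /F; case: pselect => [BW|BW] //=.
  by apply: measurableX; exact: measurable_itv.
apply/seteqP; split => [[x y] Wxy|q [r _]]; last by rewrite /F; case: pselect => // BW; exact: BW.
have /nbhs_ballP[e /= e0 eW] : nbhs (x, y) W by apply: open_nbhs_nbhs.
have [p hp] : exists p : rat, ratr p \in `]x - e, x[.
  by apply: rat_in_itvoo; lra.
have [q hq] : exists q : rat, ratr q \in `]x, x + e[.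
  by apply: rat_in_itvoo; lra.
have [r hr] : exists p : rat, ratr p \in `]y - e, y[.
  by apply: rat_in_itvoo; lra.
have [s hs] : exists q : rat, ratr q \in `]y, y + e[.
  by apply: rat_in_itvoo; lra.
move: hp hq hr hs; rewrite !in_itv/= => /andP[p1 p2] /andP[q1 q2] /andP[r1 r2] /andP[s1 s2].
exists (p, q, r, s) => //; rewrite /F /=; case: pselect => [BW|nBW] /=; last first.
  case: nBW => -[x' y'] /= []; rewrite !in_itv/= => /andP[h1 h2] /andP[h3 h4].
  apply: eW; split; rewrite /ball/= ltr_distl; apply/andP; split; lra.
by split; rewrite /= in_itv/=; apply/andP; split.
Qed.

(** The superlevel sets are open. Joint measurability is the hypothesis of
    Fubini's theorem that separate continuity would not provide. *)
Lemma continuous_measurable_prod (a b c d : R) (f : R -> R -> R) :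
  (forall x y, a < x < b -> c < y < d ->
     {for (x, y), continuous (fun q : R * R => f q.1 q.2)}) ->
  measurable_fun (`]a, b[ `*` `]c, d[ : set (RT * RT)) (fun q : RT * RT => f q.1 q.2).
Proof.
move=> cf; apply: (measurability _ (RGenOInfty.measurableE R)) => _ [_ [r ->] <-].
apply: open_measurable_prod; rewrite openE => -[x y] [[/=]].
rewrite !in_itv/= andbT => xab ycd rf.
have h1 : \forall q \near (x, y), r < f q.1 q.2.
  exact: (cvgr_gt (f x y) (cf _ _ xab ycd)).
have h2 : \forall q \near (x, y), (`]a, b[ `*` `]c, d[) q.
  near=> q; split => /=.
    near: q; apply: (@cvg_fst _ _ _ _ _ (fun z => z \in `]a, b[)).
    by apply: near_in_itvoo; rewrite in_itv.
  near: q; apply: (@cvg_snd _ _ _ _ _ (fun z => z \in `]c, d[)).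
  by apply: near_in_itvoo; rewrite in_itv.
rewrite /interior; near=> q; split; first by near: q.
by rewrite /= in_itv/= andbT; near: q.
Unshelve. all: by end_near. Qed.

(** The extension of f by zero off D1 x D2 reduces this to Fubini's theorem on
    the plane. *)
Lemma Rfubini (D1 D2 : set RT) (f : R -> R -> R) :
  measurable D1 -> measurable D2 ->
  measurable_fun (D1 `*` D2 : set (RT * RT)) (fun q : RT * RT => f q.1 q.2) ->
  (forall x, D1 x -> mu.-integrable D2 (fun y => (f x y)%:E)) ->
  (forall y, D2 y -> mu.-integrable D1 (fun x => (f x y)%:E)) ->
  (\int[mu]_(x in D1) \int[mu]_(y in D2) `|f x y|%:E < +oo)%E ->
  [/\ mu.-integrable D1 (fun x => (\int[mu]_(y in D2) f x y)%:E),
      mu.-integrable D2 (fun y => (\int[mu]_(x in D1) f x y)%:E) &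
      \int[mu]_(x in D1) \int[mu]_(y in D2) f x y =
      \int[mu]_(y in D2) \int[mu]_(x in D1) f x y].
Proof.
move=> mD1 mD2 mf i1 i2 foo.
pose F (q : RT * RT) := (((fun q => f q.1 q.2) \_ (D1 `*` D2)) q)%:E.
have mF : measurable_fun setT F.
  apply/measurable_EFinP/(measurable_restrictT _ _).1 => //.
  exact: measurableX.
have FE x y : F (x, y) = (((fun x => ((fun y => (f x y)%:E) \_ D2) y) \_ D1) x).
  by rewrite /F !patchE in_setX /=; case: (x \in D1); case: (y \in D2).
have FE' x y : F (x, y) = (((fun y => ((fun x => (f x y)%:E) \_ D1) x) \_ D2) y).
  by rewrite /F !patchE in_setX /=; case: (x \in D1); case: (y \in D2).
have in1 x : (\int[mu]_y F (x, y) = ((fun x => (\int[mu]_(y in D2) f x y)%:E) \_ D1) x)%E.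
  rewrite patchE; case: ifPn => [xD1|xD1].
    have /set_mem hx := xD1.
    rewrite /Rintegral fineK; last exact: (integrable_fin_num mD2 (i1 _ hx)).
    rewrite [RHS]integral_mkcond; apply: eq_integral => y _.
    by rewrite FE patchE xD1.
  by apply: integral0_eq => y _; rewrite FE patchE (negbTE xD1).
have in2 y : (\int[mu]_x F (x, y) = ((fun y => (\int[mu]_(x in D1) f x y)%:E) \_ D2) y)%E.
  rewrite patchE; case: ifPn => [yD2|yD2].
    have /set_mem hy := yD2.
    rewrite /Rintegral fineK; last exact: (integrable_fin_num mD1 (i2 _ hy)).
    rewrite [RHS]integral_mkcond; apply: eq_integral => x _.
    by rewrite FE' patchE yD2.
  by apply: integral0_eq => x _; rewrite FE' patchE (negbTE yD2).
have iF : (mu \x mu)%E.-integrable setT F.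
  apply/(integrable12ltyP _ _ mF); apply: le_lt_trans foo.
  rewrite [leRHS]integral_mkcond le_eqVlt; apply/orP; left; apply/eqP.
  apply: eq_integral => x _; rewrite patchE; case: ifPn => xD1.
    rewrite [RHS]integral_mkcond; apply: eq_integral => y _.
    by rewrite FE !patchE xD1; case: ifP => //=; rewrite normr0.
  by apply: integral0_eq => y _; rewrite FE patchE (negbTE xD1) /= normr0.
split.
- apply/(integrable_mkcond _ mD1).
  by have := integrable_fubini_F iF; apply: eq_integrable => // x _; rewrite /fubini_F in1.
- apply/(integrable_mkcond _ mD2).
  have : mu.-integrable setT (fubini_G mu F).
    apply/integrableP; split; first exact: (measurable_fubini_G iF).
    have /integrable21ltyP := iF => /(_ mF); apply: le_lt_trans.
    apply: ge0_le_integral => //.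
    - by apply: measurableT_comp => //; exact: (measurable_fubini_G iF).
    - apply: (measurable_fun_fubini_tonelli_G (abse \o F)) => //=.
      exact: measurableT_comp.
    - move=> y _; apply: le_abse_integral => //.
      exact: (measurable_fun_pair1 y mF).
  by apply: eq_integrable => // x _; rewrite /fubini_G in2.
- have := Fubini iF; rewrite (eq_integral _ _ (fun x _ => in1 x)) (eq_integral _ _ (fun x _ => in2 x)).
  by rewrite -!integral_mkcond => h; rewrite [LHS]/Rintegral h.
Qed.

End product_integrals.

(** * Integrable functions of one variable *)

Section integrals.
Context {R : realType}.
Notation mu := (@lebesgue_measure R).
Notation RT := (measurableTypeR R).
Implicit Types (f g : R -> R) (a b c d k x t : R).

Lemma integrable_mulr (D : set RT) f k : measurable D ->
  mu.-integrable D (fun t => (f t)%:E) -> mu.-integrable D (fun t => (f t * k)%:E).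
Proof.
move=> mD /(integrableZl mD k); apply: eq_integrable => // t _.
by rewrite -EFinM mulrC.
Qed.

Lemma integrable_mull (D : set RT) f k : measurable D ->
  mu.-integrable D (fun t => (f t)%:E) -> mu.-integrable D (fun t => (k * f t)%:E).
Proof.
by move=> mD /(integrable_mulr k mD); apply: eq_integrable => // t _; rewrite mulrC.
Qed.

Lemma integrable_subr (D : set RT) f g : measurable D ->
  mu.-integrable D (fun t => (f t)%:E) -> mu.-integrable D (fun t => (g t)%:E) ->
  mu.-integrable D (fun t => (f t - g t)%:E).
Proof.
by move=> mD i1 /(integrableB mD i1); apply: eq_integrable => // t _; rewrite EFinB.
Qed.

Lemma Rint_sub (D : set RT) f g : measurable D ->
  mu.-integrable D (fun t => (f t)%:E) -> mu.-integrable D (fun t => (g t)%:E) ->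
  \int[mu]_(t in D) (f t - g t) = \int[mu]_(t in D) f t - \int[mu]_(t in D) g t.
Proof. by move=> mD i1 i2; rewrite RintegralB. Qed.

Lemma Rint_scale (D : set RT) f k : measurable D ->
  mu.-integrable D (fun t => (f t)%:E) ->
  \int[mu]_(t in D) (k * f t) = k * \int[mu]_(t in D) f t.
Proof. by move=> mD i1; rewrite RintegralZl. Qed.

Lemma Rint_fin (D : set RT) f : measurable D ->
  mu.-integrable D (fun t => (f t)%:E) ->
  ((\int[mu]_(t in D) f t)%:E = \int[mu]_(t in D) (f t)%:E)%E.
Proof. by move=> mD i1; rewrite /Rintegral fineK//; exact: integrable_fin_num. Qed.

Lemma Rint_eq0 (D : set RT) f : measurable D -> (forall t, D t -> f t = 0) ->
  \int[mu]_(t in D) f t = 0.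
Proof.
move=> mD f0; rewrite -[RHS](mul0r (fine (mu D))) -(Rintegral_cst _ mD).
by apply: eq_Rintegral => t; rewrite inE => /f0.
Qed.

Lemma integrable_dom (D : set RT) f g : measurable D -> measurable_fun D f ->
  mu.-integrable D (fun t => (g t)%:E) -> (forall t, D t -> `|f t| <= g t) ->
  mu.-integrable D (fun t => (f t)%:E).
Proof.
move=> mD mf ig fg; apply: le_integrable ig => //; first exact/measurable_EFinP.
by move=> t Dt; rewrite lee_fin; exact: le_trans (fg _ Dt) (ler_norm _).
Qed.

Lemma Rint_dom (D : set RT) f g : measurable D -> measurable_fun D f ->
  mu.-integrable D (fun t => (g t)%:E) -> (forall t, D t -> `|f t| <= g t) ->
  `|\int[mu]_(t in D) f t| <= \int[mu]_(t in D) g t.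
Proof.
move=> mD mf ig fg; have jf := integrable_dom mD mf ig fg.
apply: le_trans (le_normr_Rintegral mD jf) _.
rewrite -lee_fin !Rint_fin//; last exact: (integrable_norm jf).
apply: ge0_le_integral => //.
- by apply/measurable_EFinP; apply: measurableT_comp.
- exact: (measurable_int _ ig).
Qed.

Lemma integrable_cst_itv a b k : mu.-integrable `]a, b[ (fun=> k%:E).
Proof.
apply/integrableP; split; first exact: measurable_cst.
rewrite integral_cst//= lebesgue_measure_itv/=; case: ifP => _.
  by rewrite -EFinB -EFinM ltry.
by rewrite mule0.
Qed.

Lemma Rint_le (D : set RT) f g : measurable D ->
  mu.-integrable D (fun t => (f t)%:E) ->
  mu.-integrable D (fun t => (g t)%:E) ->
  (forall t, D t -> f t <= g t) ->
  \int[mu]_(t in D) f t <= \int[mu]_(t in D) g t.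
Proof. by move=> mD i1 i2 fg; apply: le_Rintegral. Qed.

Lemma integrable_sub (D E : set RT) f : measurable E -> measurable D ->
  D `<=` E -> mu.-integrable E (fun t => (f t)%:E) ->
  mu.-integrable D (fun t => (f t)%:E).
Proof. by move=> mE mD DE; exact: integrableS. Qed.

Lemma Rint_split f a c b : a < c -> c < b ->
  mu.-integrable `]a, b[ (fun y => (f y)%:E) ->
  \int[mu]_(y in `]a, b[) f y =
  \int[mu]_(y in `]a, c[) f y + \int[mu]_(y in `]c, b[) f y.
Proof.
move=> ac cb if_.
have := @Rintegral_itvB R f (BRight a) (BLeft b) c if_.
rewrite !bnd_simp => /(_ (ltW ac) cb) <-.
rewrite -Rintegral_itv_bndo_bndc; first by rewrite addrC subrK.
apply: integrable_sub if_ => // y /=; rewrite !in_itv/= => /andP[-> yc].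
exact: lt_trans cb.
Qed.

Lemma open_itv_continuous_integrable f a b c d : c < a -> b < d ->
  (forall y, c < y < d -> {for y, continuous f}) ->
  mu.-integrable `]a, b[ (fun y => (f y)%:E).
Proof.
move=> ca bd cf.
have : mu.-integrable `[a, b] (fun y => (f y)%:E).
  apply: continuous_compact_integrable; first exact: segment_compact.
  apply: continuous_in_subspaceT => y; rewrite inE/= in_itv/= => /andP[ay yb].
  by apply: cf; rewrite (lt_le_trans ca)// (le_lt_trans yb).
by apply: integrable_sub => //; exact: subset_itv_oo_cc.
Qed.

End integrals.

(** * Convolution on the half line *)

Section convolution.
Context {R : realType}.
Notation mu := (@lebesgue_measure R).
Notation RT := (measurableTypeR R).
Implicit Types (a b c f g : R -> R) (x t r : R).

Definition conv a b x := \int[mu]_(t in `]0, x[) (a (x - t) * b t).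

Definition convable a b x :=
  mu.-integrable `]0, x[ (fun t => (a (x - t) * b t)%:E).

Lemma measurable_sub (D : set RT) x f : measurable_fun [set: RT] f -> measurable_fun D (fun t => f (x - t)).
Proof.
by move=> mf; apply: (@measurableT_comp _ _ _ _ _ _ f) => //; apply: measurable_funB.
Qed.

Lemma convC a b x : measurable_fun [set: RT] a -> measurable_fun [set: RT] b ->
  conv a b x = conv b a x.
Proof.
move=> ma mb; rewrite /conv /Rintegral.
rewrite -(@integral_reflect _ x (fun t => (b (x - t) * a t)%:E)).
  by congr fine; apply: eq_integral => t _; rewrite subKr mulrC.
by apply/measurable_EFinP; apply: measurable_funM; [exact: measurable_sub|exact: measurable_funTS].
Qed.

Lemma eq_conv a b a' b' x : {in `]0, x[, a =1 a'} -> {in `]0, x[, b =1 b'} ->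
  conv a b x = conv a' b' x.
Proof.
move=> aa bb; apply: eq_Rintegral => t; rewrite inE/= => t0x.
rewrite bb// aa//; move: t0x; rewrite !in_itv/= => /andP[h1 h2].
by apply/andP; split; lra.
Qed.

Lemma eq_convable a b a' b' x : {in `]0, x[, a =1 a'} -> {in `]0, x[, b =1 b'} ->
  convable a b x -> convable a' b' x.
Proof.
move=> aa bb; apply: eq_integrable => // t; rewrite inE/= => t0x.
rewrite bb// aa//; move: t0x; rewrite !in_itv/= => /andP[h1 h2].
by apply/andP; split; lra.
Qed.

Lemma integral_after r x (g : RT -> \bar R) : 0 <= r -> measurable_fun `]r, x[ g ->
  (\int[mu]_(t in `]0%R, x[) ((g \_ `]r, +oo[) t) =
   \int[mu]_(t in `]0%R, (x - r)%R[) g (t + r)%R)%E.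
Proof.
move=> r0 mg; rewrite -integral_mkcondr -integral_shift//; congr integral.
apply/seteqP; split => t /=; rewrite !in_itv/= ?andbT.
  by move=> [/andP[_ ->] ->].
by move=> /andP[rt ->]; rewrite rt (le_lt_trans r0 rt).
Qed.

(** Fubini's theorem on the triangle r < t < x: translating t by r turns the
    inner integral into a convolution. The last hypothesis is the absolute
    convergence of the double integral. *)
Lemma convA a b c x : measurable_fun [set: RT] a -> measurable_fun [set: RT] b ->
  measurable_fun [set: RT] c ->
  (forall t, 0 < t < x -> convable b c t) ->
  (forall t, 0 < t < x -> convable a b t) ->
  convable (conv (Num.norm \o a) (Num.norm \o b)) (Num.norm \o c) x ->
  convable a (conv b c) x /\ conv a (conv b c) x = conv (conv a b) c x.
Proof.
move=> ma mb mc bc ab abc.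
(* with b cut off at 0 the integrand vanishes outside the triangle r < t *)
pose b' := b \_ `]0, +oo[.
have mb' : measurable_fun [set: RT] b' by apply/(measurable_restrictT _ _).1 => //; exact: measurable_funTS.
pose f r t := a (x - t) * b' (t - r) * c r.
have b'E t r : b' (t - r) = ((fun t => b (t - r)) \_ `]r, +oo[) t.
  by rewrite /b' !patchE !mem_setE !in_itv/= !andbT subr_gt0.
have fE r t : f r t = ((fun t => a (x - t) * b (t - r) * c r) \_ `]r, +oo[) t.
  by rewrite /f b'E !patchE; case: ifP => // _; rewrite mulr0 mul0r.
have fE' r t : f r t = ((fun r => a (x - t) * (b (t - r) * c r)) \_ `]-oo, t[) r.
  rewrite /f b'E !patchE !mem_setE !in_itv/= andbT mulrA.
  by case: ifP => // _; rewrite mulr0 mul0r.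
have mabc r : measurable_fun setT (fun t : RT => a (x - t) * b (t - r) * c r).
  apply: measurable_funM => //; apply: measurable_funM; first exact: measurable_sub.
  by apply: (@measurableT_comp _ _ _ _ _ _ b) => //; apply: measurable_funB.
have i1 r : `]0, x[%classic r -> mu.-integrable `]0, x[ (fun t => (f r t)%:E).
  rewrite /= in_itv/= => /andP[r0 rx].
  apply/integrableP; split.
    apply/measurable_EFinP; apply: measurable_funTS; apply: measurable_funM => //.
    apply: measurable_funM; first exact: measurable_sub.
    by apply: (@measurableT_comp _ _ _ _ _ _ b') => //; apply: measurable_funB.
  have /integrableP[_] : mu.-integrable `]0, x - r[ (fun t => ((a (x - r - t) * b t) * c r)%:E).
    by apply: integrable_mulr => //; apply: ab; apply/andP; split; lra.
  congr (_ < _)%E.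
  transitivity (\int[mu]_(t in `]0%R, x[) (((fun t => `|a (x - t)%R * b (t - r)%R * c r|%:E) \_ `]r, +oo[) t))%E.
    rewrite integral_after ?ltW//; last first.
      by apply/measurable_EFinP; apply: measurable_funTS; exact: (measurableT_comp (@normr_measurable R setT) (mabc r)).
    apply: eq_integral => t _ /=.
    by congr ((`|_ * _ * _|)%:E); [congr a; ring|congr b; ring].
  by apply: eq_integral => t _; rewrite fE !patchE; case: ifP => //= _; rewrite normr0.
have cutE (t : R) : 0 < t < x -> `]0, x[%classic `&` `]-oo, t[ = `]0, t[%classic.
  move=> /andP[t0 tx]; apply/seteqP; split => r /=; rewrite !in_itv/=.
    by move=> [/andP[-> _] ->].
  by move=> /andP[-> rt]; rewrite rt (lt_trans rt tx).
have i2 t : `]0, x[%classic t -> mu.-integrable `]0, x[ (fun r => (f r t)%:E).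
  rewrite /= in_itv/= => t0x.
  have -> : (fun r => (f r t)%:E) = ((fun r => (a (x - t))%:E * (b (t - r) * c r)%:E)%E \_ `]-oo, t[).
    by apply/funext => r; rewrite fE' !patchE; case: ifP.
  apply/integrable_restrict => //; rewrite cutE//.
  by apply: integrableZl => //; exact: bc.
have int1 r : 0 < r < x -> \int[mu]_(t in `]0, x[) f r t = conv a b (x - r) * c r.
  move=> /andP[r0 rx].
  rewrite /conv -RintegralZr//; last by apply: ab; apply/andP; split; lra.
  rewrite /Rintegral; congr fine.
  transitivity (\int[mu]_(t in `]0%R, x[) (((fun t => (a (x - t)%R * b (t - r)%R * c r)%:E) \_ `]r, +oo[) t))%E.
    by apply: eq_integral => t _; rewrite fE !patchE; case: ifP.
  rewrite integral_after ?ltW//; last by apply/measurable_EFinP; apply: measurable_funTS; exact: (mabc r).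
  apply: eq_integral => t _; congr ((_ * _ * _)%:E); [congr a; ring|congr b; ring].
have int2 t : 0 < t < x -> \int[mu]_(r in `]0, x[) f r t = a (x - t) * conv b c t.
  move=> t0x; rewrite /conv -RintegralZl//; last exact: bc.
  rewrite -(cutE t t0x) Rintegral_mkcondr.
  by apply: eq_Rintegral => r _; rewrite fE'.
have mf : measurable_fun (`]0, x[ `*` `]0, x[ : set (RT * RT)) (fun q : RT * RT => f q.1 q.2).
  apply: measurable_funTS; rewrite /f; apply: measurable_funM.
    apply: measurable_funM.
      by apply: (measurableT_comp ma); apply: measurable_funB.
    by apply: (measurableT_comp mb'); apply: measurable_funB.
  by apply: (measurableT_comp mc); exact: measurable_fst.
have intabs r : 0 < r < x -> (\int[mu]_(t in `]0%R, x[) `|f r t|%:E =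
    (conv (Num.norm \o a) (Num.norm \o b) (x - r) * `|c r|)%:E)%E.
  move=> /andP[r0 rx].
  have iab : mu.-integrable `]0, x - r[ (fun t => (`|a (x - r - t)| * `|b t|)%:E).
    have /integrable_norm : mu.-integrable `]0, x - r[ (EFin \o (fun t => a (x - r - t) * b t)).
      by apply: ab; apply/andP; split; lra.
    by apply: eq_integrable => // t _; rewrite /= normrM.
  rewrite /conv -RintegralZr//.
  rewrite /Rintegral fineK; last first.
    by apply: integrable_fin_num => //; exact: integrable_mulr.
  transitivity (\int[mu]_(t in `]0%R, x[) (((fun t => `|a (x - t)%R * b (t - r)%R * c r|%:E) \_ `]r, +oo[) t))%E.
    by apply: eq_integral => t _; rewrite fE !patchE; case: ifP => //= _; rewrite normr0.
  rewrite integral_after ?ltW//; last first.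
    by apply/measurable_EFinP; apply: measurable_funTS; exact: (measurableT_comp (@normr_measurable R setT) (mabc r)).
  apply: eq_integral => t _; rewrite /= !normrM.
  by rewrite addrK (_ : x - (t + r) = x - r - t)//; ring.
have foo : (\int[mu]_(r in `]0%R, x[) \int[mu]_(t in `]0%R, x[) `|f r t|%:E < +oo)%E.
  have /integrableP[_] := abc; apply: le_lt_trans; rewrite le_eqVlt; apply/orP; left; apply/eqP.
  apply: eq_integral => r; rewrite inE/= in_itv/= => r0x.
  rewrite intabs//=; congr EFin; rewrite [RHS]ger0_norm//; apply: mulr_ge0 => //.
  by apply: Rintegral_ge0 => t _; rewrite mulr_ge0 /=.
have [iF iG FG] := @Rfubini _ `]0, x[ `]0, x[ f (measurable_itv _) (measurable_itv _) mf i1 i2 foo.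
- split.
    apply: eq_integrable iG => // t; rewrite inE/= in_itv/= => t0x.
    by rewrite int2.
  transitivity (\int[mu]_(t in `]0, x[) \int[mu]_(r in `]0, x[) f r t).
    by apply: eq_Rintegral => t; rewrite inE/= in_itv/= => t0x; rewrite int2.
  rewrite -FG; apply: eq_Rintegral => r; rewrite inE/= in_itv/= => r0x.
  by rewrite int1.
Qed.

End convolution.

(** * Abel integral equations *)

Section power_convolution.
Context {R : realType}.
Notation mu := (@lebesgue_measure R).
Notation RT := (measurableTypeR R).
Implicit Types (a b c x t M : R) (f g : R -> R).

Definition pow a : R -> R := fun t => t `^ a.

(** Euler's beta function with both arguments shifted by one, B(a+1, b+1). *)
Definition beta a b := \int[mu]_(s in `]0, 1[) ((1 - s) `^ a * s `^ b).

Lemma measurable_pow a : measurable_fun [set: RT] (pow a).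
Proof. exact: measurable_powR. Qed.

Lemma norm_pow a : Num.norm \o pow a = pow a.
Proof. by apply/funext => t /=; rewrite ger0_norm ?powR_ge0. Qed.

Lemma beta_kernel_scale a b x s : 0 < x -> 0 < s < 1 ->
  (x - x * s) `^ a * (x * s) `^ b = x `^ (a + b) * ((1 - s) `^ a * s `^ b).
Proof.
move=> x0 /andP[s0 s1].
rewrite -{1}(mulr1 x) -mulrBr !powRM ?subr_ge0 ?(ltW x0) ?(ltW s0) ?(ltW s1)//.
rewrite powRD; last by rewrite (gt_eqF x0) implybT.
by ring.
Qed.

Lemma convable_pow a b x : -1 < a -> -1 < b -> 0 < x -> convable (pow a) (pow b) x.
Proof.
move=> a1 b1 x0; rewrite /convable /pow.
have -> : `]0, x[%classic = `]0, x * 1[%classic :> set R by rewrite mulr1.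
apply/integrable_scale => //.
have := integrable_mull (x `^ (a + b)) (measurable_itv _) (integrable_beta_kernel a1 b1).
apply: eq_integrable => // s; rewrite inE/= in_itv/= => s01.
by rewrite beta_kernel_scale.
Qed.

(** Scaling t = x s makes the domain of integration independent of x. *)
Lemma conv_pow a b x : -1 < a -> -1 < b -> 0 < x ->
  conv (pow a) (pow b) x = beta a b * pow (a + b + 1) x.
Proof.
move=> a1 b1 x0; rewrite /conv /pow {1}/Rintegral.
have -> : `]0, x[%classic = `]0, x * 1[%classic :> set R by rewrite mulr1.
rewrite integral_scale//; last first.
  apply/measurable_EFinP; apply: measurable_funM.
    by apply: measurable_funTS; exact: (measurable_sub (D := setT) x (measurable_pow a)).
  by apply: measurable_funTS; exact: measurable_pow.
transitivity (fine (x%:E * (x `^ (a + b) * beta a b)%:E)%E); last first.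
  rewrite -EFinM /=.
  rewrite [x `^ (a + b + 1)]powRD; last by rewrite (gt_eqF x0) implybT.
  rewrite (powRr1 (ltW x0)) powRD; last by rewrite (gt_eqF x0) implybT.
  by ring.
congr (fine (_ * _)%E).
rewrite /beta -RintegralZl//; last exact: integrable_beta_kernel.
rewrite /Rintegral fineK; last first.
  by apply: integrable_fin_num => //; apply: integrable_mull => //; exact: integrable_beta_kernel.
by apply: eq_integral => s; rewrite inE/= in_itv/= => s01; rewrite beta_kernel_scale.
Qed.

Lemma betaC a b : -1 < a -> -1 < b -> beta a b = beta b a.
Proof.
move=> a1 b1; have := convC 1 (measurable_pow a) (measurable_pow b).
by rewrite (conv_pow a1 b1 ltr01) (conv_pow b1 a1 ltr01) /pow !powR1 !mulr1.
Qed.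

(** The integrand is at least 1 when both exponents are nonpositive; so the
    constant that appears in the Abel inversion does not vanish. *)
Lemma beta_ge1 a b : -1 < a <= 0 -> -1 < b <= 0 -> 1 <= beta a b.
Proof.
move=> /andP[a1 a0] /andP[b1 b0].
have -> : 1 = \int[mu]_(s in `]0, 1[) 1 :> R.
  rewrite Rintegral_cst//= lebesgue_measure_itv/= lte_fin ltr01.
  by rewrite oppr0 adde0 mul1r.
apply: le_Rintegral => //.
- apply: (@eq_integrable _ _ _ _ _ _ (fun t : RT => (t `^ 0)%:E)) => //.
    by move=> t _; rewrite powRr0.
  by apply: integrable_powR; lra.
- exact: integrable_beta_kernel.
- move=> s /=; rewrite in_itv/= => /andP[s0 s1].
  have ge1 (r c : R) : 0 < r -> r < 1 -> c <= 0 -> 1 <= r `^ c.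
    by move=> r0 r1 c0; rewrite -(powRr0 r); apply: ger_powR => //; rewrite r0 ltW.
  by rewrite -[1]mulr1 ler_pM// ge1//; lra.
Qed.

Lemma convable_dom a g c M x : -1 < a -> -1 < c -> 0 < x ->
  measurable_fun `]0, x[ g ->
  (forall t, 0 < t < x -> `|g t| <= M * t `^ c) ->
  convable (pow a) g x.
Proof.
move=> a1 c1 x0 mg gM.
have := integrable_mulr M (measurable_itv _) (convable_pow a1 c1 x0).
apply: le_integrable => //.
  apply/measurable_EFinP; apply: measurable_funM => //.
  by apply: measurable_sub; exact: measurable_pow.
move=> t; rewrite /= in_itv/= => t0x; rewrite lee_fin normrM.
apply: le_trans (ler_norm _).
rewrite (ger0_norm (powR_ge0 _ _)) -mulrA ler_wpM2l ?powR_ge0//.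
by rewrite mulrC; exact: gM.
Qed.

(** The semigroup law of fractional integration, up to the normalisation by
    Gamma values. *)
Lemma conv_conv_pow a b c M g x : -1 < a -> -1 < b -> -1 < c -> 0 < x ->
  measurable_fun [set: RT] g ->
  (forall t, 0 < t < x -> `|g t| <= M * t `^ c) ->
  convable (pow a) (conv (pow b) g) x /\
  conv (pow a) (conv (pow b) g) x = beta a b * conv (pow (a + b + 1)) g x.
Proof.
move=> a1 b1 c1 x0 mg gM.
have ab1 : -1 < a + b + 1 by lra.
have icg : convable (pow (a + b + 1)) g x by apply: (@convable_dom _ _ c M) => //; exact: measurable_funTS.
have [||||||h1 h2] := @convA _ (pow a) (pow b) g x; rewrite //.
- exact: measurable_pow.
- exact: measurable_pow.
- move=> t /andP[t0 tx]; apply: (@convable_dom _ _ c M) => //; first exact: measurable_funTS.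
  by move=> r /andP[r0 rt]; apply: gM; rewrite r0 (lt_trans rt).
- by move=> t /andP[t0 tx]; exact: convable_pow.
- rewrite !norm_pow.
  have : convable (pow (a + b + 1)) (Num.norm \o g) x.
    apply: (@convable_dom _ _ c M) => //.
      by apply: measurableT_comp => //; exact: measurable_funTS.
    by move=> t /gM; rewrite /= normr_id.
  move=> /(integrable_mull (beta a b) (measurable_itv _)).
  apply: eq_integrable => // t; rewrite inE/= in_itv/= => /andP[t0 tx].
  by rewrite conv_pow ?subr_gt0// mulrA.
- split => //; rewrite h2.
  apply: etrans (@RintegralZl _ _ _ mu `]0, x[ _ (beta a b) (measurable_itv _) icg).
  apply: eq_Rintegral => t; rewrite inE/= in_itv/= => /andP[t0 tx].
  by rewrite conv_pow ?subr_gt0// mulrA.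
Qed.

Lemma conv0E g x : conv (pow 0) g x = \int[mu]_(t in `]0, x[) g t.
Proof. by apply: eq_Rintegral => t _; rewrite /pow powRr0 mul1r. Qed.

(** The integrand is the derivative of the primitive, which is constant. *)
Lemma integral_eq0_continuous (g : R -> R) :
  {in `]0, 1[, continuous g} ->
  (forall X, 0 < X < 1 -> mu.-integrable `]0, X[ (fun t => (g t)%:E)) ->
  (forall X, 0 < X < 1 -> \int[mu]_(t in `]0, X[) g t = 0) ->
  forall x, 0 < x < 1 -> g x = 0.
Proof.
move=> cg ig g0 x /andP[x0 x1].
pose u := (x + 1) / 2; pose v := (u + 1) / 2.
have xu : x < u by rewrite /u; lra.
have iu : mu.-integrable `]0, u] (EFin \o g).
  have : mu.-integrable `]0, v[ (fun t => (g t)%:E).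
    by apply: ig; rewrite /v /u; apply/andP; split; lra.
  apply: integrableS => // t /=; rewrite !in_itv/= => /andP[-> tu] /=.
  by apply: le_lt_trans tu _; rewrite /v /u; lra.
have x01 : x \in `]0, 1[ by rewrite in_itv/= x0 x1.
have [_ <-] := @continuous_FTC1 _ g (BRight 0) x u xu iu x0 (cg x x01).
rewrite derive1E (@near_eq_derive _ _ _ _ (cst 0)) ?derive_cst//.
near=> y.
have y01 : 0 < y < 1.
  have : y \in `]0, 1[ by near: y; exact: near_in_itvoo.
  by rewrite in_itv.
rewrite -Rintegral_itv_bndo_bndc; first exact: g0.
exact: ig.
Unshelve. all: by end_near. Qed.

Lemma continuous_mulr_arg f (y s : R) :
  {for y * s, continuous f} -> {for y, continuous (fun z : R => f (z * s))}.
Proof.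
move=> cf; apply: (@continuous_comp _ _ _ (fun z : R => z * s) f) cf.
exact: mulrr_continuous.
Qed.

Section weighted.
Variables (a b : R) (f : R -> R) (M : R).
Hypotheses (a1 : -1 < a) (b1 : -1 < b) (mf : measurable_fun [set: RT] f).
Hypothesis fM : forall t, 0 < t < 1 -> `|f t| <= M.

Lemma integrable_beta_mul x : 0 < x <= 1 ->
  mu.-integrable `]0, 1[ (fun s => ((1 - s) `^ a * s `^ b * f (x * s))%:E).
Proof.
move=> /andP[x0 x1].
apply: le_integrable (integrable_mulr M (measurable_itv _) (integrable_beta_kernel a1 b1)) => //.
  apply/measurable_EFinP; apply: measurable_funM.
    apply: measurable_funM; first exact: measurable_powR_onem.
    by apply: measurable_funTS; exact: measurable_pow.
  apply: measurable_funTS; apply: (measurableT_comp mf).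
  exact: measurable_funM.
move=> s /=; rewrite in_itv/= => /andP[s0 s1]; rewrite lee_fin !normrM.
rewrite ler_wpM2l ?mulr_ge0//; apply: le_trans (ler_norm _).
apply: fM; rewrite mulr_gt0//=.
by apply: le_lt_trans s1; rewrite ger_pMl.
Qed.

(** Scaling t = x s isolates the dependence on x; both the continuity of the
    convolution and its smallness for small x are read off the right-hand
    side. *)
Lemma conv_pow_weightE x : 0 < x <= 1 ->
  conv (pow a) (fun t => t `^ b * f t) x =
  x `^ (a + b + 1) * \int[mu]_(s in `]0, 1[) ((1 - s) `^ a * s `^ b * f (x * s)).
Proof.
move=> x01; have /andP[x0 x1] := x01.
have ibm := integrable_beta_mul x01.
have : (\int[mu]_(t in `]0%R, (x * 1)%R[) (pow a (x - t) * (t `^ b * f t))%:E =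
  x%:E * \int[mu]_(s in `]0%R, 1%R[) (x `^ (a + b) * ((1 - s) `^ a * s `^ b * f (x * s)%R))%:E)%E.
  rewrite integral_scale//; last first.
    apply/measurable_EFinP; apply: measurable_funM.
      by apply: measurable_funTS; exact: (measurable_sub (D := setT) x (measurable_pow a)).
    apply: measurable_funTS; apply: measurable_funM => //; exact: measurable_pow.
  congr (_ * _)%E; apply: eq_integral => s; rewrite inE/= in_itv/= => s01.
  by rewrite [X in X * _]/pow !mulrA beta_kernel_scale// !mulrA.
rewrite mulr1 => E; rewrite {1}/conv /Rintegral E.
have -> : x `^ (a + b + 1) = x * x `^ (a + b).
  rewrite powRD; last by rewrite (gt_eqF x0) implybT.
  by rewrite powRr1 ?ltW// mulrC.
rewrite -/(Rintegral _ _ _) -mulrA.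
have <- := @RintegralZl _ _ _ mu `]0, 1[ _ (x `^ (a + b)) (measurable_itv _) ibm.
rewrite /Rintegral fineM//.
apply: integrable_fin_num => //.
exact: (integrable_mull (x `^ (a + b)) (measurable_itv _) ibm).
Qed.

Lemma conv_pow_weight_continuous : {in `]0, 1[, continuous f} ->
  {in `]0, 1[, continuous (conv (pow a) (fun t => t `^ b * f t))}.
Proof.
move=> cf x x01; have := x01; rewrite in_itv/= => /andP[x0 x1].
pose F y := y `^ (a + b + 1) * \int[mu]_(s in `]0, 1[) ((1 - s) `^ a * s `^ b * f (y * s)).
have FE : \forall y \near x, F y = conv (pow a) (fun t => t `^ b * f t) y.
  near=> y; apply/esym/conv_pow_weightE.
  have : y \in `]0, 1[ by near: y; exact: near_in_itvoo.
  by rewrite in_itv/= => /andP[-> /ltW].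
suff cF : {for x, continuous F}.
  rewrite /prop_for /continuous_at -(nbhs_singleton FE).
  by apply: cvg_trans cF; apply: near_eq_cvg.
apply: continuousM; first exact: continuous_powR.
have := @continuity_under_integral R _ _ mu
  (fun y s => (1 - s) `^ a * s `^ b * f (y * s)) `]0, 1[ (measurable_itv _) 0 1 _ _
  (fun s => (1 - s) `^ a * s `^ b * M).
apply.
- by move=> y /=; rewrite in_itv/= => /andP[y0 /ltW y1]; apply: integrable_beta_mul; rewrite y0.
- apply: aeW => s /=; rewrite in_itv/= => /andP[s0 s1] y; rewrite inE/= in_itv/= => /andP[y0 y1].
  have cys : {for y, continuous (fun z : R => f (z * s))}.
    apply: continuous_mulr_arg.
    by apply: cf; rewrite in_itv/= mulr_gt0//= (lt_trans _ s1)// gtr_pMl.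
  exact: (cvgM (cvg_cst _) cys).
- exact: (integrable_mulr M (measurable_itv _) (integrable_beta_kernel a1 b1)).
- move=> y /=; rewrite in_itv/= => /andP[y0 y1]; apply: aeW => s /=; rewrite in_itv/= => /andP[s0 s1].
  rewrite normrM ger0_norm ?mulr_ge0 ?powR_ge0// ler_wpM2l ?mulr_ge0 ?powR_ge0//.
  by apply: fM; rewrite mulr_gt0//= (lt_trans _ s1)// gtr_pMl.
- by rewrite inE.
Unshelve. all: by end_near. Qed.

End weighted.

Lemma continuous_measurable_patch f : {in `]0, 1[, continuous f} ->
  measurable_fun [set: RT] (f \_ `]0, 1[).
Proof.
move=> cf; apply/(measurable_restrictT _ _).1 => //.
apply: open_continuous_measurable_fun; first exact: interval_open.
by move=> x; rewrite inE/=; exact: cf.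
Qed.

Lemma patch01 f x : 0 < x < 1 -> (f \_ `]0, 1[) x = f x.
Proof. by move=> x01; rewrite patchE mem_set//= in_itv. Qed.

Lemma continuous_patch f : {in `]0, 1[, continuous f} -> {in `]0, 1[, continuous (f \_ `]0, 1[)}.
Proof.
move=> cf x x01; rewrite /continuous_at patch01; last by rewrite in_itv in x01.
apply: cvg_trans (cf x x01); apply: near_eq_cvg; near=> y.
have : y \in `]0, 1[ by near: y; exact: near_in_itvoo.
by rewrite in_itv/= => y01; rewrite patch01.
Unshelve. all: by end_near. Qed.

(** Convolving both sides with t `^ (al - 1) turns them, by the semigroup law,
    into primitives of continuous functions, whose derivatives are the two
    sides of the conclusion. *)
Lemma abel_inversion (al be M : R) (m f : R -> R) :
  0 < al < 1 -> - al < be ->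
  {in `]0, 1[, continuous m} -> {in `]0, 1[, continuous f} ->
  (forall t, 0 < t < 1 -> `|m t| <= M) -> (forall t, 0 < t < 1 -> `|f t| <= M) ->
  (forall x, 0 < x < 1 ->
     conv (pow (- al)) m x = \int[mu]_(r in `]0, x[) (r `^ be * f r)) ->
  forall x, 0 < x < 1 ->
    beta (al - 1) (- al) * m x =
    x `^ (al + be) * \int[mu]_(s in `]0, 1[) ((1 - s) `^ (al - 1) * s `^ be * f (x * s)).
Proof.
move=> /andP[al0 al1] albe cm cf mM fM kmf.
pose m' := m \_ `]0, 1[; pose f' := f \_ `]0, 1[.
have mm' : measurable_fun [set: RT] m' by exact: continuous_measurable_patch.
have mf' : measurable_fun [set: RT] f' by exact: continuous_measurable_patch.
have m'M t : 0 < t < 1 -> `|m' t| <= M by move=> t01; rewrite /m' patch01//; exact: mM.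
have f'M t : 0 < t < 1 -> `|f' t| <= M by move=> t01; rewrite /f' patch01//; exact: fM.
pose wf := fun t => t `^ be * f' t.
have mwf : measurable_fun [set: RT] wf.
  by apply: measurable_funM => //; exact: measurable_pow.
have wfM t : 0 < t < 1 -> `|wf t| <= M * t `^ be.
  move=> t01; rewrite normrM (ger0_norm (powR_ge0 _ _)) mulrC ler_wpM2r ?powR_ge0//.
  exact: f'M.
have al11 : -1 < al - 1 by lra.
have Nal1 : -1 < - al by lra.
have be1 : -1 < be by lra.
have z1 : -1 < 0 :> R by lra.
have sub1 (t X : R) : 0 < X < 1 -> 0 < t < X -> 0 < t < 1.
  by move=> /andP[_ X1] /andP[-> tX] /=; exact: lt_trans X1.
have km' x : 0 < x < 1 -> conv (pow (- al)) m' x = conv (pow 0) wf x.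
  move=> x01; rewrite conv0E (@eq_conv _ _ _ (pow (- al)) m)//; last first.
    by move=> t; rewrite in_itv/= => /(sub1 _ _ x01) t01; rewrite /m' patch01.
  rewrite kmf//; apply: eq_Rintegral => t; rewrite inE/= in_itv/= => /(sub1 _ _ x01) t01.
  by rewrite /wf /f' patch01.
have H X : 0 < X < 1 ->
    beta (al - 1) (- al) * \int[mu]_(t in `]0, X[) m' t =
    \int[mu]_(t in `]0, X[) conv (pow (al - 1)) wf t /\
    mu.-integrable `]0, X[ (fun t => (conv (pow (al - 1)) wf t)%:E).
  move=> X01; have /andP[X0 X1] := X01.
  have m'MX t : 0 < t < X -> `|m' t| <= M * t `^ 0.
    by move=> /(sub1 _ _ X01); rewrite powRr0 mulr1; exact: m'M.
  have wfMX t : 0 < t < X -> `|wf t| <= M * t `^ be.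
    by move=> /(sub1 _ _ X01); exact: wfM.
  have [_ E1] := conv_conv_pow al11 Nal1 z1 X0 mm' m'MX.
  have [_ E2] := conv_conv_pow al11 z1 be1 X0 mwf wfMX.
  have e1 : al - 1 + 0 + 1 = 0 + (al - 1) + 1 by ring.
  have e2 : al - 1 - al + 1 = 0 by ring.
  rewrite e1 in E2; rewrite e2 in E1.
  have [I3 E3] := conv_conv_pow z1 al11 be1 X0 mwf wfMX.
  split; last first.
    by apply: eq_integrable I3 => // t _; rewrite /pow powRr0 mul1r.
  rewrite -!conv0E E3 (betaC z1 al11).
  have -> : beta (al - 1) 0 * conv (pow (0 + (al - 1) + 1)) wf X = conv (pow (al - 1)) (conv (pow 0) wf) X.
    by rewrite E2.
  have -> : conv (pow (al - 1)) (conv (pow 0) wf) X = conv (pow (al - 1)) (conv (pow (- al)) m') X.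
    by apply: eq_conv => // t; rewrite in_itv/= => /(sub1 _ _ X01) t01; rewrite km'.
  by rewrite E1.
have im' X : 0 < X < 1 -> mu.-integrable `]0, X[ (fun t => (m' t)%:E).
  move=> X01; have /andP[X0 X1] := X01.
  have : convable (pow 0) m' X.
    apply: (@convable_dom _ _ 0 M) => //; first exact: measurable_funTS.
    by move=> t /(sub1 _ _ X01); rewrite powRr0 mulr1; exact: m'M.
  by apply: eq_integrable => // t _; rewrite /pow powRr0 mul1r.
move=> x x01; have /andP[x0 x1] := x01.
have := @integral_eq0_continuous (fun t => beta (al - 1) (- al) * m' t - conv (pow (al - 1)) wf t).
move=> /(_ _ _ _ x x01) => G.
have E : beta (al - 1) (- al) * m' x - conv (pow (al - 1)) wf x = 0.
  apply: G.
  - move=> y y01; apply: cvgB.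
      by apply: cvgM; [exact: cvg_cst|exact: continuous_patch].
    exact: (conv_pow_weight_continuous al11 be1 mf' f'M (continuous_patch cf)).
  - move=> X X01; have [_ I3] := H X X01.
    apply: integrable_subr => //; apply: integrable_mull => //; exact: im'.
  - move=> X X01; have [E3 I3] := H X X01.
    rewrite RintegralB//; last by apply: integrable_mull => //; exact: im'.
    by rewrite RintegralZl ?E3 ?subrr//; exact: im'.
have mE : m x = m' x by rewrite /m' patch01.
rewrite mE; move/eqP: E; rewrite subr_eq0 => /eqP ->.
rewrite (conv_pow_weightE al11 be1 mf' f'M); last by rewrite x0 ltW.
congr (_ `^ _ * _); first by ring.
apply: eq_Rintegral => s; rewrite inE/= in_itv/= => /andP[s0 s1].
by rewrite /f' patch01// mulr_gt0//= (lt_trans _ s1)// gtr_pMl.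
Qed.

End power_convolution.

(** * Bounded continuous functions on the unit interval *)

Section bounded_continuous.
Context {R : realType}.
Notation mu := (@lebesgue_measure R).
Notation RT := (measurableTypeR R).
Implicit Types (f g phi psi : R -> R).

(** The test functions for the spatial variable. *)
Definition bcont phi := {in `]0, 1[, continuous phi} /\
  exists M, forall y, 0 < y < 1 -> `|phi y| <= M.

Definition ip phi psi := \int[mu]_(y in `]0, 1[) (phi y * psi y).

Lemma bcont_measurable phi : bcont phi -> measurable_fun (`]0, 1[ : set RT) phi.
Proof.
move=> [c _]; apply: open_continuous_measurable_fun; first exact: interval_open.
by move=> x; rewrite inE/=; exact: c.
Qed.

Lemma bcont_integrable phi : bcont phi -> mu.-integrable `]0, 1[ (fun y => (phi y)%:E).
Proof.
move=> bphi; have [_ [M phiM]] := bphi.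
apply: le_integrable (integrable_cst_itv 0 1 M) => //.
  by apply/measurable_EFinP; exact: bcont_measurable.
move=> y /=; rewrite in_itv/= => y01; rewrite lee_fin.
exact: le_trans (phiM _ y01) (ler_norm _).
Qed.

Lemma bcontM phi psi : bcont phi -> bcont psi -> bcont (fun y => phi y * psi y).
Proof.
move=> [c1 [M h1]] [c2 [N h2]]; split.
  by move=> y y01; apply: cvgM; [exact: c1|exact: c2].
exists (M * N) => y y01; rewrite normrM; apply: ler_pM => //; [exact: h1|exact: h2].
Qed.

Lemma bcontZ (k : R) phi : bcont phi -> bcont (fun y => k * phi y).
Proof.
move=> [c1 [M h1]]; split.
  by move=> y y01; apply: cvgM; [exact: cvg_cst|exact: c1].
exists (`|k| * M) => y y01; rewrite normrM ler_wpM2l//; exact: h1.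
Qed.

Lemma ipC phi psi : ip phi psi = ip psi phi.
Proof. by apply: eq_Rintegral => y _; rewrite mulrC. Qed.

Lemma ip_sub_scale phi psi (t : R) : bcont phi -> bcont psi ->
  ip (fun y => phi y - t * psi y) (fun y => phi y - t * psi y) =
  ip phi phi - 2 * t * ip phi psi + t ^+ 2 * ip psi psi.
Proof.
move=> b1 b2.
have i11 := bcont_integrable (bcontM b1 b1).
have i12 := bcont_integrable (bcontM b1 b2).
have i22 := bcont_integrable (bcontM b2 b2).
have E : ip (fun y => phi y - t * psi y) (fun y => phi y - t * psi y) =
    \int[mu]_(y in `]0, 1[) ((phi y * phi y - 2 * t * (phi y * psi y)) - (- t ^+ 2) * (psi y * psi y)).
  by apply: eq_Rintegral => y _; ring.
rewrite E.
have j12 := integrable_mull (2 * t) (measurable_itv _) i12.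
have j22 := integrable_mull (- t ^+ 2) (measurable_itv _) i22.
rewrite (Rint_sub (measurable_itv _) (integrable_subr (measurable_itv _) i11 j12) j22).
rewrite (Rint_sub (measurable_itv _) i11 j12).
rewrite (Rint_scale _ (measurable_itv _) i12) (Rint_scale _ (measurable_itv _) i22).
by rewrite /ip; ring.
Qed.

Lemma ip_ge0 phi : 0 <= ip phi phi.
Proof. by apply: Rintegral_ge0 => y _; rewrite -expr2 sqr_ge0. Qed.

(** The square of phi is continuous and has vanishing integral over every
    interval. *)
Lemma ip_eq0 phi : bcont phi -> ip phi phi = 0 -> forall y, 0 < y < 1 -> phi y = 0.
Proof.
move=> b h y y01; apply/eqP; rewrite -sqrf_eq0 expr2; apply/eqP.
have bb := bcontM b b.
have iX (X : R) : 0 < X < 1 -> mu.-integrable `]0, X[ (fun y => (phi y * phi y)%:E).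
  move=> /andP[X0 X1]; have := bcont_integrable bb.
  by apply: integrableS => // z /=; rewrite !in_itv/= => /andP[-> /lt_trans ->].
apply: (@integral_eq0_continuous _ (fun y => phi y * phi y)) => //.
- by case: bb.
- move=> X X01; apply/eqP; rewrite eq_le; apply/andP; split; last first.
    by apply: Rintegral_ge0 => z _; rewrite -expr2 sqr_ge0.
  rewrite -[leRHS]h /ip -lee_fin Rint_fin//; last exact: iX.
  rewrite Rint_fin//; last exact: bcont_integrable.
  apply: ge0_subset_integral => //.
  + by have /measurable_int := bcont_integrable bb; exact.
  + by move=> z _; rewrite lee_fin -expr2 sqr_ge0.
  + by case/andP: X01 => X0 X1 z /=; rewrite !in_itv/= => /andP[-> /lt_trans ->].
Qed.

End bounded_continuous.

Section dominated_fubini.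
Context {R : realType}.
Notation mu := (@lebesgue_measure R).
Notation RT := (measurableTypeR R).

(** A majorant that is a product of integrable functions yields all the
    integrability needed for Fubini's theorem. *)
Lemma Rfubini_dom (D1 D2 : set RT) (f : R -> R -> R) (a b : R -> R) :
  measurable D1 -> measurable D2 ->
  measurable_fun (D1 `*` D2 : set (RT * RT)) (fun q : RT * RT => f q.1 q.2) ->
  mu.-integrable D1 (fun x => (a x)%:E) -> mu.-integrable D2 (fun y => (b y)%:E) ->
  (forall x y, D1 x -> D2 y -> `|f x y| <= a x * b y) ->
  [/\ mu.-integrable D1 (fun x => (\int[mu]_(y in D2) f x y)%:E),
      mu.-integrable D2 (fun y => (\int[mu]_(x in D1) f x y)%:E) &
      \int[mu]_(x in D1) \int[mu]_(y in D2) f x y =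
      \int[mu]_(y in D2) \int[mu]_(x in D1) f x y].
Proof.
move=> mD1 mD2 mf ia ib fab.
have mF : measurable_fun setT (((fun q : RT * RT => f q.1 q.2) \_ (D1 `*` D2))).
  by apply/(measurable_restrictT _ _).1 => //; exact: measurableX.
have m1 (x : RT) : D1 x -> measurable_fun D2 (f x).
  move=> D1x; apply: (@eq_measurable_fun _ _ _ _ _ (fun y : RT => ((fun q : RT * RT => f q.1 q.2) \_ (D1 `*` D2)) (x, y))).
    by move=> y yD2; rewrite patchE mem_set//=; split => //; exact: set_mem.
  by apply: measurable_funTS; exact: (measurable_fun_pair2 x mF).
have m2 (y : RT) : D2 y -> measurable_fun D1 (f ^~ y).
  move=> D2y; apply: (@eq_measurable_fun _ _ _ _ _ (fun x : RT => ((fun q : RT * RT => f q.1 q.2) \_ (D1 `*` D2)) (x, y))).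
    by move=> x xD1; rewrite patchE mem_set//=; split => //; exact: set_mem.
  by apply: measurable_funTS; exact: (measurable_fun_pair1 y mF).
apply: Rfubini => //.
- move=> x D1x; apply: le_integrable (integrable_mull (a x) mD2 ib) => //.
    by apply/measurable_EFinP; exact: m1.
  by move=> y D2y; rewrite lee_fin; apply: le_trans (ler_norm _); exact: fab.
- move=> y D2y; apply: le_integrable (integrable_mulr (b y) mD1 ia) => //.
    by apply/measurable_EFinP; exact: m2.
  by move=> x D1x; rewrite lee_fin; apply: le_trans (ler_norm _); exact: fab.
- pose B := \int[mu]_(y in D2) `|b y|.
  have ib' : mu.-integrable D2 (fun y => `|b y|%:E) by exact: (integrable_norm ib).
  apply: (@le_lt_trans _ _ (\int[mu]_(x in D1) (`|a x| * B)%:E)%E).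
    apply: ge0_le_integral => //.
    - by move=> x _; exact: integral_ge0.
    - apply: (@eq_measurable_fun _ _ _ _ _ (fun x : RT => \int[mu]_(y in setT) `|((fun q : RT * RT => f q.1 q.2) \_ (D1 `*` D2)) (x, y)|%:E)%E).
        move=> x xD1; rewrite [RHS]integral_mkcond; apply: eq_integral => y _.
        rewrite !patchE in_setX/= xD1/=; case: ifP => // _.
        by rewrite normr0.
      apply: measurable_funTS.
      apply: (measurable_fun_fubini_tonelli_F (fun q => `|((fun q : RT * RT => f q.1 q.2) \_ (D1 `*` D2)) q|%:E)) => //.
      by apply/measurable_EFinP; exact: measurableT_comp.
    - apply/measurable_EFinP; apply: measurable_funM => //; apply: measurableT_comp => //.
      by apply/measurable_EFinP; exact: (measurable_int _ ia).
    - move=> x D1x; apply: (@le_trans _ _ (\int[mu]_(y in D2) (`|a x| * `|b y|)%:E)%E).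
        apply: ge0_le_integral => //.
        + by apply/measurable_EFinP; apply: measurableT_comp => //; exact: m1.
        + by have /measurable_int := integrable_mull `|a x| mD2 ib'; exact.
        + move=> y D2y; rewrite lee_fin; apply: le_trans (fab _ _ D1x D2y) _.
          by rewrite -normrM ler_norm.
      rewrite le_eqVlt; apply/orP; left; apply/eqP.
      rewrite /B -(Rint_scale _ mD2 ib') Rint_fin//.
      exact: integrable_mull.
  have ia' : mu.-integrable D1 (fun x => `|a x|%:E) by exact: (integrable_norm ia).
  exact: (integrable_lty mD1 (integrable_mulr B mD1 ia')).
Qed.

End dominated_fubini.

(** * The evolution equation *)

Section geometric_growth.
Context {R : realType}.

(** Nonnegativity of the quadratic polynomials in t says that A is log-convex,
    so that A n >= A 0 * r ^+ n with r = A 1 / A 0. If r > 0 this contradicts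
    A n <= C n.*2, because C eventually decreases by factors whose squares are
    at most r / 2. *)
Lemma logconvex_subgeometric_eq0 (A C e : nat -> R) :
  (forall n, 0 <= A n) ->
  (forall n t, 0 <= A n - 2 * t * A n.+1 + t ^+ 2 * A n.+2) ->
  (forall n, A n <= C n.*2) -> (forall n, C n.+1 = C n * e n) ->
  (forall n, 0 <= C n) -> e @ \oo --> 0 -> A 1%N = 0.
Proof.
move=> A0 Acvx AC CS C0 e0.
apply/eqP; rewrite eq_le A0 andbT leNgt; apply/negP => A1.
have Az : 0 < A 0%N.
  rewrite lt_def A0 andbT; apply/eqP => Az.
  pose t := A 1%N / (A 2%N + 1).
  have A21 : 0 < A 2%N + 1 by rewrite ltr_wpDl.
  have t0 : 0 < t by rewrite divr_gt0.
  have tA : t * A 2%N < A 1%N.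
    by rewrite /t mulrAC ltr_pdivrMr// ltr_pM2l// ltrDl.
  have := Acvx 0%N t; rewrite Az add0r.
  have -> : - (2 * t * A 1%N) + t ^+ 2 * A 2%N = t * (t * A 2%N - 2 * A 1%N) by ring.
  by rewrite pmulr_rge0//; lra.
pose r := A 1%N / A 0%N.
have r0 : 0 < r by rewrite divr_gt0.
have step n : 0 < A n /\ r * A n <= A n.+1.
  elim: n => [|n [An IH]]; first by rewrite /r divfK ?gt_eqF.
  have An1 : 0 < A n.+1 by apply: lt_le_trans IH; rewrite mulr_gt0.
  split => //.
  have := Acvx n r^-1 => h.
  have : 0 <= r ^+ 2 * (A n - 2 * r^-1 * A n.+1 + r^-1 ^+ 2 * A n.+2).
    by rewrite mulr_ge0// ltW// exprn_gt0.
  have -> : r ^+ 2 * (A n - 2 * r^-1 * A n.+1 + r^-1 ^+ 2 * A n.+2) =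
      r * (r * A n) - 2 * (r * A n.+1) + A n.+2.
    by field; rewrite gt_eqF.
  have : r * (r * A n) <= r * A n.+1 by rewrite ler_pM2l.
  by lra.
have lowA n : A 0%N * r ^+ n <= A n.
  elim: n => [|n IH]; first by rewrite expr0 mulr1.
  have [_] := step n; apply: le_trans; rewrite exprS mulrCA ler_pM2l//.
(* both d <= 1 and d <= r / 2 are needed to have d ^+ 2 <= r / 2 *)
pose d := Num.min 1 (r / 2).
have d0 : 0 < d by rewrite lt_min ltr01/= divr_gt0.
have dd : d ^+ 2 <= r / 2.
  apply: (@le_trans _ _ d); last by rewrite ge_min lexx orbT.
  by rewrite expr2 ger_pMl// ge_min lexx.
have [N _ eN] : \forall n \near \oo, e n <= d.
  by apply: (cvgr_le 0 e0).
have CN k : C (N + k)%N <= C N * d ^+ k.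
  elim: k => [|k IH]; first by rewrite addn0 expr0 mulr1.
  rewrite addnS CS exprSr mulrA; apply: le_trans (ler_wpM2r (ltW d0) IH).
  by rewrite ler_wpM2l//; apply: eN; rewrite /= leq_addr.
have key n : A 0%N * r ^+ (N + n) <= C N * d ^+ N * (r / 2) ^+ n.
  apply: le_trans (lowA _) _; apply: le_trans (AC _) _.
  have -> : (N + n).*2 = (N + (N + n.*2))%N by rewrite -!addnn addnACA -addnA.
  apply: le_trans (CN _) _; rewrite exprD mulrA ler_wpM2l//.
    by rewrite mulr_ge0// exprn_ge0// ltW.
  by rewrite -mul2n exprM lerXn2r// nnegrE ?exprn_ge0 ?divr_ge0// ltW.
have key2 n : A 0%N * r ^+ N <= C N * d ^+ N * 2^-1 ^+ n.
  have := key n; rewrite exprD (_ : (r / 2) ^+ n = 2^-1 ^+ n * r ^+ n).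
    by rewrite !mulrA ler_pM2r// exprn_gt0.
  by rewrite [RHS]mulrC -exprMn.
have : A 0%N * r ^+ N <= 0.
  have cv : (fun n => C N * d ^+ N * 2^-1 ^+ n) @ \oo --> 0.
    rewrite -[X in _ --> X](mulr0 (C N * d ^+ N)); apply: cvgM; first exact: cvg_cst.
    by apply: cvg_expr; rewrite ger0_norm ?invr_ge0// invf_lt1// ltr1n.
  rewrite -(cvg_lim _ cv)//; apply: limr_ge; first exact: cvgP cv.
  exact: nearW.
by rewrite leNgt mulr_gt0// exprn_gt0.
Qed.

End geometric_growth.

Lemma continuous_fst_slice (R : realType) (f : R -> R -> R) (x y : R) :
  {for (x, y), continuous (fun q : R * R => f q.1 q.2)} -> {for x, continuous (f ^~ y)}.
Proof.
move=> cf; apply: (@continuous_comp _ _ _ (fun x => (x, y)) (fun q : R * R => f q.1 q.2)) cf.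
move=> A [[/= P Q] [/= nP nQ] PQ]; change (\forall z \near x, A (z, y)).
near=> z; apply: PQ; split => /=; first by near: z.
exact: (nbhs_singleton nQ).
Unshelve. all: by end_near. Qed.

Lemma continuous_snd_slice (R : realType) (f : R -> R -> R) (x y : R) :
  {for (x, y), continuous (fun q : R * R => f q.1 q.2)} -> {for y, continuous (f x)}.
Proof.
move=> cf; apply: (@continuous_comp _ _ _ (fun y => (x, y)) (fun q : R * R => f q.1 q.2)) cf.
move=> A [[/= P Q] [/= nP nQ] PQ]; change (\forall z \near y, A (x, z)).
near=> z; apply: PQ; split => /=; last by near: z.
exact: (nbhs_singleton nP).
Unshelve. all: by end_near. Qed.

Lemma swap_continuous (R : realType) (x y : R) :
  {for (x, y), continuous (fun q : R * R => (q.2, q.1))}.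
Proof.
move=> A [[/= P Q] [/= nP nQ] PQ]; exists (Q, P) => //=.
by move=> [z w] [/= hz hw]; apply: PQ.
Qed.

(** Dominated convergence gives the continuity. *)
Lemma bcont_integral (R : realType) (F : R -> R -> R) (D : set (measurableTypeR R)) (b : R -> R) : measurable D ->
  (forall x, 0 < x < 1 -> measurable_fun D (F x)) ->
  (forall x y, 0 < x < 1 -> D y -> {for x, continuous (F ^~ y)}) ->
  (forall x y, 0 < x < 1 -> D y -> `|F x y| <= b y) ->
  (@lebesgue_measure R).-integrable D (fun y => (b y)%:E) ->
  bcont (fun x => \int[@lebesgue_measure R]_(y in D) F x y).
Proof.
move=> mD mF cF Fb ib.
have iF x : 0 < x < 1 -> (@lebesgue_measure R).-integrable D (fun y => (F x y)%:E).
  move=> x01; apply: le_integrable ib => //; first by apply/measurable_EFinP; exact: mF.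
  by move=> y Dy; rewrite lee_fin; apply: le_trans (ler_norm _); exact: Fb.
split.
- move=> x0 x001; have := @continuity_under_integral R _ _ lebesgue_measure F D mD 0 1 _ _ b; apply.
  + by move=> x /=; rewrite in_itv/=; exact: iF.
  + by apply: aeW => y Dy x; rewrite inE/= in_itv/= => x01; exact: cF.
  + exact: ib.
  + by move=> x /=; rewrite in_itv/= => x01; apply: aeW => y Dy; exact: Fb.
  + by rewrite inE.
- exists (\int[@lebesgue_measure R]_(y in D) b y) => x x01.
  by apply: Rint_dom => //; [exact: mF|move=> y; exact: Fb].
Qed.

Section evolution.
Context {R : realType}.
Notation mu := (@lebesgue_measure R).
Notation RT := (measurableTypeR R).
Variables (al be c0 N M : R) (G v : R -> R -> R).
Hypotheses (al01 : 0 < al < 1) (albe : - al < be).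
Hypothesis Gcont : forall y xi, 0 < y < 1 -> 0 < xi < 1 ->
  {for (y, xi), continuous (fun q : R * R => G q.1 q.2)}.
Hypothesis GN : forall y xi, 0 < y < 1 -> 0 < xi < 1 -> `|G y xi| <= N.
Hypothesis Gsym : forall y xi, 0 < y < 1 -> 0 < xi < 1 -> G y xi = G xi y.
Hypothesis vcont : forall x y, 0 < x < 1 -> 0 < y < 1 ->
  {for (x, y), continuous (fun q : R * R => v q.1 q.2)}.
Hypothesis vM : forall x y, 0 < x < 1 -> 0 < y < 1 -> `|v x y| <= M.
Implicit Types (phi psi : R -> R).

Let T phi xi := c0 * \int[mu]_(y in `]0, 1[) (G y xi * phi y).

Hypothesis evol : forall x xi, 0 < x < 1 -> 0 < xi < 1 ->
  T (fun y => conv (pow (- al)) (v ^~ y) x) xi =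
  - \int[mu]_(t in `]0, x[) (t `^ be * v t xi).

Let vx_bcont x : 0 < x < 1 -> bcont (v x).
Proof.
move=> x01; split; last by exists M => y y01; exact: vM.
by move=> y; rewrite in_itv/= => y01; exact: (continuous_snd_slice (vcont x01 y01)).
Qed.

Let vy_bcont y : 0 < y < 1 -> bcont (v ^~ y).
Proof.
move=> y01; split; last by exists M => x x01; exact: vM.
by move=> x; rewrite in_itv/= => x01; exact: (continuous_fst_slice (vcont x01 y01)).
Qed.

Let T_bcont phi : bcont phi -> bcont (T phi).
Proof.
move=> bphi; apply: bcontZ; have [_ [B phiB]] := bphi.
apply: (@bcont_integral _ _ `]0, 1[ (fun=> N * B)) => //.
- move=> xi xi01; apply: measurable_funM; last exact: bcont_measurable.
  apply: (@bcont_measurable _ (G ^~ xi)); split; last by exists N => y y01; exact: GN.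
  by move=> y; rewrite in_itv/= => y01; exact: (continuous_fst_slice (Gcont y01 xi01)).
- move=> xi y xi01 /=; rewrite in_itv/= => y01; apply: cvgM; last exact: cvg_cst.
  exact: (continuous_snd_slice (Gcont y01 xi01)).
- move=> xi y xi01 /=; rewrite in_itv/= => y01; rewrite normrM; apply: ler_pM => //.
    exact: GN.
  exact: phiB.
- exact: integrable_cst_itv.
Qed.

Let prod_cont (f : R -> R -> R) (p q : R -> R) :
  (forall x y, 0 < x < 1 -> 0 < y < 1 -> {for (x, y), continuous (fun q : R * R => f q.1 q.2)}) ->
  bcont p -> bcont q ->
  measurable_fun (`]0, 1[ `*` `]0, 1[ : set (RT * RT)) (fun z : RT * RT => p z.1 * (f z.1 z.2 * q z.2)).
Proof.
move=> cf [cp _] [cq _].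
apply: (@continuous_measurable_prod R 0 1 0 1 (fun x y => p x * (f x y * q y))) => x y x01 y01.
apply: cvgM.
  apply: (@continuous_comp _ _ _ (@fst R R) p); first exact: cvg_fst.
  by apply: cp; rewrite in_itv.
apply: cvgM; first exact: cf.
apply: (@continuous_comp _ _ _ (@snd R R) q); first exact: cvg_snd.
by apply: cq; rewrite in_itv.
Qed.

Let T_sym phi psi : bcont phi -> bcont psi -> ip (T phi) psi = ip phi (T psi).
Proof.
move=> b1 b2; have [_ [B1 h1]] := b1; have [_ [B2 h2]] := b2.
pose F y xi := phi y * (G y xi * psi xi).
have [|I1 I2 E] := @Rfubini_dom R `]0, 1[ `]0, 1[ F (fun=> B1) (fun=> N * B2)
  (measurable_itv _) (measurable_itv _) (prod_cont Gcont b1 b2) (integrable_cst_itv 0 1 B1) (integrable_cst_itv 0 1 (N * B2)).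
  move=> y xi /=; rewrite !in_itv/= => y01 xi01; rewrite normrM; apply: ler_pM => //; first exact: h1.
  by rewrite normrM; apply: ler_pM => //; [exact: GN|exact: h2].
have iG1 f xi : bcont f -> 0 < xi < 1 -> mu.-integrable `]0, 1[ (fun y => (G y xi * f y)%:E).
  move=> bf xi01; apply: bcont_integrable; apply: bcontM => //.
  split; last by exists N => y y01; exact: GN.
  by move=> y; rewrite in_itv/= => y01; exact: (continuous_fst_slice (Gcont y01 xi01)).
have iT f : bcont f -> mu.-integrable `]0, 1[ (fun y => (T f y)%:E).
  by move=> bf; apply: bcont_integrable; exact: T_bcont.
have := E; move/(congr1 ( *%R c0)) => {}E.
transitivity (c0 * \int[mu]_(xi in `]0, 1[) \int[mu]_(y in `]0, 1[) F y xi).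
  rewrite -(Rint_scale _ (measurable_itv _) I2).
  apply: eq_Rintegral => xi; rewrite inE/= in_itv/= => xi01.
  rewrite /T -mulrA; congr (_ * _); rewrite mulrC -Rint_scale//; last exact: iG1.
  by apply: eq_Rintegral => y _; rewrite /F; ring.
rewrite -E -(Rint_scale _ (measurable_itv _) I1).
apply: eq_Rintegral => y; rewrite inE/= in_itv/= => y01.
rewrite /T mulrCA; congr (_ * _); rewrite -Rint_scale//; last exact: iG1.
by apply: eq_Rintegral => xi; rewrite inE/= in_itv/= => xi01; rewrite /F Gsym.
Qed.

Let fv phi x := ip (v x) phi.

Let fv_bcont phi : bcont phi -> bcont (fv phi).
Proof.
move=> bphi; have [_ [B phiB]] := bphi.
apply: (@bcont_integral _ _ `]0, 1[ (fun=> M * B)) => //.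
- move=> x x01; apply: measurable_funM; apply: bcont_measurable => //.
  exact: vx_bcont.
- move=> x y x01 /=; rewrite in_itv/= => y01; apply: cvgM; last exact: cvg_cst.
  exact: (continuous_fst_slice (vcont x01 y01)).
- move=> x y x01 /=; rewrite in_itv/= => y01; rewrite normrM; apply: ler_pM => //.
    exact: vM.
  exact: phiB.
- exact: integrable_cst_itv.
Qed.

Let sub1 (t X : R) : 0 < X < 1 -> 0 < t < X -> 0 < t < 1.
Proof. by move=> /andP[_ X1] /andP[-> tX] /=; exact: lt_trans X1. Qed.

(** Pairing with a test function commutes with integration in time. *)
Let swap x (w psi : R -> R) : 0 < x < 1 -> measurable_fun [set: RT] w ->
  mu.-integrable `]0, x[ (fun t => (w t)%:E) -> bcont psi ->
  \int[mu]_(y in `]0, 1[) (psi y * \int[mu]_(t in `]0, x[) (w t * v t y)) =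
  \int[mu]_(t in `]0, x[) (w t * ip (v t) psi).
Proof.
move=> x01 mw iw bpsi; have [cpsi [B psiB]] := bpsi; have /andP[x0 x1] := x01.
pose F y t := psi y * (w t * v t y).
have iwv y : 0 < y < 1 -> mu.-integrable `]0, x[ (fun t => (w t * v t y)%:E).
  move=> y01; apply: le_integrable (integrable_mulr M (measurable_itv _) iw) => //.
    apply/measurable_EFinP; apply: measurable_funM; first exact: measurable_funTS.
    apply: measurable_funS (bcont_measurable (vy_bcont y01)) => //.
    by move=> t /=; rewrite !in_itv/=; exact: sub1.
  move=> t /=; rewrite in_itv/= => tx; rewrite lee_fin !normrM ler_wpM2l//.
  by apply: le_trans (ler_norm _); apply: vM => //; exact: sub1 tx.
have [||I1 I2 E] := @Rfubini_dom R `]0, 1[ `]0, x[ F (fun=> B) (fun t => M * `|w t|)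
  (measurable_itv _) (measurable_itv _) _ (integrable_cst_itv 0 1 B)
  (integrable_mull M (measurable_itv _) (integrable_norm iw)).
- have E (q : RT * RT) : F q.1 q.2 = w q.2 * (psi q.1 * v q.2 q.1) by rewrite /F; ring.
  rewrite (_ : (fun q : RT * RT => F q.1 q.2) = (fun q => w q.2 * (psi q.1 * v q.2 q.1))); last exact/funext.
  apply: measurable_funM.
    by apply: measurable_funTS; apply: (measurableT_comp mw); exact: measurable_snd.
  apply: (@continuous_measurable_prod R 0 1 0 x (fun y t => psi y * v t y)) => y t y01 t01.
  apply: cvgM.
    apply: (@continuous_comp _ _ _ (@fst R R) psi); first exact: cvg_fst.
    by apply: cpsi; rewrite in_itv.
  apply: (@continuous_comp _ _ _ (fun q : R * R => (q.2, q.1)) (fun q : R * R => v q.1 q.2)).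
    exact: swap_continuous.
  by apply: vcont => //; exact: sub1 t01.
- move=> y t /=; rewrite !in_itv/= => y01 t01; rewrite normrM; apply: ler_pM => //; first exact: psiB.
  rewrite normrM mulrC; apply: ler_pM => //; apply: vM => //; exact: sub1 t01.
transitivity (\int[mu]_(y in `]0, 1[) \int[mu]_(t in `]0, x[) F y t).
  apply: eq_Rintegral => y; rewrite inE/= in_itv/= => y01.
  by rewrite /F (Rint_scale _ (measurable_itv _) (iwv y y01)).
rewrite E; apply: eq_Rintegral => t; rewrite inE/= in_itv/= => /(sub1 x01) t01.
rewrite /ip -(Rint_scale _ (measurable_itv _) (bcont_integrable (bcontM (vx_bcont t01) bpsi))).
by apply: eq_Rintegral => y _; rewrite /F; ring.
Qed.

Lemma integrable_pow_sub x : 0 < x -> mu.-integrable `]0, x[ (fun t => (pow (- al) (x - t))%:E).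
Proof.
have Nal1 : -1 < - al by case/andP: al01 => ? ?; lra.
have z1 : -1 < 0 :> R by lra.
move=> x0; have := convable_pow Nal1 z1 x0.
by apply: eq_integrable => // t _; rewrite /pow powRr0 mulr1.
Qed.

Lemma integrable_pow_weight x : 0 < x -> mu.-integrable `]0, x[ (fun t => (pow be t)%:E).
Proof.
have be1 : -1 < be by move: albe; case/andP: al01 => ? ? ?; lra.
have z1 : -1 < 0 :> R by lra.
move=> x0; have := convable_pow z1 be1 x0.
by apply: eq_integrable => // t _; rewrite /pow powRr0 mul1r.
Qed.

Lemma conv_pow_bcont x : 0 < x < 1 -> bcont (fun y => conv (pow (- al)) (v ^~ y) x).
Proof.
move=> x01; have /andP[x0 x1] := x01.
apply: (@bcont_integral _ _ `]0, x[ (fun t => pow (- al) (x - t) * M)) => //.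
- move=> y y01; apply: measurable_funM.
    by apply: measurable_funTS; exact: (measurable_sub (D := setT) x (measurable_pow _)).
  apply: measurable_funS (bcont_measurable (vy_bcont y01)) => //.
  by move=> t /=; rewrite !in_itv/=; exact: sub1.
- move=> y t y01 /=; rewrite in_itv/= => /(sub1 x01) t01; apply: cvgM; first exact: cvg_cst.
  exact: (continuous_snd_slice (vcont t01 y01)).
- move=> y t y01 /=; rewrite in_itv/= => /(sub1 x01) t01; rewrite normrM.
  by rewrite [`|pow _ _|]ger0_norm ?powR_ge0// ler_wpM2l ?powR_ge0//; exact: vM.
- by apply: integrable_mulr => //; exact: integrable_pow_sub.
Qed.

(** Paired with phi, the evolution equation becomes a scalar one: the symmetry
    of T moves it onto the test function, and the time kernel is left
    untouched. *)
Let weak_evolution phi x : bcont phi -> 0 < x < 1 ->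
  conv (pow (- al)) (fv (T phi)) x = \int[mu]_(r in `]0, x[) (r `^ be * - fv phi r).
Proof.
move=> bphi x01; have /andP[x0 x1] := x01.
have mk : measurable_fun [set: RT] (fun t => pow (- al) (x - t)).
  exact: (measurable_sub (D := setT) x (measurable_pow _)).
have e1 : ip (T phi) (fun y => conv (pow (- al)) (v ^~ y) x) =
    conv (pow (- al)) (fv (T phi)) x := swap x01 mk (integrable_pow_sub x0) (T_bcont bphi).
rewrite -e1 ipC -(T_sym (conv_pow_bcont x01) bphi) ipC.
transitivity (\int[mu]_(xi in `]0, 1[) (- (phi xi) * \int[mu]_(t in `]0, x[) (pow be t * v t xi))).
  apply: eq_Rintegral => xi; rewrite inE/= in_itv/= => xi01.
  by rewrite evol//; rewrite mulrN mulNr.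
have bN : bcont (fun xi => - phi xi).
  have := bcontZ (-1) bphi; congr bcont; apply/funext => xi; exact: mulN1r.
rewrite (swap x01 (measurable_pow be) (integrable_pow_weight x0) bN).
apply: eq_Rintegral => t; rewrite inE/= in_itv/= => /(sub1 x01) t01; congr (_ * _).
rewrite /fv /ip -mulN1r -(Rint_scale _ (measurable_itv _) (bcont_integrable (bcontM (vx_bcont t01) bphi))).
by apply: eq_Rintegral => y _; ring.
Qed.

Let B0 := beta (al - 1) (- al).

Let B0_gt0 : 0 < B0.
Proof.
apply: lt_le_trans ltr01 _; apply: beta_ge1; move: al01 => /andP[? ?];
  by apply/andP; split; lra.
Qed.

Let ga := al + be.

(** Abel inversion of the scalar equation: applying T to the test function
    amounts to applying an Abel operator to the pairing. *)
Let fv_T phi x : bcont phi -> 0 < x < 1 ->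
  B0 * fv (T phi) x =
  x `^ ga * \int[mu]_(s in `]0, 1[) ((1 - s) `^ (al - 1) * s `^ be * - fv phi (x * s)).
Proof.
move=> bphi x01.
have [c1 [M1 h1]] := fv_bcont (T_bcont bphi); have [c2 [M2 h2]] := fv_bcont bphi.
apply: (@abel_inversion R al be (Num.max M1 M2) (fv (T phi)) (fun x => - fv phi x)) => //.
- by move=> t t01; apply: cvgN; exact: c2.
- by move=> t t01; rewrite le_max h1.
- by move=> t t01; rewrite normrN le_max h2// orbT.
- by move=> t t01; exact: weak_evolution.
Qed.

Let eps n := beta (al - 1) (be + n%:R * ga) / B0.

Let ga0 : 0 < ga. Proof. by rewrite /ga; move: albe; lra. Qed.

(** Every application of T to the test function gains a power x `^ ga and a
    factor eps n. *)
Let fv_T_le phi C n : bcont phi -> 0 <= C ->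
  (forall x, 0 < x < 1 -> `|fv phi x| <= C * x `^ (n%:R * ga)) ->
  forall x, 0 < x < 1 -> `|fv (T phi) x| <= C * eps n * x `^ (n.+1%:R * ga).
Proof.
move=> bphi C0 hC x x01; have /andP[x0 x1] := x01.
have al11 : -1 < al - 1 by case/andP: al01 => ? ?; lra.
have nga : 0 <= n%:R * ga by rewrite mulr_ge0// ltW.
have be1 : -1 < be + n%:R * ga by move: albe nga; case/andP: al01 => ? ? ? ?; lra.
rewrite /eps -(ler_pM2l B0_gt0) -{1}(gtr0_norm B0_gt0) -normrM fv_T//.
rewrite normrM (ger0_norm (powR_ge0 _ _)).
have -> : B0 * (C * (beta (al - 1) (be + n%:R * ga) / B0) * x `^ (n.+1%:R * ga)) =
    x `^ ga * (C * x `^ (n%:R * ga) * beta (al - 1) (be + n%:R * ga)).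
  rewrite -natr1 mulrDl mul1r powRD ?(gt_eqF x0) ?implybT//.
  by field; rewrite gt_eqF.
rewrite ler_wpM2l ?powR_ge0//.
have ib := integrable_mull (C * x `^ (n%:R * ga)) (measurable_itv _) (integrable_beta_kernel al11 be1).
have le1 s : 0 < s < 1 -> `|(1 - s) `^ (al - 1) * s `^ be * - fv phi (x * s)| <=
    C * x `^ (n%:R * ga) * ((1 - s) `^ (al - 1) * s `^ (be + n%:R * ga)).
  move=> /andP[s0 s1]; rewrite normrM normrN ger0_norm ?mulr_ge0 ?powR_ge0//.
  apply: le_trans (ler_wpM2l _ (hC _ _)) _; rewrite ?mulr_ge0 ?powR_ge0//.
    by rewrite mulr_gt0//= (lt_trans _ s1)// gtr_pMl.
  rewrite powRM ?(ltW x0) ?(ltW s0)// [s `^ (be + _)]powRD ?(gt_eqF s0) ?implybT//.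
  by rewrite le_eqVlt; apply/orP; left; apply/eqP; ring.
have mF : measurable_fun (`]0, 1[ : set RT) (fun s => (1 - s) `^ (al - 1) * s `^ be * - fv phi (x * s)).
  apply: measurable_funM.
    apply: measurable_funM; first exact: measurable_powR_onem.
    by apply: measurable_funTS; exact: measurable_pow.
  have bN : bcont (fun s => - fv phi (s * x)).
    have [c2 [M2 h2]] := fv_bcont bphi; split; last first.
      exists M2 => s /andP[s0 s1]; rewrite normrN; apply: h2.
      by rewrite mulr_gt0//= (lt_trans _ s1)// gtr_pMr.
    move=> s; rewrite in_itv/= => /andP[s0 s1].
    have cs : {for s, continuous (fun z : R => fv phi (z * x))}.
      apply: continuous_mulr_arg; apply: c2.
      by rewrite in_itv/= mulr_gt0//= (lt_trans _ s1)// gtr_pMr.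
    exact: (cvgN cs).
  rewrite (_ : (fun s : RT => - fv phi (x * s)) = (fun s => - fv phi (s * x))).
    exact: (bcont_measurable bN).
  by apply/funext => s; rewrite mulrC.
rewrite /beta -(Rint_scale _ (measurable_itv _) (integrable_beta_kernel al11 be1)).
by apply: Rint_dom => // s /=; rewrite in_itv/=; exact: le1.
Qed.

(** Dominated convergence: s `^ ga < 1 for 0 < s < 1. *)
Let eps_cvg0 : eps @ \oo --> 0.
Proof.
have al11 : -1 < al - 1 by case/andP: al01 => ? ?; lra.
have be1 : -1 < be by move: albe; case/andP: al01 => ? ? ?; lra.
rewrite -[X in _ --> X](mul0r B0^-1); apply: cvgM; last exact: cvg_cst.
have mK n : measurable_fun (`]0, 1[ : set RT) (fun s => ((1 - s) `^ (al - 1) * s `^ (be + n%:R * ga))%:E).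
  apply/measurable_EFinP; apply: measurable_funM; first exact: measurable_powR_onem.
  by apply: measurable_funTS; exact: measurable_pow.
have [] := @dominated_convergence _ _ _ mu `]0, 1[ (measurable_itv _)
  (fun n s => ((1 - s) `^ (al - 1) * s `^ (be + n%:R * ga))%:E) (cst 0%E)
  (fun s => ((1 - s) `^ (al - 1) * s `^ be)%:E).
- exact: mK.
- exact: measurable_cst.
- apply: aeW => s /=; rewrite in_itv/= => /andP[s0 s1].
  have sga : 0 <= s `^ ga < 1.
    rewrite powR_ge0/=; have : s `^ ga < 1 `^ ga.
      by apply: gt0_ltr_powR => //; rewrite nnegrE ltW.
    by rewrite powR1.
  have E n : (1 - s) `^ (al - 1) * s `^ (be + n%:R * ga) =
      (1 - s) `^ (al - 1) * s `^ be * (s `^ ga) ^+ n.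
    rewrite [s `^ (be + _)]powRD ?(gt_eqF s0) ?implybT// mulrA; congr (_ * _).
    by rewrite mulrC powRrM powR_mulrn ?powR_ge0.
  under eq_fun do rewrite E.
  apply: cvg_EFin; first exact: nearW.
  rewrite -[X in _ --> X](mulr0 ((1 - s) `^ (al - 1) * s `^ be)).
  apply: cvgM; first exact: cvg_cst.
  by apply: cvg_expr; case/andP: sga => g0 g1; rewrite ger0_norm.
- exact: integrable_beta_kernel.
- apply: aeW => s n /=; rewrite in_itv/= => /andP[s0 s1].
  rewrite ger0_norm ?mulr_ge0 ?powR_ge0// lee_fin ler_wpM2l ?powR_ge0//.
  apply: ger_powR; first by rewrite s0 ltW.
  by rewrite lerDl mulr_ge0// ltW.
move=> _ _; rewrite integral0 => h.
exact: (fine_cvg h).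
Qed.

(** For phi = v x0 the squared norm of T^n phi is, by symmetry, the pairing of
    v x0 with T^(2n) phi, hence decays faster than every geometric sequence;
    as these squared norms are log-convex in n, T (v x0) = 0. Then T psi is
    orthogonal to all v t for every psi, and the weak equation says that the
    primitive of t `^ be times the pairing of v t with psi vanishes. *)
Lemma evolution_eq0 x y : 0 < x < 1 -> 0 < y < 1 -> v x y = 0.
Proof.
have Tv0 x0 : 0 < x0 < 1 -> ip (T (v x0)) (T (v x0)) = 0.
  move=> x01; have bv := vx_bcont x01; have [_ [B hB]] := bv.
  pose Tn n := iter n T (v x0).
  have bT n : bcont (Tn n) by elim: n => [//|n IH]; exact: T_bcont.
  have sh m n : ip (Tn m) (Tn n) = ip (v x0) (Tn (m + n)%N).
    elim: m n => [//|m IH] n; rewrite [LHS](T_sym (bT m) (bT n)).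
    by rewrite -[T (Tn n)]/(Tn n.+1) IH addnS addSn.
  have [_ [M0 hM0]] := fv_bcont bv.
  have M00 : 0 <= M0 by apply: le_trans (hM0 _ x01).
  pose C := fix C n := if n is k.+1 then C k * eps k else M0.
  have eps0 n : 0 <= eps n.
    rewrite divr_ge0 ?(ltW B0_gt0)//; apply: Rintegral_ge0 => s _.
    by rewrite mulr_ge0 ?powR_ge0.
  have C0 n : 0 <= C n by elim: n => [//|n IH] /=; rewrite mulr_ge0.
  have bound n z : 0 < z < 1 -> `|fv (Tn n) z| <= C n * z `^ (n%:R * ga).
    elim: n z => [|n IH] z zz; first by rewrite mul0r powRr0 mulr1; exact: hM0.
    exact: fv_T_le.
  have AC n : ip (Tn n) (Tn n) <= C n.*2.
    rewrite sh addnn; apply: le_trans (ler_norm _) _; apply: le_trans (bound _ _ x01) _.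
    apply: ler_piMr => //; rewrite -[leRHS](powRr0 x0); case/andP: x01 => x00 x1.
    by apply: ger_powR; [rewrite x00 ltW|rewrite mulr_ge0// ltW].
  apply: (@logconvex_subgeometric_eq0 R (fun n => ip (Tn n) (Tn n)) C eps) => //.
  - by move=> n; exact: ip_ge0.
  - move=> n t; have := ip_ge0 (fun y => Tn n y - t * Tn n.+2 y).
    rewrite ip_sub_scale//.
    by rewrite (sh n n) (sh n n.+2) (sh n.+2 n.+2) (sh n.+1 n.+1) !addnS !addSn.
have TvE x0 z : 0 < x0 < 1 -> 0 < z < 1 -> T (v x0) z = 0.
  move=> x01; exact: (ip_eq0 (T_bcont (vx_bcont x01)) (Tv0 _ x01)).
have fT0 psi t : bcont psi -> 0 < t < 1 -> fv (T psi) t = 0.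
  move=> bpsi t01; rewrite /fv -T_sym//; last exact: vx_bcont.
  apply: (Rint_eq0 (measurable_itv _)) => z /=; rewrite in_itv/= => z01.
  by rewrite TvE// mul0r.
move=> x01; have bv := vx_bcont x01.
apply: (ip_eq0 bv).
have [c2 [M2 h2]] := fv_bcont bv.
have : x `^ be * - fv (v x) x = 0.
  apply: (@integral_eq0_continuous R (fun r => r `^ be * - fv (v x) r)) => //.
  - move=> t t01; apply: cvgM; last by apply: cvgN; exact: c2.
    by apply: continuous_powR; move: t01; rewrite in_itv/= => /andP[].
  - move=> X X01; have /andP[X0 X1] := X01.
    apply: le_integrable (integrable_mulr M2 (measurable_itv _) (integrable_pow_weight X0)) => //.
      apply/measurable_EFinP; apply: measurable_funM.
        by apply: measurable_funTS; exact: measurable_pow.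
      apply: measurableT_comp => //; apply: measurable_funS (bcont_measurable (fv_bcont bv)) => //.
      by move=> t /=; rewrite !in_itv/=; exact: sub1.
    move=> t /=; rewrite in_itv/= => /(sub1 X01) t01; rewrite lee_fin !normrM normrN ler_wpM2l//.
    by apply: le_trans (ler_norm _); exact: h2.
  - move=> X X01; rewrite -weak_evolution//.
    apply: (Rint_eq0 (measurable_itv _)) => t /=; rewrite in_itv/= => /(sub1 X01) t01.
    by rewrite fT0// mulr0.
move=> /eqP; rewrite mulrN oppr_eq0 mulf_eq0 powR_eq0.
by case/andP: x01 => /gt_eqF -> _ /= /eqP.
Qed.

End evolution.

(** * The fundamental theorem for integrable derivatives *)

Section fundamental_theorem.
Context {R : realType}.
Notation mu := (@lebesgue_measure R).
Notation RT := (measurableTypeR R).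
Implicit Types (f g Lam : R -> R) (a b c d x y e : R).

(** Consider the supremum of the points up to which the comparison holds. It
    holds at the supremum since f is continuous and Lam monotone, and then
    beyond it by the local hypothesis. *)
Lemma local_increment_le f Lam c d : c <= d ->
  {homo Lam : x y / x <= y} ->
  (forall x, c <= x <= d -> {for x, continuous f}) ->
  (forall x, c <= x < d -> exists2 e, 0 < e &
     forall y, x < y < x + e -> f y - f x <= Lam y - Lam x) ->
  f d - f c <= Lam d - Lam c.
Proof.
move=> cd Lmono fc loc.
pose S := [set x | c <= x <= d /\ f x - f c <= Lam x - Lam c].
have Sc : S c by split; rewrite ?lexx ?cd// !subrr.
have hS : has_sup S by split; [exists c|exists d => x [/andP[]]].
have Ssup x : S x -> x <= sup S by apply: sup_upper_bound.
have c_sup : c <= sup S by exact: Ssup.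
have sup_d : sup S <= d by apply: sup_le_ub; [exists c|move=> x [/andP[]]].
have cont := fc (sup S); rewrite c_sup sup_d in cont.
have SS : f (sup S) - f c <= Lam (sup S) - Lam c.
  apply/ler_addgt0Pr => e e0.
  have /cvgrPdist_lt/(_ _ e0) := cont isT.
  move=> /nbhs_ballP[r /= r0 hr].
  have [x Sx xr] := sup_adherent r0 hS.
  have xs := Ssup _ Sx.
  have : `|f (sup S) - f x| < e.
    by apply: hr; rewrite /ball/= ger0_norm ?subr_ge0// ltrBlDl addrC -ltrBlDl; lra.
  rewrite ltr_norml => /andP[_ h1].
  have := Lmono _ _ xs; case: Sx => _ h2; lra.
have [<-//|sd] := eqVneq (sup S) d.
have {}sd : sup S < d by rewrite lt_neqAle sd.
have [|e e0 he] := loc (sup S); first by rewrite c_sup.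
pose y := Num.min d (sup S + e / 2).
have yd : y <= d by rewrite ge_min lexx.
have ys : sup S < y < sup S + e.
  by rewrite /y lt_min sd/= gt_min; apply/andP; split; [lra|apply/orP; right; lra].
have : S y.
  split; last by have := he _ ys; lra.
  by rewrite yd andbT; case/andP: ys => /ltW /(le_trans c_sup).
by move=> /Ssup; case/andP: ys; lra.
Qed.

Lemma lengthD (U : set RT) a x y : measurable U -> a <= x -> x < y ->
  (forall z, x < z < y -> U z) ->
  fine (mu (U `&` `]a, x[)) + (y - x) <= fine (mu (U `&` `]a, y[)).
Proof.
move=> mU ax xy xyU.
have fin z : (mu (U `&` `]a, z[) < +oo)%E.
  apply: (@le_lt_trans _ _ (mu `]a, z[)).
    by apply: le_measure; rewrite ?inE//; exact: measurableI.
  by rewrite /= lebesgue_measure_itv/=; case: ifP => // _; rewrite -EFinB ltry.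
have fn z : mu (U `&` `]a, z[) \is a fin_num by rewrite ge0_fin_numE.
rewrite -lee_fin EFinD !fineK//.
have -> : (y - x)%:E = mu `]x, y[.
  by rewrite /= lebesgue_measure_itv/= lte_fin xy EFinB.
rewrite -measureU//.
- apply: le_measure; rewrite ?inE//.
  + by apply: measurableU => //; exact: measurableI.
  + exact: measurableI.
  + move=> z /= [[Uz]|]; rewrite !in_itv/=.
      by move=> /andP[-> zx]; split => //; rewrite (lt_trans zx).
    by move=> xzy; split; [exact: xyU|case/andP: xzy => xz ->; rewrite (le_lt_trans ax)].
- exact: measurableI.
- apply/seteqP; split => z //= [[_]]; rewrite !in_itv/= => /andP[_ zx] /andP[xz _].
  by have := lt_trans zx xz; rewrite ltxx.
Qed.

(** At each point x the number of levels k.+1 * e below g x is at most g x /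
    e. *)
Lemma superlevel_measure_sum g a b e N : 0 < e ->
  mu.-integrable `]a, b[ (fun x => (g x)%:E) -> (forall x, a < x < b -> 0 <= g x) ->
  \sum_(k < N) e * fine (mu (`]a, b[ `&` [set x | k.+1%:R * e <= g x])) <=
    \int[mu]_(x in `]a, b[) g x.
Proof.
move=> e0 ig g0.
set F := fun k : nat => (`]a, b[ `&` [set x | k.+1%:R * e <= g x] : set RT).
have mg : measurable_fun (`]a, b[ : set RT) g.
  by apply/measurable_EFinP; exact: (measurable_int _ ig).
have mF k : measurable (F k).
  have -> : F k = `]a, b[%classic `&` g @^-1` `[k.+1%:R * e, +oo[%classic.
    by apply/seteqP; split => x /= []; rewrite ?in_itv/= ?andbT.
  exact: mg.
have ih k : mu.-integrable `]a, b[ (fun x => (e * \1_(F k) x)%:E).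
  apply: (@integrable_dom _ _ _ (fun x => e)) => //.
  - apply: measurable_funM => //.
  - exact: integrable_cst_itv.
  - move=> t _; rewrite ger0_norm ?mulr_ge0 ?(ltW e0)//.
    by rewrite -[leRHS]mulr1 ler_pM2l// indicE lern1; case: (_ \in _).
have -> : \sum_(k < N) e * fine (mu (F k)) =
    \int[mu]_(x in `]a, b[) (\sum_(k < N) e * \1_(F k) x).
  rewrite /Rintegral; under eq_integral do rewrite -sumEFin.
  rewrite integral_sum//.
  transitivity (fine (\sum_(k < N) (e * fine (mu (F k)))%:E)); first by rewrite sumEFin.
  congr fine; apply: eq_bigr => k _; rewrite -[RHS](Rint_fin (measurable_itv _) (ih k)).
  congr EFin; apply/esym.
  rewrite Rint_scale//; last first.
    move: (integrable_mull e^-1 (measurable_itv _) (ih k)); apply: eq_integrable => // t _.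
    by rewrite mulKf ?gt_eqF.
  congr (_ * _); rewrite /Rintegral integral_indic//; congr (fine (mu _)).
  by rewrite setIidl// => x [].
apply: Rint_le => //.
- have := @integrable_sum _ _ _ mu _ (measurable_itv `]a, b[) _ (index_enum 'I_N)
    xpredT (fun (k : 'I_N) x => (e * \1_(F k) x)%:E) (fun k _ => ih k).
  by apply: eq_integrable => // x _; rewrite sumEFin.
- move=> x; rewrite /= in_itv/= => xab.
  have Fx k : F k x <-> k.+1%:R * e <= g x by split => [[]//|h]; split => //=; rewrite in_itv.
  suff : \sum_(k < N) e * \1_(F k) x <= g x /\ \sum_(k < N) e * \1_(F k) x <= N%:R * e by case.
  elim: N => [|n [IH1 IH2]]; first by rewrite big_ord0 mul0r g0.
  rewrite big_ord_recr/= indicE; have [h|h] := leP (n.+1%:R * e) (g x).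
    rewrite mem_set; last exact/Fx.
    by rewrite mulr1 -natr1 mulrDl mul1r in h *; split; lra.
  rewrite memNset ?mulr0 ?addr0; last by move/Fx; rewrite leNgt h.
  by split => //; rewrite (le_trans IH2)// ler_pM2r// ler_nat.
Qed.

(** The primitive of a lower semicontinuous majorant of g, as in the theorem
    of Vitali and Caratheodory. Each superlevel set k.+1 * e <= g has an open
    neighbourhood U k larger by at most 2^-(k+1) in measure, and Lam x is e
    times the total length of the U k to the left of x. A point where g is
    about N * e lies in the open sets U k for all k < N, so that Lam grows
    near it at a rate of at least N * e. *)
Lemma integrable_majorant_primitive g a b e : a < b -> 0 < e ->
  mu.-integrable `]a, b[ (fun x => (g x)%:E) -> (forall x, a < x < b -> 0 <= g x) ->
  exists Lam, [/\ {homo Lam : x y / x <= y},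
    (forall x, 0 <= Lam x <= \int[mu]_(x in `]a, b[) g x + e) &
    forall x, a < x < b -> exists2 d, 0 < d &
      forall y, x < y < x + d -> (g x - e) * (y - x) <= Lam y - Lam x].
Proof.
move=> ab e0 ig g0.
pose F := fun k : nat => (`]a, b[ `&` [set x | k.+1%:R * e <= g x] : set RT).
have mg : measurable_fun (`]a, b[ : set RT) g.
  by apply/measurable_EFinP; exact: (measurable_int _ ig).
have mF k : measurable (F k).
  have -> : F k = `]a, b[%classic `&` g @^-1` `[k.+1%:R * e, +oo[%classic.
    by apply/seteqP; split => x /= []; rewrite ?in_itv/= ?andbT.
  exact: mg.
have muab : (mu `]a, b[ < +oo)%E by rewrite /= lebesgue_measure_itv/= lte_fin ab -EFinB ltry.
have muF k : (mu (F k) < +oo)%E.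
  by apply: le_lt_trans muab; apply: le_measure; rewrite ?inE//; exact: subIsetl.
have ch k : exists U : set RT,
    [/\ open U, F k `<=` U & (mu (U `\` F k) < (2^-1 ^+ k.+1)%:E)%E].
  apply: lebesgue_regularity_outer; [exact: mF|exact: muF|].
  by rewrite exprn_gt0// invr_gt0.
have {ch}/choice[U hU] := ch.
have mU k : measurable (U k) by have [oU _ _] := hU k; exact: open_measurable.
pose len k y := fine (mu (U k `&` `]a, y[)).
have len0 k y : 0 <= len k y by apply: fine_ge0.
have fin k y : mu (U k `&` `]a, y[) \is a fin_num.
  rewrite ge0_fin_numE//; apply: (@le_lt_trans _ _ (mu `]a, y[)).
    by apply: le_measure; rewrite ?inE//; exact: measurableI.
  by rewrite /= lebesgue_measure_itv/=; case: ifP => // _; rewrite -EFinB ltry.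
have len_mono k : {homo len k : x y / x <= y}.
  move=> x y xy; apply: fine_le => //; apply: le_measure; rewrite ?inE; try exact: measurableI.
  by apply: setIS => z /=; rewrite !in_itv/= => /andP[-> zx]; exact: lt_le_trans xy.
have len_le k y : len k y <= fine (mu (F k)) + 2^-1 ^+ k.+1.
  rewrite -lee_fin EFinD !fineK//; last by rewrite ge0_fin_numE.
  apply: (@le_trans _ _ (mu (F k `|` (U k `\` F k)))).
    apply: le_measure; rewrite ?inE.
    - exact: measurableI.
    - by apply: measurableU => //; exact: measurableD.
    - by move=> z [Uz _]; have [Fz|] := pselect (F k z); [left|right].
  apply: le_trans (measureU2 _ _ _) _ => //; first exact: measurableD.
  by rewrite leeD2l// ltW//; have [] := hU k.
pose L N y := \sum_(k < N) e * len k y.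
pose B := \int[mu]_(x in `]a, b[) g x + e.
have L0 N y : 0 <= L N y by apply: sumr_ge0 => k _; rewrite mulr_ge0// ltW.
have LB N y : L N y <= B.
  apply: (@le_trans _ _ (\sum_(k < N) (e * fine (mu (F k)) + e * 2^-1 ^+ k.+1))).
    by apply: ler_sum => k _; rewrite -mulrDr ler_pM2l.
  rewrite big_split/= lerD//; first exact: superlevel_measure_sum.
  rewrite -mulr_sumr ler_piMr ?(ltW e0)//.
  suff -> : \sum_(k < N) 2^-1 ^+ k.+1 = 1 - 2^-1 ^+ N :> R.
    by rewrite gerBl exprn_ge0// invr_ge0.
  elim: N => [|n IH]; first by rewrite big_ord0 expr0 subrr.
  by rewrite big_ord_recr/= IH exprS; field.
have Lmono N : {homo L N : x y / x <= y}.
  by move=> x y xy; apply: ler_sum => k _; rewrite ler_pM2l//; exact: len_mono.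
have LN y : {homo L ^~ y : m n / (m <= n)%N >-> m <= n}.
  move=> m n mn; rewrite /L -(subnKC mn) big_split_ord/= lerDl.
  by apply: sumr_ge0 => k _; rewrite mulr_ge0// ltW.
pose Lam y := sup [set L N y | N in [set: nat]].
have hs y : has_sup [set L N y | N in [set: nat]].
  by split; [exists (L 0 y); exists 0|exists B => _ [N _ <-]].
have L_le N y : L N y <= Lam y by apply: sup_upper_bound => //; exists N.
have Lam_le y z : (forall N, L N y <= z) -> Lam y <= z.
  by move=> h; apply: sup_le_ub; [exists (L 0 y); exists 0|move=> _ [N _ <-]].
exists Lam; split.
- move=> x y xy; apply: Lam_le => N; exact: le_trans (Lmono N _ _ xy) (L_le _ _).
- move=> x; rewrite (le_trans (L0 0 x) (L_le _ _))/=; apply: Lam_le => N; exact: LB.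
move=> x xab; have gx0 := g0 _ xab.
pose N := Num.truncn (g x / e).
have /andP[N1 N2] := truncn_itv (divr_ge0 gx0 (ltW e0)); rewrite -/N in N1 N2.
have xU k : (k < N)%N -> U k x.
  move=> kN; have [_ FU _] := hU k; apply: FU; split => /=; first by rewrite in_itv.
  by rewrite -ler_pdivlMr// (le_trans _ N1)// ler_nat.
have near_U : \forall z \near x, forall k : 'I_N, U k z.
  suff near_lt n : (n <= N)%N -> \forall z \near x, forall k, (k < n)%N -> U k z.
    by apply: filterS (near_lt N (leqnn N)) => z h k; apply: h.
  elim: n => [_|n IH nN]; first by apply: (@nearW _ (nbhs x)) => z k; rewrite ltn0.
  have Un : \forall z \near x, U n z.
    by apply: open_nbhs_nbhs; split; [have [] := hU n|exact: xU].
  apply: filterS2 (IH (ltnW nN)) Un => z h1 h2 k; rewrite ltnS leq_eqVlt.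
  by move=> /predU1P[->|/h1].
have /nbhs_ballP[d /= d0 hd] := near_U.
exists d => // y /andP[xy yd].
apply: (@le_trans _ _ (N%:R * e * (y - x))).
  rewrite ler_pM2r ?subr_gt0//; move: N2.
  by rewrite ltr_pdivrMr// -natr1 mulrDl mul1r; lra.
rewrite lerBrDr -lerBrDl; apply: Lam_le => n; rewrite lerBrDl.
apply: le_trans (L_le (maxn n N) y).
apply: (@le_trans _ _ (N%:R * e * (y - x) + L (maxn n N) x)).
  by rewrite lerD2l; apply: LN; rewrite leq_maxl.
have E z : L (maxn n N) z = L N z + \sum_(k < maxn n N - N) e * len (N + k)%N z.
  by rewrite -{1}(subnKC (leq_maxr n N)) /L big_split_ord.
rewrite !E addrA lerD//; last first.
  by apply: ler_sum => k _; rewrite ler_pM2l//; apply: len_mono; exact: ltW.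
rewrite addrC /L -mulr_sumr -mulr_sumr -mulrA mulrCA -mulrDr ler_pM2l//.
have -> : N%:R * (y - x) = \sum_(k < N) (y - x) by rewrite sumr_const card_ord mulr_natl.
rewrite -big_split/=; apply: ler_sum => k _.
apply: lengthD => //; first by case/andP: xab => /ltW.
move=> z /andP[xz zy]; apply: hd; rewrite /ball/= ltr0_norm ?subr_lt0//; lra.
Qed.

Lemma derive1_right_approx f x e : derivable f x 1 -> 0 < e ->
  exists2 d, 0 < d & forall y, x < y < x + d -> `|f y - f x - derive1 f x * (y - x)| <= e * (y - x).
Proof.
move=> dfx e0; have := dfx; rewrite /derivable derive1E /derive => /cvgrPdist_le/(_ _ e0).
move=> /nbhs_ballP[d /= d0 hd]; exists d => // y /andP[xy yd].
have yx : 0 < y - x by rewrite subr_gt0.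
have := hd (y - x); rewrite /ball/= sub0r normrN gtr0_norm// ltrBlDl => /(_ yd).
rewrite gt_eqF// /GRing.scale/= mulr1 subrK => /(_ isT).
rewrite -(ler_pM2r yx) -{2}(gtr0_norm yx) -normrM; apply: le_trans.
rewrite distrC mulrBl mulrAC mulVf ?mul1r ?gt_eqF//.
Qed.

(** Inside the interval the increments of f are locally at most those of Lam x
    + 2 * e * x, where Lam is a primitive of a majorant of the absolute value
    of the derivative. *)
Lemma increment_le_integral_norm_derive f a b : a < b ->
  derivable_oo_LRcontinuous f a b ->
  mu.-integrable `]a, b[ (fun x => (derive1 f x)%:E) ->
  f b - f a <= \int[mu]_(x in `]a, b[) `|derive1 f x|.
Proof.
move=> ab [df fa fb] if'.
set I := Rintegral _ _ _.
have dfx x : a < x < b -> derivable f x 1 by move=> xab; apply: df; rewrite in_itv.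
have inner c d : a < c -> c < d -> d < b -> f d - f c <= I.
  move=> ac cd db; apply/ler_addgt0Pr => r r0.
  pose e := r / (1 + 2 * (d - c)).
  have e0 : 0 < e by rewrite divr_gt0// addr_gt0// mulr_gt0 ?subr_gt0.
  have [|Lam [Lmono LB Lloc]] := integrable_majorant_primitive ab e0 (integrable_norm if').
    by move=> x _; exact: normr_ge0.
  have : f d - f c <= (Lam d + 2 * e * d) - (Lam c + 2 * e * c).
    apply: (@local_increment_le f (fun x => Lam x + 2 * e * x)); first exact: ltW.
    - move=> x y xy; apply: lerD; first exact: Lmono.
      by rewrite ler_pM2l// mulr_gt0.
    - move=> x /andP[cx xd]; apply: differentiable_continuous.
      by apply/derivable1_diffP; apply: dfx; rewrite (lt_le_trans ac)// (le_lt_trans xd).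
    - move=> x /andP[cx xd].
      have xab : a < x < b by rewrite (lt_le_trans ac)// (lt_trans xd).
      have [d1 d10 h1] := derive1_right_approx (dfx _ xab) e0.
      have [d2 d20 h2] := Lloc _ xab.
      exists (Num.min d1 d2); first by rewrite lt_min d10.
      move=> y /andP[xy]; rewrite -ltrBlDl lt_min !ltrBlDl => /andP[y1 y2].
      have {h1} := h1 y; rewrite xy => /(_ y1); rewrite ler_norml => /andP[_ h1].
      have {h2} := h2 y; rewrite xy => /(_ y2) h2.
      have := ler_norm (derive1 f x); rewrite -(ler_pM2r (_ : 0 < y - x)) ?subr_gt0// => h3.
      by move: h1 h2 h3; rewrite !mulrBl !mulrBr; lra.
  move=> h; apply: (le_trans h).
  have /andP[L1 _] := LB c; have /andP[_ L2] := LB d.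
  have : r = e + 2 * e * (d - c).
    by rewrite /e; field; rewrite gt_eqF// addr_gt0// mulr_gt0 ?subr_gt0.
  by move: L1 L2; rewrite -/I mulrBr; lra.
have hc c : a < c < b -> f b - f c <= I.
  move=> /andP[ac cb].
  have : (fun d => f d - f c) @ b^'- --> f b - f c by apply: cvgB => //; exact: cvg_cst.
  apply: (closed_cvg _ (@closed_le _ I)); near=> d; apply: inner => //.
rewrite -[leLHS]/(f b - f a).
have : (fun c => f b - f c) @ a^'+ --> f b - f a by apply: cvgB => //; exact: cvg_cst.
apply: (closed_cvg _ (@closed_le _ I)); near=> c; apply: hc.
by apply/andP; split; near: c; [exact: nbhs_right_gt|exact: nbhs_right_lt].
Unshelve. all: by end_near. Qed.

Lemma norm_increment_le_integral_norm_derive f a b : a < b ->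
  derivable_oo_LRcontinuous f a b ->
  mu.-integrable `]a, b[ (fun x => (derive1 f x)%:E) ->
  `|f b - f a| <= \int[mu]_(x in `]a, b[) `|derive1 f x|.
Proof.
move=> ab df if'; rewrite ler_norml increment_le_integral_norm_derive// andbT.
have [dfx fa fb] := df.
have dN x : x \in `]a, b[ -> derive1 (- f) x = - derive1 f x.
  by move=> /dfx d1; rewrite !derive1E deriveN.
have dfN : derivable_oo_LRcontinuous (- f) a b.
  by split; [move=> x /dfx; exact: derivableN|exact: cvgN|exact: cvgN].
rewrite lerNl opprB addrC.
have -> : \int[mu]_(x in `]a, b[) `|derive1 f x| = \int[mu]_(x in `]a, b[) `|derive1 (- f) x|.
  by apply: eq_Rintegral => x; rewrite inE/= => xab; rewrite dN// normrN.
have : mu.-integrable `]a, b[ (fun x => (derive1 (- f) x)%:E).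
  apply: eq_integrable (integrable_mull (-1) (measurable_itv _) if') => // x.
  by rewrite inE/= => xab; rewrite dN// mulN1r.
move=> /(increment_le_integral_norm_derive ab dfN); apply: le_trans.
by rewrite -[(- f) b]/(- f b) -[(- f) a]/(- f a) opprK addrC.
Qed.

(** The derivative is close in mean to a continuous function, with primitive
    G. The preceding bound, applied to f - G, shows that the increments of f
    and G are as close. *)
Lemma integral_derive1 f a b : a < b ->
  derivable_oo_LRcontinuous f a b ->
  mu.-integrable `]a, b[ (fun x => (derive1 f x)%:E) ->
  \int[mu]_(x in `]a, b[) derive1 f x = f b - f a.
Proof.
move=> ab df if'; have [dfx fa fb] := df.
have muab : (mu `]a, b[ < +oo)%E by rewrite /= lebesgue_measure_itv/= lte_fin ab -EFinB ltry.
have [g [cg ig glim]] := approximation_continuous_integrable (measurable_itv `]a, b[) muab if'.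
set I := Rintegral _ _ _.
pose D n := \int[mu]_(x in `]a, b[) `|derive1 f x - g n x|.
have iD n := integrable_subr (measurable_itv _) if' (ig n).
have D0 : D @ \oo --> 0 by exact: (fine_cvg glim).
have bound n : `|f b - f a - I| <= D n + D n.
  pose G x := \int[mu]_(t in `[a, x]) g n t.
  have igab c d : mu.-integrable `[c, d] (EFin \o g n).
    apply: continuous_compact_integrable; first exact: segment_compact.
    exact: continuous_subspaceT.
  have dG x : a < x -> derivable G x 1 /\ derive1 G x = g n x.
    move=> ax; have xx : x < x + 1 by rewrite ltrDl.
    exact: (@continuous_FTC1_closed _ (g n) a x (x + 1) xx (igab _ _) ax (cg n x)).
  have /(continuous_within_itvP _ ab)[_ Ga Gb] :=
    parameterized_integral_continuous (ltW ab) (igab a b).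
  have G_a : G a = 0 by rewrite /G set_itv1 Rintegral_set1.
  have G_b : G b = \int[mu]_(x in `]a, b[) g n x.
    have ioc : mu.-integrable `]a, b] (EFin \o g n).
      by apply: integrableS (igab a b) => //; exact: subset_itv_oc_cc.
    by rewrite (Rintegral_itv_bndo_bndc (ig n)) (Rintegral_itv_obnd_cbnd ioc).
  have dfG x : x \in `]a, b[ -> derivable f x 1 /\ derivable G x 1.
    by move=> xab; split; [exact: dfx|move: xab; rewrite in_itv/= => /andP[/dG[]]].
  have dh : derivable_oo_LRcontinuous (f - G) a b.
    split; [|exact: cvgB|exact: cvgB].
    by move=> x /dfG[d1 d2]; exact: (derivableB d1 d2).
  have hE x : x \in `]a, b[ -> derive1 (f - G) x = derive1 f x - g n x.
    move=> xab; have [d1 d2] := dfG _ xab; rewrite !derive1E (deriveB d1 d2) -!derive1E.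
    by move: xab; rewrite in_itv/= => /andP[/dG[_ ->]].
  have ih : mu.-integrable `]a, b[ (fun x => (derive1 (f - G) x)%:E).
    by apply: eq_integrable (iD n) => // x; rewrite inE/= => xab; rewrite hE.
  have := norm_increment_le_integral_norm_derive ab dh ih.
  rewrite (_ : Rintegral _ _ _ = D n); last first.
    by apply: eq_Rintegral => x; rewrite inE/= => xab; rewrite hE.
  rewrite -[(f - G) b]/(f b - G b) -[(f - G) a]/(f a - G a) G_a subr0 => h1.
  have h2 : `|I - G b| <= D n.
    rewrite G_b /I -Rint_sub//; [|exact: ig].
    by apply: le_normr_Rintegral => //; exact: iD.
  rewrite (_ : _ - I = (f b - G b - f a) - (I - G b)); last by ring.
  by apply: le_trans (ler_normB _ _) _; exact: lerD.
(* the bound is twice the distance in mean of the derivative and g n *)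
suff : `|f b - f a - I| <= 0 by rewrite normr_le0 subr_eq0 => /eqP.
have : D n + D n @[n --> \oo] --> 0 + 0 by exact: cvgD.
rewrite addr0; apply: (closed_cvg _ (@closed_ge _ _)).
by apply: nearW.
Qed.

End fundamental_theorem.

(** * The primitive of the Caputo derivative *)

Section caputo_primitive.
Context {R : realType}.
Notation mu := (@lebesgue_measure R).
Notation RT := (measurableTypeR R).
Variables (al X : R) (f : R -> R).
Hypotheses (al01 : 0 < al < 1) (X0 : 0 < X).
Hypotheses (f0 : f 0 = 0) (fr0 : f x @[x --> 0^'+] --> f 0).
Hypothesis df : forall t, 0 < t <= X -> derivable f t 1.

Let d t := \int[mu]_(r in `]0, t[) (derive1 f r / (t - r) `^ al).

Hypothesis id : forall t, 0 < t <= X ->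
  mu.-integrable `]0, t[ (fun r => (derive1 f r / (t - r) `^ al)%:E).

(** With k(t) = t `^ - al and f = 1 * f', the associativity and commutativity
    of the convolution give k * f = k * (1 * f') = 1 * (k * f'), and k * f' is
    d. *)
Lemma conv_pow_caputo : mu.-integrable `]0, X[ (fun t => (d t)%:E) /\
  conv (pow (- al)) f X = \int[mu]_(t in `]0, X[) d t.
Proof.
have /andP[al0 al1] := al01.
have Nal1 : -1 < - al by lra.
have kE t r : r < t -> derive1 f r / (t - r) `^ al = pow (- al) (t - r) * derive1 f r.
  by move=> rt; rewrite /pow powRN mulrC.
have idX : mu.-integrable `]0, X[ (fun r => (derive1 f r)%:E).
  have mf' : measurable_fun (`]0, X[ : set RT) (derive1 f).
    have -> : measurable_fun (`]0, X[ : set RT) (derive1 f) =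
      measurable_fun (`]0, X[ : set RT) (fun r => derive1 f r / (X - r) `^ al * (X - r) `^ al).
      apply/propext; split; apply: eq_measurable_fun => r; rewrite inE/= in_itv/= => /andP[r0 rX];
        by rewrite mulfVK// gt_eqF// powR_gt0// subr_gt0.
    apply: measurable_funM.
      by apply/measurable_EFinP; apply: (measurable_int mu); apply: id; rewrite X0 lexx.
    exact: (measurable_sub X (measurable_pow al)).
  have XX : 0 < X <= X by rewrite X0 lexx.
  have := integrable_mulr (X `^ al) (measurable_itv _) (integrable_norm (id XX)).
  move=> ig; apply: (integrable_dom (measurable_itv _) mf' ig) => r /=.
  rewrite in_itv/= => /andP[r0 rX].
  rewrite normrM normfV (ger0_norm (powR_ge0 _ _)) mulrAC ler_pdivlMr ?powR_gt0 ?subr_gt0//.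
  by apply: ler_wpM2l => //; apply: ge0_ler_powR; rewrite ?nnegrE ?(ltW al0) ?subr_ge0 ?(ltW rX) ?(ltW X0)//; lra.
pose w := (derive1 f) \_ `]0, X[.
have wE t r : t <= X -> 0 < r < t -> w r = derive1 f r.
  by move=> tX /andP[r0 rt]; rewrite /w patchE mem_set//= in_itv/= r0 (lt_le_trans rt).
have mw : measurable_fun [set: RT] w.
  apply/(measurable_restrictT _ _).1 => //; apply/measurable_EFinP; exact: (measurable_int mu idX).
have iw : mu.-integrable `]0, X[ (fun r => (w r)%:E).
  by apply: eq_integrable idX => // r; rewrite inE/= in_itv/= => /(wE X) ->.
have sub t : t <= X -> `]0, t[ `<=` (`]0, X[ : set RT).
  by move=> tX r /=; rewrite !in_itv/= => /andP[-> rt]; exact: lt_le_trans tX.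
have c0w t : 0 < t < X -> convable (pow 0) w t.
  move=> /andP[t0 tX]; have := integrable_sub (measurable_itv _) (measurable_itv _) (sub _ (ltW tX)) iw.
  by apply: eq_integrable => // r _; rewrite /pow powRr0 mul1r.
have ckw t : 0 < t <= X -> convable (pow (- al)) w t.
  move=> tX; apply: eq_integrable (id tX) => // r; rewrite inE/= in_itv/= => r0t.
  by case/andP: tX => _ tX; rewrite (wE t)// kE//; case/andP: r0t.
have fE t : 0 < t <= X -> f t = conv (pow 0) w t.
  move=> /andP[t0 tX]; rewrite conv0E.
  have dt : derivable_oo_LRcontinuous f 0 t.
    split => //.
      by move=> r; rewrite in_itv/= => /andP[r0 rt]; apply: df; rewrite r0 ltW// (lt_le_trans rt).
    apply: cvg_at_left_filter; apply: differentiable_continuous; apply/derivable1_diffP.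
    by apply: df; rewrite t0.
  have iu := integrable_sub (measurable_itv _) (measurable_itv _) (sub _ tX) idX.
  have := integral_derive1 t0 dt iu; rewrite f0 subr0 => <-.
  by apply: eq_Rintegral => r; rewrite inE/= in_itv/= => r0t; rewrite (wE t).
have dE t : 0 < t < X -> d t = conv (pow (- al)) w t.
  move=> /andP[t0 tX]; apply: eq_Rintegral => r; rewrite inE/= in_itv/= => r0t.
  by rewrite (wE t) ?(ltW tX)// kE//; case/andP: r0t.
have N1 : -1 < 0 :> R by rewrite ltrN10.
have kk t : 0 < t -> conv (pow (- al)) (pow 0) t = beta (- al) 0 * pow (1 - al) t.
  move=> t0; rewrite conv_pow//.
  by congr (_ * pow _ _); ring.
have kk' t : 0 < t -> conv (pow 0) (pow (- al)) t = beta (- al) 0 * pow (1 - al) t.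
  by move=> t0; rewrite convC ?kk//; exact: measurable_pow.
have ckk : convable (fun t => beta (- al) 0 * pow (1 - al) t) (Num.norm \o w) X.
  have := integrable_mull (`|beta (- al) 0| * X `^ (1 - al)) (measurable_itv _) (integrable_norm iw).
  move=> ig; apply: (integrable_dom (measurable_itv _) _ ig).
    apply: measurable_funM; last by apply: measurable_funTS; apply: measurableT_comp.
    by apply: measurable_funM => //; exact: (measurable_sub X (measurable_pow _)).
  move=> r /=; rewrite in_itv/= => /andP[r0 rX].
  rewrite !normrM normr_id; apply: ler_wpM2r => //; apply: ler_wpM2l => //.
  rewrite ger0_norm ?powR_ge0//; apply: ge0_ler_powR; rewrite ?nnegrE ?subr_ge0 ?(ltW rX) ?(ltW X0) ?(ltW al1)//; lra.
have [_ A1] : convable (pow (- al)) (conv (pow 0) w) X /\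
    conv (pow (- al)) (conv (pow 0) w) X = conv (conv (pow (- al)) (pow 0)) w X.
  apply: convA => //; try exact: measurable_pow.
  - by move=> t /andP[t0 _]; exact: convable_pow.
  - rewrite !norm_pow; apply: eq_convable ckk => // t; rewrite in_itv/= => /andP[t0 _].
    by rewrite kk.
have [A2 A3] : convable (pow 0) (conv (pow (- al)) w) X /\
    conv (pow 0) (conv (pow (- al)) w) X = conv (conv (pow 0) (pow (- al))) w X.
  apply: convA => //; try exact: measurable_pow.
  - by move=> t /andP[t0 tX]; apply: ckw; rewrite t0 ltW.
  - by move=> t /andP[t0 _]; exact: convable_pow.
  - rewrite !norm_pow; apply: eq_convable ckk => // t; rewrite in_itv/= => /andP[t0 _].
    by rewrite kk'.
split.
  apply: eq_integrable A2 => // t; rewrite inE/= in_itv/= => t0X.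
  by rewrite dE// /pow powRr0 mul1r.
transitivity (conv (pow (- al)) (conv (pow 0) w) X).
  by apply: eq_conv => // t; rewrite in_itv/= => /andP[t0 tX]; rewrite fE// t0 ltW.
rewrite A1; transitivity (conv (conv (pow 0) (pow (- al))) w X).
  by apply: eq_conv => // t; rewrite in_itv/= => /andP[t0 tX]; rewrite kk// kk'.
rewrite -A3 conv0E; apply: eq_Rintegral => t; rewrite inE/= in_itv/= => t0X.
by rewrite dE.
Qed.

End caputo_primitive.

(** * Functions of class C^n on an open set *)

Section smooth.
Context {R : realType}.
Implicit Types (O D : set R) (f g h p : R -> R) (x y : R) (n k : nat).

(** The continuity of all derivatives up to order n is included, so that the
    class is stable under products by induction on n. *)
Record smooth O n f : Prop := Smooth {
  smooth_continuous : forall k y, (k <= n)%N -> O y -> {for y, continuous (derive1n k f)};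
  smooth_derivable : forall k y, (k < n)%N -> O y -> derivable (derive1n k f) y 1 }.

Lemma derivable1_continuous f y : derivable f y 1 -> {for y, continuous f}.
Proof. by move=> /derivable1_diffP; exact: differentiable_continuous. Qed.

Lemma derive1nSr n f : derive1n n.+1 f = derive1n n (derive1 f).
Proof. by rewrite /derive1n iterSr. Qed.

Lemma near_open O y (P : R -> Prop) : open O -> O y -> (forall z, O z -> P z) -> \near y, P y.
Proof. by move=> oO Oy OP; apply: filterS (open_nbhs_nbhs (conj oO Oy)). Qed.

Lemma near_eq_derive1 f g y : {near y, f =1 g} -> derive1 f y = derive1 g y.
Proof. by move=> fg; rewrite !derive1E; apply: near_eq_derive. Qed.

Lemma eq_derive1n O n f g y : open O -> (forall z, O z -> f z = g z) -> O y ->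
  derive1n n f y = derive1n n g y.
Proof.
move=> oO fg; elim: n y => [|n IH] y Oy; first exact: fg.
by rewrite !derive1nS; apply: near_eq_derive1; apply: (near_open oO Oy).
Qed.

Lemma eq_derivable f g y : {near y, f =1 g} -> derivable f y 1 -> derivable g y 1.
Proof. by move=> fg; apply: near_eq_derivable. Qed.

Lemma eq_continuous_at f g y : {near y, f =1 g} -> {for y, continuous f} -> {for y, continuous g}.
Proof.
move=> fg cf; have E : f y = g y by rewrite (nbhs_singleton fg).
have : g x @[x --> y] --> f y by apply: cvg_trans cf; apply: near_eq_cvg.
by rewrite E.
Qed.

Lemma eq_smooth O n f g : open O -> (forall z, O z -> f z = g z) -> smooth O n f -> smooth O n g.
Proof.
move=> oO fg [cf df]; split=> k y kn Oy.
  by apply: eq_continuous_at (cf _ _ kn Oy); apply: (near_open oO Oy) => z Oz; exact: eq_derive1n fg Oz.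
by apply: eq_derivable (df _ _ kn Oy); apply: (near_open oO Oy) => z Oz; exact: eq_derive1n fg Oz.
Qed.

Lemma smooth_le O n m f : (m <= n)%N -> smooth O n f -> smooth O m f.
Proof.
by move=> mn [cf df]; split=> k y km; [apply: cf|apply: df]; exact: leq_trans mn.
Qed.

Lemma smooth_sub O D n f : D `<=` O -> smooth O n f -> smooth D n f.
Proof. by move=> DO [cf df]; split=> k y km /DO; [exact: cf|exact: df]. Qed.

Lemma smoothS O n f : smooth O n.+1 f <->
  (forall y, O y -> derivable f y 1) /\ smooth O n (derive1 f).
Proof.
split=> [[cf df]|[df0 [cf df]]].
  split; first by move=> y; exact: (df 0%N).
  by split=> k y kn; rewrite -derive1nSr; [exact: cf|exact: df].
split=> -[|k] y kn Oy; rewrite ?derive1nSr; [|exact: cf|exact: df0|exact: df].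
by apply: derivable1_continuous; exact: df0.
Qed.

Lemma smooth_derive1n O n k f : smooth O (k + n) f -> smooth O n (derive1n k f).
Proof.
move=> [cf df]; split=> m y mn Oy; rewrite /derive1n -iterD.
  by apply: cf => //; rewrite addnC leq_add2l.
by apply: df => //; rewrite addnC ltn_add2l.
Qed.

Lemma derive1D f g y : derivable f y 1 -> derivable g y 1 ->
  derive1 (fun z => f z + g z) y = derive1 f y + derive1 g y.
Proof. by move=> df dg; rewrite !derive1E (deriveD df dg). Qed.

Lemma derive1B f g y : derivable f y 1 -> derivable g y 1 ->
  derive1 (fun z => f z - g z) y = derive1 f y - derive1 g y.
Proof. by move=> df dg; rewrite !derive1E (deriveB df dg). Qed.

Lemma derive1M f g y : derivable f y 1 -> derivable g y 1 ->
  derive1 (fun z => f z * g z) y = derive1 f y * g y + f y * derive1 g y.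
Proof.
by move=> df dg; rewrite !derive1E (deriveM df dg) /GRing.scale/= addrC [g y * _]mulrC.
Qed.

Lemma derive1nD O n f g y : open O -> smooth O n f -> smooth O n g -> O y ->
  derive1n n (fun z => f z + g z) y = derive1n n f y + derive1n n g y.
Proof.
move=> oO sf sg; elim: n y sf sg => [//|n IH] y sf sg Oy; rewrite !derive1nS.
rewrite -derive1D; [|exact: (smooth_derivable sf (ltnSn n))|exact: (smooth_derivable sg (ltnSn n))].
apply: near_eq_derive1; apply: (near_open oO Oy) => z Oz.
by apply: IH => //; [apply: smooth_le sf|apply: smooth_le sg].
Qed.

Lemma smoothD O n f g : open O -> smooth O n f -> smooth O n g -> smooth O n (fun z => f z + g z).
Proof.
move=> oO sf sg; split=> k y kn Oy.
  apply: (@eq_continuous_at (fun z => derive1n k f z + derive1n k g z)).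
    apply: (near_open oO Oy) => z Oz; rewrite (@derive1nD O k)//.
      exact: smooth_le sf.
    exact: smooth_le sg.
  by apply: cvgD; [exact: (smooth_continuous sf kn)|exact: (smooth_continuous sg kn)].
apply: (@eq_derivable (fun z => derive1n k f z + derive1n k g z)).
  apply: (near_open oO Oy) => z Oz; rewrite (@derive1nD O k)//.
    exact: smooth_le (ltnW kn) sf.
  exact: smooth_le (ltnW kn) sg.
by apply: derivableD; [exact: (smooth_derivable sf kn)|exact: (smooth_derivable sg kn)].
Qed.

Lemma smoothM O n f g : open O -> smooth O n f -> smooth O n g -> smooth O n (fun z => f z * g z).
Proof.
move=> oO; elim: n f g => [|n IH] f g sf sg.
  split=> // k y; rewrite leqn0 => /eqP -> Oy; apply: cvgM; [exact: (@smooth_continuous _ _ _ sf 0%N)|exact: (@smooth_continuous _ _ _ sg 0%N)].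
have [df sf'] := (smoothS O n f).1 sf; have [dg sg'] := (smoothS O n g).1 sg.
apply/smoothS; split; first by move=> y Oy; apply: derivableM; [exact: df|exact: dg].
apply: (@eq_smooth O n (fun z => derive1 f z * g z + f z * derive1 g z)) => //.
  by move=> z Oz; rewrite derive1M//; [exact: df|exact: dg].
by apply: smoothD => //; apply: IH => //; [apply: smooth_le sg|apply: smooth_le sf].
Qed.

(** The binomial coefficients of Leibniz' formula add up to 2 ^+ n. *)
Lemma derive1nM_bound O n f g A B : open O -> smooth O n f -> smooth O n g ->
  (forall k y, (k <= n)%N -> O y -> `|derive1n k f y| <= A) ->
  (forall k y, (k <= n)%N -> O y -> `|derive1n k g y| <= B) ->
  forall y, O y -> `|derive1n n (fun z => f z * g z) y| <= 2 ^+ n * A * B.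
Proof.
move=> oO; elim: n f g => [|n IH] f g sf sg fA gB y Oy.
  by rewrite expr0 mul1r normrM ler_pM//; [exact: (fA 0%N)|exact: (gB 0%N)].
have [df sf'] := (smoothS O n f).1 sf; have [dg sg'] := (smoothS O n g).1 sg.
have sf0 : smooth O n f by exact: smooth_le sf.
have sg0 : smooth O n g by exact: smooth_le sg.
rewrite derive1nSr (@eq_derive1n O n _ (fun z => derive1 f z * g z + f z * derive1 g z))//; last first.
  by move=> z Oz; rewrite derive1M//; [exact: df|exact: dg].
rewrite (@derive1nD O n)//; [|exact: smoothM|exact: smoothM].
rewrite exprS (_ : 2 * 2 ^+ n * A * B = 2 ^+ n * A * B + 2 ^+ n * A * B); last by ring.
apply: le_trans (ler_normD _ _) _; apply: lerD; apply: IH => // k z kn Oz.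
- by rewrite -derive1nSr; exact: fA.
- exact/gB/Oz/leqW.
- exact/fA/Oz/leqW.
- by rewrite -derive1nSr; exact: gB.
Qed.

(** * Derivatives relative to a set *)

Lemma within_dnbhs_interior O D y : open O -> O `<=` D -> O y -> within D y^' = y^'.
Proof.
move=> oO OD Oy; apply/seteqP; split=> A; rewrite /within/=; last first.
  by move=> yA; apply: filterS yA.
move=> yA; have : \forall z \near y^', D z.
  by apply: cvg_within; apply: (near_open oO Oy).
by move=> yD; apply: filterS2 yA yD => z DA /DA.
Qed.

Lemma derive_quotE f y : (f z - f y) / (z - y) @[z --> y^'] = h^-1 *: (f (h + y) - f y) @[h --> 0^'].
Proof.
have E (h : R) : (f (h + y) - f y) / (h + y - y) = h^-1 *: (f (h + y) - f y).
  by rewrite addrK mulrC.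
apply/seteqP; split=> A.
  change ((\forall z \near y, z != y -> A ((f z - f y) / (z - y))) ->
    \forall h \near 0, h != 0 -> A (h^-1 *: (f (h + y) - f y))).
  rewrite [X in X -> _](near_shift 0); apply: filterS => h /=; rewrite subr0 E => yA h0.
  by apply: yA; rewrite -subr_eq0 addrK.
change ((\forall h \near 0, h != 0 -> A (h^-1 *: (f (h + y) - f y))) ->
  \forall z \near y, z != y -> A ((f z - f y) / (z - y))).
rewrite [X in _ -> X](near_shift 0); apply: filterS => h /=; rewrite subr0 E => yA hy.
by apply: yA; move: hy; rewrite -subr_eq0 addrK.
Qed.

Lemma derive_in_derive1 O D f y : open O -> O `<=` D -> O y -> derive_in D f y = derive1 f y.
Proof.
by move=> oO OD Oy; rewrite /derive_in /diffquo_in (within_dnbhs_interior oO OD Oy) derive_quotE.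
Qed.

Lemma derivable_in_derivable O D f y : open O -> O `<=` D -> O y ->
  derivable_in D f y -> derivable f y 1.
Proof.
move=> oO OD Oy; rewrite /derivable_in /diffquo_in (within_dnbhs_interior oO OD Oy) derive_quotE.
suff -> : (fun h : R => h^-1 *: (f (h + y) - f y)) =
  (fun h : R => h^-1 *: ((f \o shift y) (h *: 1) - f y)) by [].
by apply/funext => h /=; rewrite [h%:A]mulr1.
Qed.

(** At an interior point of D the difference quotients relative to D are the
    ordinary ones, so that all iterated derivatives can be computed with
    ordinary derivatives in the interior. *)
Lemma derive_in_nE O D f n y : open O -> O `<=` D -> O y ->
  derive_in_n D n f y = derive1n n f y.
Proof.
move=> oO OD; elim: n y => [//|n IH] y Oy; rewrite derive1nS -[LHS]/(derive_in D (derive_in_n D n f) y).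
rewrite (derive_in_derive1 _ oO OD Oy).
by apply: near_eq_derive1; apply: (near_open oO Oy).
Qed.

Lemma derivable_in_continuous D f y : D y -> derivable_in D f y -> f z @[z --> within D (nbhs y)] --> f y.
Proof.
move=> Dy /cvg_ex[/= l hl].
suff h : f z @[z --> within D y^'] --> f y.
  apply/cvgrPdist_lt => e e0; move/cvgrPdist_lt : h => /(_ _ e0); rewrite !near_withinE.
  apply: filterS => z zy Dz.
  by have [->|/zy] := eqVneq z y; [rewrite subrr normr0|exact].
have : (f z - f y) / (z - y) * (z - y) + f y @[z --> within D y^'] --> l * (y - y) + f y.
  apply: cvgD; last exact: cvg_cst.
  apply: cvgM => //; apply: cvgB; last exact: cvg_cst.
  by apply: cvg_within_filter; apply: cvg_within_filter.
rewrite subrr mulr0 add0r; apply: cvg_trans; apply: near_eq_cvg.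
rewrite near_withinE /dnbhs near_withinE; apply: nearW => z zy Dz.
by rewrite mulfVK ?subrK// subr_eq0.
Qed.

Lemma within_continuous_interior (T U : topologicalType) (O D : set T) (f : T -> U) (t : T) :
  open O -> O `<=` D -> O t -> {within D, continuous f} -> {for t, continuous f}.
Proof.
move=> oO OD Oy /subspace_continuousP/(_ t (OD _ Oy)) cf.
apply: cvg_trans cf => A; rewrite /= !nbhs_simpl /= /within/= => DA.
have yO : \forall z \near t, O z by exact: open_nbhs_nbhs.
by apply: filterS2 DA yO => z DA /OD /DA.
Qed.

Lemma contdiff_in_smooth O D n f : open O -> O `<=` D -> contdiff_in D n f -> smooth O n f.
Proof.
move=> oO OD [df cf]; split=> k y kn Oy.
  have E : \forall z \near y, derive_in_n D k f z = derive1n k f z.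
    by apply: (near_open oO Oy) => z Oz; exact: derive_in_nE OD Oz.
  move: kn; rewrite leq_eqVlt => /predU1P[kn|kn].
    apply: eq_continuous_at E _; rewrite kn.
    exact: (within_continuous_interior oO OD Oy cf).
  apply: eq_continuous_at E _; apply: derivable1_continuous.
  exact: derivable_in_derivable oO OD Oy (df _ kn _ (OD _ Oy)).
apply: (@eq_derivable (derive_in_n D k f)).
  by apply: (near_open oO Oy) => z Oz; exact: derive_in_nE OD Oz.
exact: derivable_in_derivable oO OD Oy (df _ kn _ (OD _ Oy)).
Qed.

Lemma contdiff_in_continuous D n f k : contdiff_in D n f -> (k <= n)%N ->
  {within D, continuous (derive_in_n D k f)}.
Proof.
move=> [df cf]; rewrite leq_eqVlt => /predU1P[->//|kn].
apply/subspace_continuousP => y Dy; exact: derivable_in_continuous Dy (df _ kn _ Dy).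
Qed.

(** One-sided derivatives at the end points enter the proof only as limits of
    derivatives at interior points. *)
Lemma derive1n_itv_lim a b n f : a < b -> {within `[a, b], continuous (derive_in_n `[a, b] n f)} ->
  derive1n n f y @[y --> a^'+] --> derive_in_n `[a, b] n f a /\
  derive1n n f y @[y --> b^'-] --> derive_in_n `[a, b] n f b.
Proof.
move=> ab /(continuous_within_itvP _ ab)[_ ca cb].
have E y : a < y < b -> derive_in_n `[a, b] n f y = derive1n n f y.
  move=> yab; apply: (@derive_in_nE `]a, b[) => //; exact: subset_itv_oo_cc.
split.
  apply: cvg_trans ca; apply: near_eq_cvg; near=> y; apply: E.
  by apply/andP; split; near: y; [exact: nbhs_right_gt|exact: nbhs_right_lt].
apply: cvg_trans cb; apply: near_eq_cvg; near=> y; apply: E.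
by apply/andP; split; near: y; [exact: nbhs_left_gt|exact: nbhs_left_lt].
Unshelve. all: by end_near. Qed.

Lemma derive1n_itv_bounded a b n f : a < b -> {within `[a, b], continuous (derive_in_n `[a, b] n f)} ->
  exists M, forall y, a < y < b -> `|derive1n n f y| <= M.
Proof.
move=> ab cf.
have [M [_ hM]] := compact_bounded (continuous_compact cf (@segment_compact _ a b)).
exists (M + 1) => y yab.
rewrite -(@derive_in_nE `]a, b[ `[a, b])//; last exact: subset_itv_oo_cc.
apply: (hM (M + 1)); first by rewrite ltrDl.
by exists y => //=; move: yab; rewrite in_itv/= => /andP[/ltW -> /ltW ->].
Qed.

(** * Bounds on intermediate derivatives *)

Lemma mvt_eq f a b : a < b -> (forall y, a <= y <= b -> derivable f y 1) ->
  exists2 c, a < c < b & f b - f a = derive1 f c * (b - a).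
Proof.
move=> ab df.
have [|//|c] := @MVT R f (derive1 f) a b ab.
- move=> y; rewrite in_itv/= => /andP[ay yb]; rewrite derive1E; apply: DeriveDef => //.
  by apply: df; rewrite !ltW.
- by apply: derivable_within_continuous => y; rewrite in_itv/=; exact: df.
by rewrite in_itv/= => cab h; exists c.
Qed.

Lemma mvt_bound f a b M : (forall y, a < y < b -> derivable f y 1) ->
  (forall y, a < y < b -> `|derive1 f y| <= M) ->
  forall y z, a < y < b -> a < z < b -> `|f y - f z| <= M * `|y - z|.
Proof.
move=> df dfM y z.
wlog yz : y z / y <= z.
  by move=> H yab zab; have [yz|/ltW zy] := leP y z; [exact: H|rewrite distrC [`|y - z|]distrC; exact: H].
move=> /andP[ay yb] /andP[az zb].
have [->|yz'] := eqVneq y z; first by rewrite !subrr normr0 mulr0.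
have {yz yz'}yz : y < z by rewrite lt_neqAle yz'.
have [|c /andP[yc cz] E] := @mvt_eq f y z yz.
  by move=> t /andP[yt tz]; apply: df; rewrite (lt_le_trans ay)// (le_lt_trans tz).
rewrite distrC [`|y - z|]distrC E normrM ler_wpM2r//; apply: dfM.
by rewrite (lt_trans ay)// (lt_trans cz).
Qed.

(** By induction the derivative of order n is small at some point of the left
    third and at some point of the right third of the interval; the mean value
    theorem is applied between them. *)
Lemma exists_small_derive1n n : exists2 C, 0 <= C &
  forall a b f M, a < b -> smooth `]a, b[ n f -> (forall y, a < y < b -> `|f y| <= M) ->
  exists2 c, a < c < b & `|derive1n n f c| <= C * M / (b - a) ^+ n.
Proof.
elim: n => [|n [C C0 IH]].
  exists 1 => // a b f M ab sf fM; exists ((a + b) / 2); first by apply/andP; split; lra.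
  by rewrite expr0 divr1 mul1r; apply: fM; apply/andP; split; lra.
exists (2 * 3 ^+ n.+1 * C); first by rewrite mulr_ge0// mulr_ge0// exprn_ge0.
move=> a b f M ab sf fM.
have M0 : 0 <= M.
  by apply: le_trans (fM ((a + b) / 2) _) => //; apply/andP; split; lra.
(* the points are taken in the outer thirds, hence at distance at least h *)
pose h := (b - a) / 3; have h0 : 0 < h by rewrite divr_gt0// subr_gt0.
have bE : b = a + 3 * h by rewrite /h; field.
have third c d : a <= c -> d <= b -> d = c + h ->
    exists2 y, c < y < d & `|derive1n n f y| <= C * M / h ^+ n.
  move=> ac db dE; have -> : h = d - c by rewrite dE; ring.
  apply: IH; first by rewrite dE ltrDl.
    apply: smooth_le (leqnSn n) _; apply: smooth_sub sf => y /=; rewrite !in_itv/=.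
    by move=> /andP[cy yd]; rewrite (le_lt_trans ac)// (lt_le_trans yd).
  by move=> y /andP[cy yd]; apply: fM; rewrite (le_lt_trans ac)// (lt_le_trans yd).
have [||//|c1 /andP[ac1 c1a] h1] := third a (a + h); [by []|by rewrite bE; lra|].
have [|||c2 /andP[bc2 c2b] h2] := third (b - h) b; [by rewrite bE; lra|by []|by lra|].
have c12 : h <= c2 - c1 by rewrite bE in bc2; lra.
have [|c /andP[c1c cc2] E] := @mvt_eq (derive1n n f) c1 c2 ltac:(lra).
  move=> y /andP[c1y yc2]; apply: (smooth_derivable sf (ltnSn n)) => /=.
  by rewrite in_itv/= (lt_le_trans ac1)// (le_lt_trans yc2).
exists c; first by rewrite (lt_trans ac1)// (lt_trans cc2).
have c21 : 0 < c2 - c1 by lra.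
rewrite derive1nS -(ler_pM2r c21) -{1}(gtr0_norm c21) -normrM -E.
apply: le_trans (ler_normB _ _) _; apply: le_trans (lerD h2 h1) _.
rewrite -[leLHS]mulr1.
have -> : 2 * 3 ^+ n.+1 * C * M / (b - a) ^+ n.+1 * (c2 - c1) =
    (C * M / h ^+ n + C * M / h ^+ n) * ((c2 - c1) / h).
  rewrite bE (_ : a + 3 * h - a = 3 * h); last by ring.
  rewrite exprMn !exprS; field; rewrite ?gt_eqF ?exprn_gt0//.
apply: ler_wpM2l; last by rewrite ler_pdivlMr// mul1r.
by rewrite addr_ge0// divr_ge0 ?mulr_ge0 ?exprn_ge0// ltW.
Qed.

(** Downward induction on k: the derivative of order k is small at some point
    by the preceding lemma and has a bounded derivative. *)
Lemma intermediate_derivatives_bound n : exists C, forall f M,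
  smooth `]0, 1[ n f -> (forall y, 0 < y < 1 -> `|f y| <= M) ->
  (forall y, 0 < y < 1 -> `|derive1n n f y| <= M) ->
  forall k y, (k <= n)%N -> 0 < y < 1 -> `|derive1n k f y| <= C * M.
Proof.
suff H j : (j <= n)%N -> exists2 C, 0 <= C & forall f M,
    smooth `]0, 1[ n f -> (forall y, 0 < y < 1 -> `|f y| <= M) ->
    (forall y, 0 < y < 1 -> `|derive1n n f y| <= M) ->
    forall k y, (n - j <= k <= n)%N -> 0 < y < 1 -> `|derive1n k f y| <= C * M.
  have [C _ hC] := H n (leqnn n); exists C => f M sf f0 fn k y kn.
  by apply: hC => //; rewrite subnn leq0n.
elim: j => [_|j IH jn].
  exists 1 => // f M sf f0 fn k y; rewrite subn0 -eqn_leq => /eqP <-.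
  by rewrite mul1r; exact: fn.
have [C C0 hC] := IH (ltnW jn).
have [C' C'0 hC'] := exists_small_derive1n (n - j.+1).
exists (C' + C); first by rewrite addr_ge0.
move=> f M sf f0 fn k y /andP[jk kn] y01.
have M0 : 0 <= M by apply: le_trans (f0 _ y01).
have [njk|] := leqP (n - j) k.
  apply: le_trans (hC f M sf f0 fn k y _ y01) _; first by rewrite njk.
  by rewrite ler_wpM2r// lerDr.
move=> kj; have {kj jk kn}-> : k = (n - j.+1)%N by lia.
have sn : (n - j.+1 < n)%N by lia.
have [|c c01] := hC' 0 1 f M ltr01 _ f0; first exact: smooth_le (ltnW sn) sf.
rewrite subr0 expr1n divr1 => hc.
have : `|derive1n (n - j.+1) f y - derive1n (n - j.+1) f c| <= C * M * `|y - c|.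
  apply: (@mvt_bound _ 0 1) => // z z01.
    by apply: (smooth_derivable sf sn); rewrite /= in_itv.
  by rewrite -derive1nS; apply: hC f0 fn _ _ _ z01; rewrite ?sf//; lia.
have yc1 : `|y - c| <= 1.
  rewrite ler_norml; move: y01 c01 => /andP[? ?] /andP[? ?]; apply/andP; split; lra.
move=> h; rewrite -[X in `|X|](subrK (derive1n (n - j.+1) f c)).
apply: le_trans (ler_normD _ _) _; rewrite mulrDl [leRHS]addrC; apply: lerD => //.
by apply: (le_trans h); rewrite -[leRHS]mulr1 ler_wpM2l// mulr_ge0.
Qed.

(** * The bilinear concomitant *)

Lemma derive1_sum n (F : nat -> R -> R) y : (forall i, (i < n)%N -> derivable (F i) y 1) ->
  derivable (fun z => \sum_(i < n) F i z) y 1 /\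
  derive1 (fun z => \sum_(i < n) F i z) y = \sum_(i < n) derive1 (F i) y.
Proof.
elim: n => [_|n IH dF].
  have -> : (fun z : R => \sum_(i < 0) F i z) = cst 0 by apply/funext => z; rewrite big_ord0.
  by rewrite derive1_cst big_ord0; split => //; exact: derivable_cst.
have -> : (fun z => \sum_(i < n.+1) F i z) = (fun z => \sum_(i < n) F i z + F n z).
  by apply/funext => z; rewrite big_ord_recr.
have [|d1 d2] := IH; first by move=> i ni; apply: dF; exact: ltnW.
have dn := dF n (ltnSn n).
by split; [exact: derivableD|rewrite derive1D// d2 big_ord_recr].
Qed.

Lemma continuous_sum n (F : nat -> R -> R) y : (forall i, (i < n)%N -> {for y, continuous (F i)}) ->
  {for y, continuous (fun z => \sum_(i < n) F i z)}.
Proof.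
elim: n => [_|n IH cF].
  have -> : (fun z : R => \sum_(i < 0) F i z) = cst 0 by apply/funext => z; rewrite big_ord0.
  exact: cvg_cst.
have -> : (fun z => \sum_(i < n.+1) F i z) = (fun z => \sum_(i < n) F i z + F n z).
  by apply/funext => z; rewrite big_ord_recr.
by apply: cvgD; [apply: IH => i ni; apply: cF; exact: ltnW|exact: cF].
Qed.

(** The boundary terms of j integrations by parts. *)
Definition concomitant j f g y : R :=
  \sum_(i < j) (-1) ^+ i * (derive1n (j.-1 - i) f y * derive1n i g y).

Lemma derivable_scale (c : R) f y : derivable f y 1 -> derivable (fun z => c * f z) y 1.
Proof. by move=> df; apply: derivableM => //; exact: derivable_cst. Qed.

Lemma derive1_scale (c : R) f y : derivable f y 1 -> derive1 (fun z => c * f z) y = c * derive1 f y.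
Proof.
by move=> df; rewrite derive1M// derive1_cst mul0r add0r.
Qed.

(** The product rule yields a telescoping sum. *)
Lemma derive1_concomitant O j f g y : smooth O j f -> smooth O j g -> O y ->
  derivable (concomitant j f g) y 1 /\
  derive1 (concomitant j f g) y = derive1n j f y * g y - (-1) ^+ j * (f y * derive1n j g y).
Proof.
move=> sf sg Oy; pose F i z : R := (-1) ^+ i * (derive1n (j.-1 - i) f z * derive1n i g z).
have df i : (i < j)%N -> derivable (derive1n (j.-1 - i) f) y 1.
  by move=> ij; apply: (smooth_derivable sf) => //; lia.
have dg i : (i < j)%N -> derivable (derive1n i g) y 1.
  by move=> ij; apply: (smooth_derivable sg).
have dfg i : (i < j)%N -> derivable (fun z => derive1n (j.-1 - i) f z * derive1n i g z) y 1.
  by move=> ij; apply: derivableM; [exact: df|exact: dg].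
have [|dS ->] := @derive1_sum j F y; first by move=> i ij; apply: derivable_scale; exact: dfg.
split => //; pose T i : R := (-1) ^+ i * (derive1n (j - i) f y * derive1n i g y).
transitivity (\sum_(0 <= i < j) (T i - T i.+1)).
  rewrite big_mkord; apply: eq_bigr => i _; rewrite derive1_scale; last exact: dfg.
  rewrite derive1M; [|exact: df|exact: dg].
  rewrite /T -!derive1nS exprS (_ : (j - i)%N = (j.-1 - i).+1); last by have := ltn_ord i; lia.
  by rewrite (_ : (j - i.+1)%N = (j.-1 - i)%N); [ring|have := ltn_ord i; lia].
rewrite (eq_bigr (fun i => - (T i.+1 - T i))); last by move=> i _; rewrite opprB.
by rewrite sumrN telescope_sumr// opprB /T subn0 subnn expr0 mul1r.
Qed.

(** Assigning to f its limits at the end points reduces this to the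
    fundamental theorem above. *)
Lemma integral_derive1_lim f g a b A B : a < b ->
  (forall y, a < y < b -> derivable f y 1) ->
  (forall y, a < y < b -> derive1 f y = g y) ->
  f y @[y --> a^'+] --> A -> f y @[y --> b^'-] --> B ->
  (@lebesgue_measure R).-integrable `]a, b[ (fun y => (g y)%:E) ->
  \int[lebesgue_measure]_(y in `]a, b[) g y = B - A.
Proof.
move=> ab df dfg fA fB ig.
pose F y := if y <= a then A else if b <= y then B else f y.
have FE y : a < y < b -> F y = f y by move=> /andP[ay yb]; rewrite /F !leNgt ay yb.
have Fn y : a < y < b -> {near y, f =1 F}.
  move=> yab; apply: (@near_open `]a, b[%classic y) => [||z /=]; first exact: interval_open.
    by rewrite /= in_itv.
  by rewrite in_itv/= => /FE ->.
have dF y : a < y < b -> derive1 F y = g y.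
  by move=> yab; rewrite -dfg//; apply/esym/near_eq_derive1; exact: Fn.
have Fa : F a = A by rewrite /F lexx.
have Fb : F b = B by rewrite /F lexx leNgt ab.
have := @integral_derive1 R F a b ab; rewrite Fa Fb => <-.
- by apply: eq_Rintegral => y; rewrite inE/= in_itv/= => /dF.
- split.
  + move=> y; rewrite in_itv/= => yab; apply: eq_derivable (df _ yab); exact: Fn.
  + rewrite Fa; apply: cvg_trans fA; apply: near_eq_cvg; near=> y; apply/esym/FE.
    by apply/andP; split; near: y; [exact: nbhs_right_gt|exact: nbhs_right_lt].
  + rewrite Fb; apply: cvg_trans fB; apply: near_eq_cvg; near=> y; apply/esym/FE.
    by apply/andP; split; near: y; [exact: nbhs_left_gt|exact: nbhs_left_lt].
- by apply: eq_integrable ig => // y; rewrite inE/= in_itv/= => /dF ->.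
Unshelve. all: by end_near. Qed.

End smooth.

(** * The Green identity *)

Section green.
Context {R : realType}.
Notation mu := (@lebesgue_measure R).
Implicit Types (O D : set R) (f g h w : R -> R) (x y a b M : R) (n k : nat).
Variables (s : nat) (p : nat -> R -> R).
Hypothesis s1 : (1 <= s)%N.

(** Setting p s = 1 gives the leading term of l the same form as the others. *)
Definition coef (j : nat) : R -> R := if (j < s)%N then p j else cst 1.

Definition momentum (j : nat) f : R -> R := fun z => coef j z * derive1n j f z.

(** The expression l written with ordinary derivatives; the leading term is
    the last one of the sum. *)
Definition Lop f y : R :=
  \sum_(j < s) (-1) ^+ j.+1 * derive1n j.+1 (momentum j.+1 f) y + p 0%N y * f y.

Lemma lexpr_Lop O D f y : open O -> O `<=` D -> O y -> lexpr D s p f y = Lop f y.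
Proof.
move=> oO OD Oy; rewrite /lexpr /Lop; congr (_ + _).
have dE n h z : O z -> derive_in_n D n h z = derive1n n h z by exact: derive_in_nE.
have E j : (j < s)%N ->
    derive_in_n D j (fun z => p j z * derive_in_n D j f z) y = derive1n j (momentum j f) y.
  move=> js; rewrite dE//; apply: (@eq_derive1n _ O) => // z Oz.
  by rewrite /momentum /coef js dE.
have ES : derive_in_n D s.*2 f y = derive1n s (momentum s f) y.
  rewrite dE// -addnn /derive1n iterD -/(derive1n s f).
  by have -> : momentum s f = derive1n s f by apply/funext => z; rewrite /momentum /coef ltnn mul1r.
case: s s1 E ES => [//|s'] _ E ES.
rewrite ES big_ord_recr /= addrC; congr (_ + _).
rewrite big_add1/= big_mkord; apply: eq_bigr => j _.
exact: (congr1 ( *%R ((-1) ^+ j.+1)) (E j.+1 (ltn_ord j))).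
Qed.

Hypothesis smooth_p : forall j, (j < s)%N -> smooth `]0, 1[ j (p j).

Lemma derive1n_cst k (c : R) : derive1n k (cst c : R -> R) = cst (if k is 0%N then c else 0).
Proof.
elim: k => [//|k IH]; rewrite derive1nS IH; apply/funext => z.
by case: k {IH} => [|k]; rewrite derive1_cst.
Qed.

Lemma smooth_cst O n (c : R) : smooth O n (cst c).
Proof. by split=> k y _ _; rewrite derive1n_cst; [exact: cvg_cst|exact: derivable_cst]. Qed.

Lemma smooth_coef O j : O `<=` `]0, 1[ -> smooth O j (coef j).
Proof.
move=> O01; rewrite /coef; case: ifP => js; last exact: smooth_cst.
exact: smooth_sub O01 (smooth_p js).
Qed.

Lemma smooth_momentum O j n f : open O -> O `<=` `]0, 1[ -> (n <= j)%N -> smooth O (j + n) f ->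
  smooth O n (momentum j f).
Proof.
move=> oO O01 nj sf; apply: smoothM => //; last exact: smooth_derive1n.
by apply: (smooth_le nj); exact: smooth_coef.
Qed.

Lemma Lop_continuous f y : smooth `]0, 1[ s.*2 f -> 0 < y < 1 -> {for y, continuous (Lop f)}.
Proof.
move=> sf y01; have Oy : (`]0, 1[%classic : set R) y by rewrite /= in_itv.
have c0 : {for y, continuous (fun z => p 0%N z * f z)}.
  apply: cvgM; first exact: (smooth_continuous (smooth_p s1) (leqnn 0) Oy).
  exact: (smooth_continuous sf (leq0n _) Oy).
apply: cvgD => //; apply: (@continuous_sum _ s (fun j z =>
  (-1) ^+ j.+1 * derive1n j.+1 (momentum j.+1 f) z)) => j js.
apply: cvgM; first exact: cvg_cst.
apply: (smooth_continuous _ (leqnn _) Oy); apply: smooth_momentum => //.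
by apply: smooth_le sf; rewrite addnn leq_double.
Qed.

Definition bracket f g y : R :=
  \sum_(j < s) (-1) ^+ j.+1 *
    (concomitant j.+1 (momentum j.+1 f) g y - concomitant j.+1 (momentum j.+1 g) f y).

(** In each order the two concomitants contribute the same symmetric term, the
    product of the coefficient and the two derivatives of order j, which
    cancels. *)
Lemma lagrange_identity O f g y : open O -> O `<=` `]0, 1[ -> smooth O s.*2 f -> smooth O s.*2 g ->
  O y -> derivable (bracket f g) y 1 /\ derive1 (bracket f g) y = Lop f y * g y - Lop g y * f y.
Proof.
move=> oO O01 sf sg Oy.
pose F j z := (-1) ^+ j.+1 *
    (concomitant j.+1 (momentum j.+1 f) g z - concomitant j.+1 (momentum j.+1 g) f z).
have conc h (k : R -> R) j : smooth O s.*2 h -> smooth O s.*2 k -> (j < s)%N ->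
    derivable (concomitant j.+1 (momentum j.+1 h) k) y 1 /\
    derive1 (concomitant j.+1 (momentum j.+1 h) k) y =
    derive1n j.+1 (momentum j.+1 h) y * k y -
    (-1) ^+ j.+1 * (coef j.+1 y * derive1n j.+1 h y * derive1n j.+1 k y).
  move=> sh sk js; apply: (derive1_concomitant _ _ Oy).
    by apply: smooth_momentum => //; apply: smooth_le sh; rewrite addnn leq_double.
  by apply: smooth_le sk; rewrite (leq_trans js)// -addnn leq_addr.
have dF j : (j < s)%N -> derivable (F j) y 1 /\ derive1 (F j) y =
    (-1) ^+ j.+1 * derive1n j.+1 (momentum j.+1 f) y * g y -
    (-1) ^+ j.+1 * derive1n j.+1 (momentum j.+1 g) y * f y.
  move=> js; have [d1 e1] := conc f g j sf sg js; have [d2 e2] := conc g f j sg sf js.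
  have dB := derivableB d1 d2; split; first exact: derivable_scale.
  rewrite derive1_scale// derive1B// e1 e2.
  move: (derive1n j.+1 (momentum j.+1 f) y) (derive1n j.+1 (momentum j.+1 g) y) (coef j.+1 y)
    (derive1n j.+1 f y) (derive1n j.+1 g y) (f y) (g y) ((-1) ^+ j.+1) => A B C a b u v e.
  by ring.
have [|d1 ->] := @derive1_sum R s F y; first by move=> j /dF[].
split => //; rewrite (eq_bigr (fun j : 'I_s => (-1) ^+ j.+1 * derive1n j.+1 (momentum j.+1 f) y * g y -
    (-1) ^+ j.+1 * derive1n j.+1 (momentum j.+1 g) y * f y)); last by move=> j _; have [] := dF j (ltn_ord j).
have key (A B P u v : R) : A * v - B * u = (A + P * u) * v - (B + P * v) * u by ring.
by rewrite sumrB -!mulr_suml; exact: key.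
Qed.

(** What the estimates need to know of a slice u(x, .) of a solution; a
    constant M common to all slices makes them uniform in x. *)
Record admissible M w : Prop := Admissible {
  admissible_smooth : smooth `]0, 1[ s.*2 w;
  admissible_bound : forall k y, (k < s.*2)%N -> 0 < y < 1 -> `|derive1n k w y| <= M;
  admissible_vanish : forall k y, (k < s)%N -> 0 < y < 1 ->
    `|derive1n k w y| <= M * Num.min y (1 - y) }.

Variables (A B M : R) (xi : R) (g : R -> R) (Lm Lp : R).
Hypotheses (A1 : 1 <= A) (B0 : 0 <= B) (M0 : 0 <= M) (xi01 : 0 < xi < 1).
Hypothesis pA : forall j k y, (j < s)%N -> (k <= j)%N -> 0 < y < 1 -> `|derive1n k (p j) y| <= A.
Hypothesis g_smooth : smooth `]0, 1[ s.*2.-2 g.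
Hypotheses (gl_smooth : smooth `]0, xi[ s.*2 g) (gr_smooth : smooth `]xi, 1[ s.*2 g).
Hypothesis gB : forall k y, (k < s.*2)%N -> 0 < y < 1 -> y != xi -> `|derive1n k g y| <= B.
Hypothesis Lg : forall y, 0 < y < 1 -> y != xi -> Lop g y = 0.
Hypothesis g_left : derive1n s.*2.-1 g y @[y --> xi^'-] --> Lm.
Hypothesis g_right : derive1n s.*2.-1 g y @[y --> xi^'+] --> Lp.
Hypothesis jump : Lp - Lm = (-1) ^+ s.
Hypothesis g0 : forall k, (k < s)%N -> derive1n k g y @[y --> 0^'+] --> 0.
Hypothesis g1 : forall k, (k < s)%N -> derive1n k g y @[y --> 1^'-] --> 0.

Let A0 : 0 <= A. Proof. exact: le_trans A1. Qed.

Let coefA j k y : (k <= j)%N -> 0 < y < 1 -> `|derive1n k (coef j) y| <= A.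
Proof.
move=> kj y01; rewrite /coef; case: ifP => js; first exact: pA.
by rewrite derive1n_cst; case: k {kj} => [|k] /=; rewrite ?normr1 ?normr0.
Qed.

Let momentum_bound O h C n j y : open O -> O `<=` `]0, 1[ -> (n < j <= s)%N -> smooth O s.*2 h ->
  (forall k z, (k < s.*2)%N -> O z -> `|derive1n k h z| <= C) -> O y ->
  `|derive1n n (momentum j h) y| <= 2 ^+ s * A * C.
Proof.
move=> oO O01 /andP[nj js] sh hC Oy.
have C0 : 0 <= C by apply: le_trans (hC 0%N y _ Oy) => //; rewrite double_gt0.
have n2 : 2 ^+ n <= 2 ^+ s :> R by rewrite ler_eXn2l ?ltr1n// (leq_trans (ltnW nj)).
apply: (@le_trans _ _ (2 ^+ n * A * C)); last by rewrite ler_wpM2r// ler_wpM2r.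
apply: (@derive1nM_bound R O n (coef j) (derive1n j h) A C oO) => //.
- by apply: (smooth_le (ltnW nj)); exact: smooth_coef.
- by apply: smooth_derive1n; apply: smooth_le sh; rewrite -addnn leq_add// (leq_trans (ltnW nj)).
- by move=> k z kn /O01; rewrite /= in_itv/=; apply: coefA; exact: leq_trans kn (ltnW nj).
- move=> k z kn Oz; rewrite /derive1n -iterD; apply: hC => //.
  by rewrite -addnn; lia.
Qed.

(** A majorant of the bracket with g that is the same for all admissible
    functions. *)
Definition bracket_bound y : R :=
  \sum_(j < s) \sum_(i < j.+1) (2 ^+ s * A * M * `|derive1n i g y| + 2 ^+ s * A * B * (M * Num.min y (1 - y))).

Lemma bracket_le w y : admissible M w -> 0 < y < 1 -> y != xi -> `|bracket w g y| <= bracket_bound y.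
Proof.
move=> [sw wM w0] y01 yxi.
apply: le_trans (ler_norm_sum _ _ _) _; apply: ler_sum => j _.
rewrite normrM normrX normrN1 expr1n mul1r /concomitant -sumrB.
apply: le_trans (ler_norm_sum _ _ _) _; apply: ler_sum => i _.
have ij := ltn_ord i; have js := ltn_ord j.
rewrite -mulrBr normrM normrX normrN1 expr1n mul1r /=.
apply: le_trans (ler_normB _ _) _; apply: lerD; rewrite normrM.
  apply: ler_wpM2r => //; apply: (@momentum_bound `]0, 1[); [exact: interval_open|by []| |exact: sw| |].
  - by rewrite js andbT ltnS leq_subr.
  - by move=> k z ks; rewrite /= in_itv/=; exact: wM.
  - by rewrite /= in_itv.
apply: ler_pM => //; last by apply: w0 => //; lia.
have [yl|yr|E] := ltgtP y xi; last by rewrite E eqxx in yxi.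
  apply: (@momentum_bound `]0, xi[); [exact: interval_open| | |exact: gl_smooth| |].
  - by move=> z /=; rewrite !in_itv/= => /andP[-> zxi]; case/andP: xi01 => _; exact: lt_trans.
  - by rewrite js andbT ltnS leq_subr.
  - move=> k z ks; rewrite /= in_itv/= => /andP[z0 zxi]; apply: gB => //.
      by rewrite z0; case/andP: xi01 => _; exact: lt_trans.
    by rewrite lt_eqF.
  - by rewrite /= in_itv/= yl; case/andP: y01 => ->.
apply: (@momentum_bound `]xi, 1[); [exact: interval_open| | |exact: gr_smooth| |].
- by move=> z /=; rewrite !in_itv/= => /andP[xiz ->]; case/andP: xi01 => /lt_trans ->.
- by rewrite js andbT ltnS leq_subr.
- move=> k z ks; rewrite /= in_itv/= => /andP[xiz z1]; apply: gB => //.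
    by rewrite z1; case/andP: xi01 => /lt_trans ->.
  by rewrite gt_eqF.
- by rewrite /= in_itv/= yr; case/andP: y01 => _ ->.
Qed.

Let mini_right : (fun y : R => Num.min y (1 - y)) y @[y --> 0^'+] --> 0.
Proof.
have : {for 0, continuous (fun y : R => Num.min y (1 - y))}.
  apply: continuous_min; first exact: cvg_id.
  by apply: cvgB; [exact: cvg_cst|exact: cvg_id].
move=> c; have E : Num.min 0 (1 - 0) = 0 :> R by rewrite subr0 min_l.
by rewrite -[X in _ --> X]E; exact: cvg_at_right_filter.
Qed.

Let mini_left : (fun y : R => Num.min y (1 - y)) y @[y --> 1^'-] --> 0.
Proof.
have : {for 1, continuous (fun y : R => Num.min y (1 - y))}.
  apply: continuous_min; first exact: cvg_id.
  by apply: cvgB; [exact: cvg_cst|exact: cvg_id].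
move=> c; have E : Num.min 1 (1 - 1) = 0 :> R by rewrite subrr min_r.
by rewrite -[X in _ --> X]E; exact: cvg_at_left_filter.
Qed.

Lemma cvg_sum0 (F : set_system R) {FF : Filter F} n (h : nat -> R -> R) :
  (forall i, (i < n)%N -> h i y @[y --> F] --> 0) -> \sum_(i < n) h i y @[y --> F] --> 0.
Proof.
elim: n => [_|n IH hn].
  have -> : (fun y : R => \sum_(i < 0) h i y) = cst 0 by apply/funext => z; rewrite big_ord0.
  exact: cvg_cst.
have -> : (fun y => \sum_(i < n.+1) h i y) = (fun y => \sum_(i < n) h i y + h n y).
  by apply/funext => z; rewrite big_ord_recr.
rewrite -[X in _ --> X](addr0 0).
by apply: cvgD; [apply: IH => i ni; apply: hn; exact: ltnW|exact: hn].
Qed.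

Lemma bracket_bound_cvg0 (F : set_system R) {FF : Filter F} :
  (forall k, (k < s)%N -> derive1n k g y @[y --> F] --> 0) ->
  Num.min y (1 - y) @[y --> F] --> 0 ->
  bracket_bound y @[y --> F] --> 0.
Proof.
move=> gF mF; apply: (@cvg_sum0 F FF s (fun j y => \sum_(i < j.+1) (2 ^+ s * A * M * `|derive1n i g y| + 2 ^+ s * A * B * (M * Num.min y (1 - y))))) => j js.
apply: (@cvg_sum0 F FF j.+1 (fun i y => 2 ^+ s * A * M * `|derive1n i g y| + 2 ^+ s * A * B * (M * Num.min y (1 - y)))) => i ij.
have E : 2 ^+ s * A * M * `|0 : R| + 2 ^+ s * A * B * (M * 0) = 0 by rewrite normr0 !mulr0 addr0.
rewrite -[X in _ --> X]E.
apply: cvgD; apply: cvgM; try exact: cvg_cst.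
  by apply: cvg_norm; apply: gF; exact: leq_trans ij js.
by apply: cvgM => //; exact: cvg_cst.
Qed.

Lemma bracket_bound_right : bracket_bound y @[y --> 0^'+] --> 0.
Proof. exact: bracket_bound_cvg0. Qed.

Lemma bracket_bound_left : bracket_bound y @[y --> 1^'-] --> 0.
Proof. exact: bracket_bound_cvg0. Qed.

Let xiO : (`]0, 1[%classic : set R) xi. Proof. by rewrite /= in_itv. Qed.

Let term w j i y : R := (-1) ^+ i * (derive1n (j - i) (momentum j.+1 g) y * derive1n i w y).

(** The bracket without the only summand in which the derivative of order 2s -
    1 of g occurs. This summand, with j + 1 = s and i = 0, is the only
    discontinuous one at xi. *)
Let bracket_reg w y : R := \sum_(j < s) (-1) ^+ j.+1 *
  (concomitant j.+1 (momentum j.+1 w) g y -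
   \sum_(i < j.+1) if (j.+1 < s)%N || (0 < i)%N then term w j i y else 0).

Let bracket_split w y : bracket w g y =
  bracket_reg w y - (-1) ^+ s * (derive1n s.-1 (momentum s g) y * w y).
Proof.
have ps : (s.-1 < s)%N by rewrite prednK.
transitivity (bracket_reg w y - \sum_(j < s) (-1) ^+ j.+1 *
    \sum_(i < j.+1) if (j.+1 < s)%N || (0 < i)%N then 0 else term w j i y).
  rewrite -sumrB; apply: eq_bigr => j _; rewrite -mulrBr; congr (_ * _).
  rewrite -addrA -opprD -big_split/=; congr (_ - _).
  by apply: eq_bigr => i _; case: ifP => _; rewrite ?addr0 ?add0r.
congr (_ - _); rewrite (bigD1 (Ordinal ps))//= [X in _ + X]big1 ?addr0; last first.
  move=> j /eqP jp; rewrite big1 ?mulr0// => i _; rewrite ifT//; apply/orP; left.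
  have : (j : nat) <> s.-1 by move=> E; apply: jp; exact: val_inj.
  by have := ltn_ord j; lia.
rewrite big_ord_recl/= big1 ?addr0; last by move=> i _; rewrite orbT.
by rewrite prednK// ltnn/= /term subn0 expr0 mul1r prednK.
Qed.

Let bracket_reg_continuous w : smooth `]0, 1[ s.*2 w -> {for xi, continuous (bracket_reg w)}.
Proof.
move=> sw.
have cw k : (k <= s.*2)%N -> {for xi, continuous (derive1n k w)}.
  by move=> ks; exact: (smooth_continuous sw ks xiO).
have cg k : (k <= s.*2.-2)%N -> {for xi, continuous (derive1n k g)}.
  by move=> ks; exact: (smooth_continuous g_smooth ks xiO).
have conc j : (j < s)%N -> {for xi, continuous (concomitant j.+1 (momentum j.+1 w) g)}.
  move=> js; apply: (@continuous_sum _ j.+1 (fun i z => (-1) ^+ i * (derive1n (j - i) (momentum j.+1 w) z * derive1n i g z))) => i ij.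
  apply: cvgM; first exact: cvg_cst.
  apply: cvgM; last by apply: cg; lia.
  have sm : smooth `]0, 1[ (j - i) (momentum j.+1 w).
    apply: smooth_momentum; [exact: interval_open|by []|lia|].
    by apply: smooth_le sw; lia.
  exact: (smooth_continuous sm (leqnn _) xiO).
have cterm j i : (j < s)%N -> (i <= j)%N -> (j.+1 < s)%N || (0 < i)%N ->
    {for xi, continuous (term w j i)}.
  move=> js ij ji; apply: cvgM; first exact: cvg_cst.
  apply: cvgM; last by apply: cw; lia.
  have sm : smooth `]0, 1[ (j - i) (momentum j.+1 g).
    apply: smooth_momentum; [exact: interval_open|by []|lia|].
    by apply: smooth_le g_smooth; lia.
  exact: (smooth_continuous sm (leqnn _) xiO).
apply: (@continuous_sum _ s (fun j y => (-1) ^+ j.+1 *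
  (concomitant j.+1 (momentum j.+1 w) g y -
   \sum_(i < j.+1) if (j.+1 < s)%N || (0 < i)%N then term w j i y else 0))) => j js.
apply: cvgM; first exact: cvg_cst.
apply: cvgB; first exact: conc.
apply: (@continuous_sum _ j.+1 (fun i y => if (j.+1 < s)%N || (0 < i)%N then term w j i y else 0)) => i ij.
by have [ji|_] := boolP ((j.+1 < s)%N || (0 < i)%N); [exact: cterm|exact: cvg_cst].
Qed.

Let lead_momentum y : derive1n s.-1 (momentum s g) y = derive1n s.*2.-1 g y.
Proof.
have -> : momentum s g = derive1n s g by apply/funext => z; rewrite /momentum /coef ltnn mul1r.
by rewrite /derive1n -iterD (_ : (s.-1 + s)%N = s.*2.-1)//; lia.
Qed.

Lemma bracket_left w : smooth `]0, 1[ s.*2 w ->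
  bracket w g y @[y --> xi^'-] --> bracket_reg w xi - (-1) ^+ s * (Lm * w xi).
Proof.
move=> sw; have -> : bracket w g = (fun y => bracket_reg w y - (-1) ^+ s * (derive1n s.*2.-1 g y * w y)).
  by apply/funext => y; rewrite bracket_split lead_momentum.
apply: cvgB; first by apply: cvg_at_left_filter; exact: bracket_reg_continuous.
apply: cvgM; first exact: cvg_cst.
apply: cvgM => //; apply: cvg_at_left_filter; exact: (smooth_continuous sw (leq0n _) xiO).
Qed.

Lemma bracket_right w : smooth `]0, 1[ s.*2 w ->
  bracket w g y @[y --> xi^'+] --> bracket_reg w xi - (-1) ^+ s * (Lp * w xi).
Proof.
move=> sw; have -> : bracket w g = (fun y => bracket_reg w y - (-1) ^+ s * (derive1n s.*2.-1 g y * w y)).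
  by apply/funext => y; rewrite bracket_split lead_momentum.
apply: cvgB; first by apply: cvg_at_right_filter; exact: bracket_reg_continuous.
apply: cvgM; first exact: cvg_cst.
apply: cvgM => //; apply: cvg_at_right_filter; exact: (smooth_continuous sw (leq0n _) xiO).
Qed.

(** Lagrange's identity is integrated over ]a, xi[ and over ]xi, b[. By the
    jump condition on g the bracket jumps by w xi at xi; the brackets at a and
    b remain. *)
Lemma green_identity_le w a b : admissible M w -> 0 < a -> a < xi -> xi < b -> b < 1 ->
  `|\int[mu]_(y in `]a, b[) (Lop w y * g y) - w xi| <= bracket_bound a + bracket_bound b.
Proof.
move=> aw a0 axi xib b1; have [sw _ _] := aw.
have cont y : 0 < y < 1 -> {for y, continuous (fun z => Lop w z * g z)}.
  move=> y01; apply: cvgM; first exact: Lop_continuous.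
  by apply: (smooth_continuous g_smooth (leq0n _)); rewrite /= in_itv.
have int c d : 0 < c -> d < 1 -> mu.-integrable `]c, d[ (fun y => (Lop w y * g y)%:E).
  by move=> c0 d1; exact: (open_itv_continuous_integrable c0 d1 cont).
have lag y : 0 < y < 1 -> y != xi ->
    derivable (bracket w g) y 1 /\ derive1 (bracket w g) y = Lop w y * g y.
  move=> y01 yxi; have /andP[y0 y1] := y01; have /andP[xi0 xi1] := xi01.
  suff : derivable (bracket w g) y 1 /\ derive1 (bracket w g) y = Lop w y * g y - Lop g y * w y.
    by rewrite (Lg y01 yxi) mul0r subr0.
  have [yl|yr|E] := ltgtP y xi; last by rewrite E eqxx in yxi.
    apply: (@lagrange_identity `]0, xi[); [exact: interval_open| | |exact: gl_smooth|by rewrite /= in_itv/= y0].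
      by move=> z /=; rewrite !in_itv/= => /andP[-> zxi]; exact: lt_trans xi1.
    apply: smooth_sub sw => z /=; rewrite !in_itv/= => /andP[-> zxi]; exact: lt_trans xi1.
  apply: (@lagrange_identity `]xi, 1[); [exact: interval_open| | |exact: gr_smooth|by rewrite /= in_itv/= yr].
    by move=> z /=; rewrite !in_itv/= => /andP[xiz ->]; rewrite (lt_trans xi0).
  apply: smooth_sub sw => z /=; rewrite !in_itv/= => /andP[xiz ->]; by rewrite (lt_trans xi0).
have cbr y : 0 < y < 1 -> y != xi -> {for y, continuous (bracket w g)}.
  by move=> y01 yxi; apply: derivable1_continuous; have [] := lag y y01 yxi.
have /andP[xi0 xi1] := xi01.
have inl y : a < y < xi -> 0 < y < 1 /\ y != xi.
  by move=> /andP[ay yxi]; rewrite (lt_trans a0 ay) (lt_trans yxi xi1) (lt_eqF yxi).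
have inr y : xi < y < b -> 0 < y < 1 /\ y != xi.
  by move=> /andP[ay yxi]; rewrite (lt_trans xi0 ay) (lt_trans yxi b1) (gt_eqF ay).
rewrite (@Rint_split R _ a xi b axi xib (int _ _ a0 b1)).
rewrite (@integral_derive1_lim R (bracket w g) _ a xi (bracket w g a) _ axi _ _ _ (bracket_left sw)); first last.
- exact: int.
- by apply: cvg_at_right_filter; apply: cbr; rewrite ?a0 ?(lt_trans axi xi1)// lt_eqF.
- by move=> y /inl[y01 yxi]; have [] := lag y y01 yxi.
- by move=> y /inl[y01 yxi]; have [] := lag y y01 yxi.
rewrite (@integral_derive1_lim R (bracket w g) _ xi b _ (bracket w g b) xib _ _ (bracket_right sw)); first last.
- exact: int.
- by apply: cvg_at_left_filter; apply: cbr; rewrite ?(lt_trans xi0 xib)// gt_eqF.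
- by move=> y /inr[y01 yxi]; have [] := lag y y01 yxi.
- by move=> y /inr[y01 yxi]; have [] := lag y y01 yxi.
have wE : (-1) ^+ s * (Lp * w xi) - (-1) ^+ s * (Lm * w xi) = w xi.
  by rewrite -mulrBr -mulrBl jump mulrA -exprMn mulrNN mulr1 expr1n mul1r.
set r := bracket_reg w xi; rewrite (_ : _ - w xi = bracket w g b - bracket w g a); last first.
  by rewrite -[X in _ - X]wE; ring.
apply: le_trans (ler_normB _ _) _; rewrite addrC; apply: lerD.
  by apply: bracket_le => //; rewrite ?a0 ?(lt_trans axi xi1)// lt_eqF.
by apply: bracket_le => //; rewrite ?(lt_trans xi0 xib)// gt_eqF.
Qed.

End green.

(** * From the differential equation to the evolution equation *)

Lemma within_rect_bounded (R : realType) (a b c d : R) (f : R -> R -> R) :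
  {within `[a, b] `*` `[c, d], continuous (fun q : R * R => f q.1 q.2)} ->
  exists B, forall x y, a <= x <= b -> c <= y <= d -> `|f x y| <= B.
Proof.
move=> cf.
have K : compact (`[a, b] `*` `[c, d] : set (R * R)).
  by apply: compact_setX; exact: segment_compact.
have [M [_ hM]] := compact_bounded (continuous_compact cf K).
exists (M + 1) => x y xab ycd; apply: (hM (M + 1)); first by rewrite ltrDl.
by exists (x, y) => //=; rewrite !in_itv/=.
Qed.

Lemma continuous_rect_bounded (R : realType) (a b c d : R) (f : R -> R -> R) :
  (forall x y, a <= x <= b -> c <= y <= d -> {for (x, y), continuous (fun q : R * R => f q.1 q.2)}) ->
  exists B, forall x y, a <= x <= b -> c <= y <= d -> `|f x y| <= B.
Proof.
move=> cf; apply: within_rect_bounded.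
by apply: continuous_in_subspaceT => -[x y]; rewrite inE => -[/= xab ycd]; exact: cf.
Qed.

Section evolution_identity.
Context {R : realType}.
Notation mu := (@lebesgue_measure R).
Notation RT := (measurableTypeR R).
Variables (al be c0 N M xi X : R) (Gb v h : R -> R -> R) (kap eta : R -> R).
Hypotheses (al01 : 0 < al < 1) (albe : - al < be).
Hypothesis Gcont : forall y, 0 < y < 1 -> {for y, continuous (Gb ^~ xi)}.
Hypothesis GN : forall y, 0 < y < 1 -> `|Gb y xi| <= N.
Hypothesis vcont : forall x y, 0 < x < 1 -> 0 < y < 1 ->
  {for (x, y), continuous (fun q : R * R => v q.1 q.2)}.
Hypothesis vM : forall x y, 0 < x < 1 -> 0 < y < 1 -> `|v x y| <= M.
Hypotheses (xi01 : 0 < xi < 1) (X01 : 0 < X < 1).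
Hypothesis kap0 : forall y, 0 < y < 1 -> 0 < kap y.
Hypothesis kapcont : forall y, 0 < y < 1 -> {for y, continuous kap}.
Hypothesis hcont : forall x y, 0 < x < 1 -> 0 < y < 1 ->
  {for (x, y), continuous (fun q : R * R => h q.1 q.2)}.

Let Q x y := conv (pow (- al)) (v ^~ y) x.

Hypothesis h_int : forall x y, 0 < x < 1 -> 0 < y < 1 ->
  mu.-integrable `]0, x[ (fun t => (t `^ be * h t y)%:E).
Hypothesis h_prim : forall x y, 0 < x < 1 -> 0 < y < 1 ->
  \int[mu]_(t in `]0, x[) (t `^ be * h t y) = - c0 / kap y * Q x y.
Hypothesis green : forall x a b, 0 < x < 1 -> 0 < a -> a < xi -> xi < b -> b < 1 ->
  `|\int[mu]_(y in `]a, b[) (h x y * (kap y * kap xi * Gb y xi)) - kap xi * v x xi|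
  <= eta a + eta b.
Hypotheses (eta0 : eta y @[y --> 0^'+] --> 0) (eta1 : eta y @[y --> 1^'-] --> 0).

Let be1 : -1 < be. Proof. by move: albe; case/andP: al01 => ? ? ?; lra. Qed.
Let Nal1 : -1 < - al. Proof. by case/andP: al01 => ? ?; lra. Qed.
Let M0 : 0 <= M. Proof. exact: le_trans (vM X01 xi01). Qed.
Let N0 : 0 <= N. Proof. exact: le_trans (GN xi01). Qed.

Let QM x y : 0 < x < 1 -> 0 < y < 1 -> `|Q x y| <= M * (beta (- al) 0 * x `^ (1 - al)).
Proof.
move=> x01 y01; have /andP[x0 x1] := x01.
have N1 : -1 < 0 :> R by rewrite ltrN10.
have := conv_pow Nal1 N1 x0; rewrite (_ : - al + 0 + 1 = 1 - al); last by ring.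
move=> <-; rewrite /conv -Rint_scale//; last exact: convable_pow.
apply: Rint_dom => //.
- apply: measurable_funM; first exact: (measurable_sub x (measurable_pow _)).
  apply: (@measurable_funS _ _ _ _ (`]0, 1[ : set RT)) => //.
    by move=> t /=; rewrite !in_itv/= => /andP[-> tx]; exact: lt_trans x1.
  apply: open_continuous_measurable_fun; first exact: interval_open.
  move=> t; rewrite inE/= in_itv/= => t01; exact: (continuous_fst_slice (vcont t01 y01)).
- exact: integrable_mull _ (measurable_itv _) (convable_pow Nal1 N1 x0).
- move=> t /=; rewrite in_itv/= => /andP[t0 tx].
  rewrite /pow powRr0 mulr1 normrM ger0_norm ?powR_ge0// mulrC ler_wpM2r ?powR_ge0//.
  by apply: vM => //; rewrite t0 (lt_trans tx).
Qed.

Let weightE e : 0 < e -> \int[mu]_(t in `]0, e[) t `^ be = beta 0 be * e `^ (be + 1).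
Proof.
move=> e0; have N1 : -1 < 0 :> R by rewrite ltrN10.
by rewrite -(conv0E (pow be)) conv_pow// add0r.
Qed.

Let in01 e t : 0 <= e -> e < t < X -> 0 < t < 1.
Proof. by move=> e0 /andP[et tX]; rewrite (le_lt_trans e0 et) (lt_trans tX)//; case/andP: X01. Qed.

Let v_xi_measurable (D : set RT) : measurable D -> D `<=` `]0, X[ ->
  measurable_fun D (fun t => t `^ be * v t xi).
Proof.
move=> mD DX; apply: measurable_funM; first by apply: measurable_funTS; exact: (measurable_pow be).
apply: (@measurable_funS _ _ _ _ (`]0, 1[ : set RT)) => //.
  by move=> t /DX; rewrite /= !in_itv/=; exact: in01.
apply: open_continuous_measurable_fun; first exact: interval_open.
by move=> t; rewrite inE/= in_itv/= => t01; exact: (continuous_fst_slice (vcont t01 xi01)).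
Qed.

Let v_xi_le t : 0 < t < X -> `|t `^ be * v t xi| <= t `^ be * M.
Proof.
move=> t0X; rewrite normrM ger0_norm ?powR_ge0// ler_wpM2l ?powR_ge0//.
by apply: vM => //; exact: in01 t0X.
Qed.

Let int_weight e : 0 < e -> mu.-integrable `]0, e[ (fun t => (t `^ be)%:E).
Proof. by move=> e0; exact: (integrable_pow_weight al01 albe e0). Qed.

Let int_v : mu.-integrable `]0, X[ (fun t => (t `^ be * v t xi)%:E).
Proof.
have /andP[X0 _] := X01.
apply: (integrable_dom (measurable_itv _) _ (integrable_mulr M (measurable_itv _) (int_weight X0))).
  exact: v_xi_measurable.
by move=> t /=; rewrite in_itv/=; exact: v_xi_le.
Qed.

Let GQ_bcont x : 0 < x < 1 -> bcont (fun y => Gb y xi * Q x y).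
Proof.
move=> x01; apply: bcontM.
  by split; [move=> y; rewrite in_itv/=; exact: Gcont|exists N; exact: GN].
exact: (conv_pow_bcont al01 vcont vM x01).
Qed.

Let GQ_int x a b : 0 < x < 1 -> 0 <= a -> b <= 1 ->
  mu.-integrable `]a, b[ (fun y => (Gb y xi * Q x y)%:E).
Proof.
move=> x01 a0 b1.
apply: integrable_sub (bcont_integrable (GQ_bcont x01)) => // y /=.
by rewrite !in_itv/= => /andP[ay yb]; rewrite (le_lt_trans a0) ?(lt_le_trans yb).
Qed.

Let Qs x := M * (beta (- al) 0 * x `^ (1 - al)).

Let GQ_le x a b : 0 < x < 1 -> 0 <= a -> a <= b -> b <= 1 ->
  `|\int[mu]_(y in `]a, b[) (Gb y xi * Q x y)| <= N * Qs x * (b - a).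
Proof.
move=> x01 a0 ab b1.
have -> : N * Qs x * (b - a) = \int[mu]_(y in `]a, b[) (N * Qs x).
  rewrite Rintegral_cst//= lebesgue_measure_itv/= lte_fin; case: ltP => //= ba.
  by rewrite (@le_anti _ _ a b) ?ab// subrr !mulr0.
apply: Rint_dom => //.
- by apply/measurable_EFinP; exact: (measurable_int _ (GQ_int x01 a0 b1)).
- exact: integrable_cst_itv.
move=> y /=; rewrite in_itv/= => /andP[ay yb]; rewrite normrM.
have y01 : 0 < y < 1 by rewrite (le_lt_trans a0) ?(lt_le_trans yb).
by apply: ler_pM => //; [exact: GN|exact: QM].
Qed.

Let E := c0 * \int[mu]_(y in `]0, 1[) (Gb y xi * Q X y) + \int[mu]_(t in `]0, X[) (t `^ be * v t xi).

(** The Green estimate is multiplied by x `^ be and integrated over ]e, X[.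
    After exchanging the integrals, h_prim evaluates the integral in time. The
    four terms of the bound are the boundary terms in y, the contribution of
    time e, the missing strips ]0, a[ and ]b, 1[, and the missing time
    interval ]0, e[. *)
Let E_le a b e : 0 < a -> a < xi -> xi < b -> b < 1 -> 0 < e -> e < X ->
  `|kap xi * E| <= (eta a + eta b) * \int[mu]_(t in `]0, X[) t `^ be
    + `|c0| * kap xi * (N * Qs e) + `|c0| * kap xi * (N * Qs X) * (a + (1 - b))
    + kap xi * (beta 0 be * e `^ (be + 1) * M).
Proof.
move=> a0 axi xib b1 e0 eX.
have /andP[X0 X1] := X01; have /andP[xi0 xi1] := xi01.
have e01 : 0 < e < 1 by rewrite e0 (lt_trans eX).
have in_ab y : a <= y <= b -> 0 < y < 1 by move=> /andP[ay yb]; rewrite (lt_le_trans a0) ?(le_lt_trans yb).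
have in_eX t : e <= t <= X -> 0 < t < 1 by move=> /andP[et tX]; rewrite (lt_le_trans e0) ?(le_lt_trans tX).
have kxi := kap0 xi01.
pose W y := kap y * kap xi * Gb y xi.
have cW y : 0 < y < 1 -> {for y, continuous W}.
  move=> y01; apply: cvgM; last exact: Gcont.
  by apply: cvgM; [exact: kapcont|exact: cvg_cst].
pose H x y := x `^ be * (h x y * W y).
have cH x y : 0 < x < 1 -> 0 < y < 1 -> {for (x, y), continuous (fun q : R * R => H q.1 q.2)}.
  move=> x01 y01; apply: cvgM.
    apply: (@continuous_comp _ _ _ (@fst R R) (fun x => x `^ be)); first exact: cvg_fst.
    by apply: continuous_powR; case/andP: x01.
  apply: cvgM; first exact: hcont.
  by apply: (@continuous_comp _ _ _ (@snd R R) W); [exact: cvg_snd|exact: cW].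
have [B HB] := @continuous_rect_bounded R e X a b H (fun x y hx hy => cH x y (in_eX x hx) (in_ab y hy)).
have [||I1 I2 F] := @Rfubini_dom R `]e, X[ `]a, b[ H (fun=> B) (fun=> 1)
  (measurable_itv _) (measurable_itv _) _ (integrable_cst_itv _ _ _) (integrable_cst_itv _ _ _).
- apply: (@continuous_measurable_prod R e X a b H) => x y /andP[ex xX] /andP[ay yb].
  by apply: cH; [apply: in_eX; rewrite !ltW|apply: in_ab; rewrite !ltW].
- move=> x y /=; rewrite !in_itv/= => /andP[ex xX] /andP[ay yb]; rewrite mulr1.
  by apply: HB; rewrite !ltW.
pose J x := \int[mu]_(y in `]a, b[) (h x y * W y).
have JE x : e < x < X -> \int[mu]_(y in `]a, b[) H x y = x `^ be * J x.
  move=> /andP[ex xX]; rewrite /H Rint_scale//.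
  apply: (open_itv_continuous_integrable a0 b1) => y y01; apply: cvgM; last exact: cW.
  by apply: continuous_snd_slice; apply: hcont => //; apply: in_eX; rewrite !ltW.
have iJ : mu.-integrable `]e, X[ (fun x => (x `^ be * J x)%:E).
  by apply: eq_integrable I1 => // x; rewrite inE/= in_itv/= => /JE ->.
have sub_eX : `]e, X[ `<=` (`]0, X[ : set RT).
  by move=> t /=; rewrite !in_itv/= => /andP[et ->]; rewrite (lt_trans e0).
have ive : mu.-integrable `]e, X[ (fun t => (t `^ be * v t xi)%:E).
  exact: integrable_sub (measurable_itv _) (measurable_itv _) sub_eX int_v.
have iwe : mu.-integrable `]e, X[ (fun t => (t `^ be)%:E).
  exact: integrable_sub (measurable_itv _) (measurable_itv _) sub_eX (int_weight X0).
have ee0 : 0 <= eta a + eta b by apply: le_trans (green X01 a0 axi xib b1).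
have step1 : `|\int[mu]_(x in `]e, X[) (x `^ be * J x) - kap xi * \int[mu]_(t in `]e, X[) (t `^ be * v t xi)|
    <= (eta a + eta b) * \int[mu]_(t in `]0, X[) t `^ be.
  rewrite -(Rint_scale (kap xi) (measurable_itv _) ive).
  rewrite -(Rint_sub (measurable_itv _) iJ (integrable_mull _ (measurable_itv _) ive)).
  apply: (@le_trans _ _ (\int[mu]_(t in `]e, X[) ((eta a + eta b) * t `^ be))).
    apply: Rint_dom => //.
    - apply/measurable_EFinP; apply: (measurable_int mu).
      by apply: integrable_subr => //; exact: integrable_mull.
    - exact: integrable_mull.
    move=> x /=; rewrite in_itv/= => /andP[ex xX].
    have -> : x `^ be * J x - kap xi * (x `^ be * v x xi) = x `^ be * (J x - kap xi * v x xi) by ring.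
    rewrite normrM ger0_norm ?powR_ge0// mulrC ler_wpM2r ?powR_ge0//.
    by apply: green => //; apply: in_eX; rewrite !ltW.
  rewrite (Rint_scale _ (measurable_itv _) iwe).
  apply: ler_wpM2l => //.
  rewrite [leRHS](@Rint_split R _ 0 e X e0 eX (int_weight X0)) lerDr.
  by apply: Rintegral_ge0 => t _; exact: powR_ge0.
have step2 : \int[mu]_(x in `]e, X[) (x `^ be * J x) =
    - (c0 * kap xi) * (\int[mu]_(y in `]a, b[) (Gb y xi * Q X y) - \int[mu]_(y in `]a, b[) (Gb y xi * Q e y)).
  have -> : \int[mu]_(x in `]e, X[) (x `^ be * J x) = \int[mu]_(x in `]e, X[) \int[mu]_(y in `]a, b[) H x y.
    by apply: eq_Rintegral => x; rewrite inE/= in_itv/= => /JE.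
  have iX := GQ_int X01 (ltW a0) (ltW b1); have ie := GQ_int e01 (ltW a0) (ltW b1).
  rewrite F -(Rint_sub (measurable_itv _) iX ie).
  rewrite -(Rint_scale _ (measurable_itv _) (integrable_subr (measurable_itv _) iX ie)).
  apply: eq_Rintegral => y; rewrite inE/= in_itv/= => /andP[ay yb].
  have y01 : 0 < y < 1 by apply: in_ab; rewrite !ltW.
  have -> : \int[mu]_(x in `]e, X[) H x y = W y * \int[mu]_(x in `]e, X[) (x `^ be * h x y).
    rewrite -Rint_scale//; last first.
      exact: integrable_sub (measurable_itv _) (measurable_itv _) sub_eX (h_int X01 y01).
    by apply: eq_Rintegral => x _; rewrite /H; ring.
  have sp := @Rint_split R _ 0 e X e0 eX (h_int X01 y01).
  rewrite !h_prim// in sp.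
  have -> : \int[mu]_(x in `]e, X[) (x `^ be * h x y) = - c0 / kap y * (Q X y - Q e y).
    by rewrite mulrBr sp addrC addKr.
  rewrite /W; move: (kap y) (kap0 y01) (kap xi) (Gb y xi) (Q X y) (Q e y) => ky ky0 kx G1 q1 q2.
  by field; rewrite gt_eqF.
have sp1 : \int[mu]_(y in `]0, 1[) (Gb y xi * Q X y) = \int[mu]_(y in `]0, a[) (Gb y xi * Q X y)
    + (\int[mu]_(y in `]a, b[) (Gb y xi * Q X y) + \int[mu]_(y in `]b, 1[) (Gb y xi * Q X y)).
  rewrite (@Rint_split R _ 0 a 1 a0)//; [|by rewrite (lt_trans axi)|exact: GQ_int].
  by rewrite (@Rint_split R _ a b 1 _ b1)//; [rewrite (lt_trans axi)|apply: GQ_int => //; exact: ltW].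
have sp2 := @Rint_split R _ 0 e X e0 eX int_v.
have b_1 := GQ_le X01 (lexx 0) (ltW a0) (ltW (lt_trans axi xi1)).
have b_2 := GQ_le X01 (ltW (lt_trans xi0 xib)) (ltW b1) (lexx 1).
have b_3 : `|\int[mu]_(y in `]a, b[) (Gb y xi * Q e y)| <= N * Qs e.
  apply: le_trans (GQ_le e01 (ltW a0) (ltW (lt_trans axi xib)) (ltW b1)) _.
  apply: ler_piMr; last by rewrite lerBlDl (le_trans (ltW b1))// lerDr ltW.
  by rewrite mulr_ge0// (le_trans _ (QM e01 xi01)).
have b_4 : `|\int[mu]_(t in `]0, e[) (t `^ be * v t xi)| <= beta 0 be * e `^ (be + 1) * M.
  rewrite -weightE// -RintegralZr//; last exact: int_weight.
  apply: Rint_dom => //.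
  - apply: v_xi_measurable => // t /=; rewrite !in_itv/= => /andP[-> te]; exact: lt_trans eX.
  - by apply: integrable_mulr => //; exact: int_weight.
  - by move=> t /=; rewrite in_itv/= => /andP[t0 te]; apply: v_xi_le; rewrite t0 (lt_trans te).
rewrite step2 in step1; rewrite /E sp1 sp2.
have key (k I0 I1' Iab Ie V0 V1 S r1 r2 r3 r4 : R) : 0 <= k ->
    `|- (c0 * k) * (Iab - Ie) - k * V1| <= S -> `|I0| <= r1 -> `|I1'| <= r2 -> `|Ie| <= r3 ->
    `|V0| <= r4 ->
    `|k * (c0 * (I0 + (Iab + I1')) + (V0 + V1))| <= S + `|c0| * k * r3 + `|c0| * k * (r1 + r2) + k * r4.
  move=> k0 hS h1 h2 h3 h4.
  rewrite (_ : k * _ = - (- (c0 * k) * (Iab - Ie) - k * V1) + c0 * k * Ie + c0 * k * (I0 + I1') + k * V0); last by ring.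
  apply: le_trans (ler_normD _ _) _; apply: lerD; last by rewrite normrM ger0_norm// ler_wpM2l.
  apply: le_trans (ler_normD _ _) _; apply: lerD.
    apply: le_trans (ler_normD _ _) _; rewrite normrN; apply: lerD => //.
    by rewrite !normrM (ger0_norm k0) ler_wpM2l// mulr_ge0.
  rewrite !normrM (ger0_norm k0) ler_wpM2l ?mulr_ge0//.
  by apply: le_trans (ler_normD _ _) _; exact: lerD.
apply: le_trans (key _ _ _ _ _ _ _ _ _ _ _ _ (ltW kxi) step1 b_1 b_2 b_3 b_4) _.
rewrite le_eqVlt; apply/orP; left; apply/eqP.
move: (\int[mu]_(t in `]0, X[) t `^ be) (Qs e) (Qs X) => W0 q1 q2; ring.
Qed.

Let powR_cvg0 c : 0 < c -> e `^ c @[e --> 0^'+] --> (0 : R).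
Proof.
move=> cp; apply/cvgrPdist_lt => r r0; near=> e.
have e0 : 0 < e by near: e; exact: nbhs_right_gt.
rewrite sub0r normrN ger0_norm ?powR_ge0//.
have c0' : c != 0 by rewrite gt_eqF.
rewrite -[ltRHS](powRr1 (ltW r0)) -(mulVf c0') powRrM.
apply: gt0_ltr_powR; rewrite ?nnegrE ?powR_ge0 ?ltW//.
by near: e; apply: nbhs_right_lt; exact: powR_gt0.
Unshelve. all: by end_near. Qed.

Lemma evolution_identity :
  c0 * \int[mu]_(y in `]0, 1[) (Gb y xi * conv (pow (- al)) (v ^~ y) X) =
  - \int[mu]_(t in `]0, X[) (t `^ be * v t xi).
Proof.
have /andP[X0 X1] := X01; have /andP[xi0 xi1] := xi01.
suff : `|kap xi * E| <= 0.
  rewrite normr_le0 mulf_eq0 gt_eqF ?kap0//= /E addr_eq0 => /eqP; exact.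
pose W0 := \int[mu]_(t in `]0, X[) t `^ be.
pose C2 := `|c0| * kap xi * (N * Qs X).
have lim_e a b : 0 < a -> a < xi -> xi < b -> b < 1 ->
    `|kap xi * E| <= (eta a + eta b) * W0 + C2 * (a + (1 - b)).
  move=> a0 axi xib b1.
  have Qs0 : Qs e @[e --> 0^'+] --> M * (beta (- al) 0 * 0).
    apply: cvgM; first exact: cvg_cst.
    by apply: cvgM; [exact: cvg_cst|apply: powR_cvg0; case/andP: al01 => ? ?; lra].
  have : (eta a + eta b) * W0 + `|c0| * kap xi * (N * Qs e) + C2 * (a + (1 - b))
      + kap xi * (beta 0 be * e `^ (be + 1) * M) @[e --> 0^'+] -->
      (eta a + eta b) * W0 + `|c0| * kap xi * (N * (M * (beta (- al) 0 * 0))) + C2 * (a + (1 - b))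
      + kap xi * (beta 0 be * 0 * M).
    apply: cvgD; first apply: cvgD; first apply: cvgD; try exact: cvg_cst.
      by apply: cvgM; [exact: cvg_cst|apply: cvgM; [exact: cvg_cst|exact: Qs0]].
    apply: cvgM; first exact: cvg_cst.
    apply: cvgM; last exact: cvg_cst.
    by apply: cvgM; [exact: cvg_cst|apply: powR_cvg0; move: be1; lra].
  rewrite !(mulr0, mul0r) !addr0.
  apply: (closed_cvg _ (@closed_ge _ _)); near=> e; apply: E_le => //.
have lim_a b : xi < b -> b < 1 -> `|kap xi * E| <= (0 + eta b) * W0 + C2 * (0 + (1 - b)).
  move=> xib b1.
  have : (eta a + eta b) * W0 + C2 * (a + (1 - b)) @[a --> 0^'+] -->
      (0 + eta b) * W0 + C2 * (0 + (1 - b)).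
    apply: cvgD; apply: cvgM; try exact: cvg_cst.
      by apply: cvgD; [exact: eta0|exact: cvg_cst].
    by apply: cvgD; [apply: cvg_at_right_filter; exact: cvg_id|exact: cvg_cst].
  apply: (closed_cvg _ (@closed_ge _ _)); near=> a; apply: lim_e => //.
have : (0 + eta b) * W0 + C2 * (0 + (1 - b)) @[b --> 1^'-] --> (0 + 0) * W0 + C2 * (0 + (1 - 1)).
  apply: cvgD; apply: cvgM; try exact: cvg_cst.
    by apply: cvgD; [exact: cvg_cst|exact: eta1].
  apply: cvgD; first exact: cvg_cst.
  by apply: cvgB; [exact: cvg_cst|apply: cvg_at_left_filter; exact: cvg_id].
rewrite subrr !addr0 mul0r mulr0 addr0.
apply: (closed_cvg _ (@closed_ge _ _)); near=> b; apply: lim_a => //.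
Unshelve. all: by end_near. Qed.

End evolution_identity.

(** * Estimates for the Green function *)

Section estimates.
Context {R : realType}.
Notation mu := (@lebesgue_measure R).
Implicit Types (f g w : R -> R) (x y a b M C : R) (n k j : nat).

Lemma uniform_bound n (F : nat -> R -> Prop) :
  (forall j M M', M <= M' -> F j M -> F j M') ->
  (forall j, (j < n)%N -> exists M, F j M) -> exists M, forall j, (j < n)%N -> F j M.
Proof.
move=> mono; elim: n => [_|n IH H]; first by exists 0.
have [|M hM] := IH; first by move=> j jn; apply: H; exact: ltnW.
have [M' hM'] := H n (ltnSn n).
exists (Num.max M M') => j; rewrite ltnS leq_eqVlt => /predU1P[->|jn].
  by apply: mono hM'; rewrite le_max lexx orbT.
by apply: mono (hM _ jn); rewrite le_max lexx.
Qed.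

(** Taylor's formula at 0, through repeated use of the mean value theorem. *)
Lemma vanish_order n f M : smooth `]0, 1[ n f ->
  (forall y, 0 < y < 1 -> `|derive1n n f y| <= M) ->
  (forall k, (k < n)%N -> derive1n k f y @[y --> 0^'+] --> 0) ->
  forall y, 0 < y < 1 -> `|f y| <= M * y ^+ n.
Proof.
elim: n f => [|n IH] f sf fM f0 y y01; first by rewrite expr0 mulr1; exact: fM.
have [df sf'] := (smoothS `]0, 1[ n f).1 sf.
have f'M : forall z, 0 < z < 1 -> `|derive1 f z| <= M * z ^+ n.
  apply: IH => // [z|k kn]; first by rewrite -derive1nSr; exact: fM.
  by under eq_fun do rewrite -derive1nSr; exact: f0.
have /andP[y0 y1] := y01; have M0 : 0 <= M by exact: le_trans (fM _ y01).
have lim : `|f y - f z| @[z --> 0^'+] --> `|f y - 0|.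
  by apply: cvg_norm; apply: cvgB; [exact: cvg_cst|exact: (f0 0%N)].
rewrite -[f y]subr0; apply: (closed_cvg _ (@closed_le _ _)) lim; near=> z.
have z0 : 0 < z by near: z; exact: nbhs_right_gt.
have zy : z < y by near: z; exact: nbhs_right_lt.
have [|c /andP[zc cy] ->] := @mvt_eq _ f z y zy.
  by move=> t /andP[zt ty]; apply: df; rewrite /= in_itv/= (lt_le_trans z0)// (le_lt_trans ty).
have c0 : 0 < c := lt_trans z0 zc.
rewrite normrM [`|y - z|]gtr0_norm ?subr_gt0//.
have c01 : 0 < c < 1 by rewrite c0 (lt_trans cy).
apply: le_trans (ler_wpM2r _ (f'M _ c01)) _; first by rewrite subr_ge0 ltW.
rewrite exprSr mulrA; apply: ler_pM.
- by rewrite mulr_ge0// exprn_ge0// ltW.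
- by rewrite subr_ge0 ltW.
- by rewrite ler_wpM2l// lerXn2r ?nnegrE ?ltW.
- by rewrite gerBl ltW.
Unshelve. all: by end_near. Qed.

Lemma vanish_right f M : (forall y, 0 < y < 1 -> derivable f y 1) ->
  (forall y, 0 < y < 1 -> `|derive1 f y| <= M) -> f y @[y --> 1^'-] --> 0 ->
  forall y, 0 < y < 1 -> `|f y| <= M * (1 - y).
Proof.
move=> df fM f1 y y01; have /andP[y0 y1] := y01; have M0 : 0 <= M by exact: le_trans (fM _ y01).
have lim : `|f y - f z| @[z --> 1^'-] --> `|f y - 0|.
  by apply: cvg_norm; apply: cvgB; [exact: cvg_cst|exact: f1].
rewrite -[f y]subr0; apply: (closed_cvg _ (@closed_le _ _)) lim; near=> z.
have yz : y < z by near: z; exact: nbhs_left_gt.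
have z1 : z < 1 by near: z; exact: nbhs_left_lt.
apply: le_trans (mvt_bound df fM y01 _) _; first by rewrite (lt_trans y0).
by rewrite distrC ler_wpM2l// gtr0_norm ?subr_gt0// lerD2r ltW.
Unshelve. all: by end_near. Qed.

Section operator.
Variables (s : nat) (p : nat -> R -> R).
Hypothesis s1 : (1 <= s)%N.

Lemma admissible_intro M w : smooth `]0, 1[ s.*2 w ->
  (forall k y, (k < s.*2)%N -> 0 < y < 1 -> `|derive1n k w y| <= M) ->
  (forall k, (k < s)%N -> derive1n k w y @[y --> 0^'+] --> 0) ->
  (forall k, (k < s)%N -> derive1n k w y @[y --> 1^'-] --> 0) ->
  admissible s M w.
Proof.
move=> sw wM w0 w1; split => // k y ks y01.
have M0 : 0 <= M by apply: le_trans (wM 0%N _ _ y01) => //; rewrite double_gt0.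
have sk : smooth `]0, 1[ 1 (derive1n k w).
  by apply: smooth_derive1n; apply: smooth_le sw; lia.
have wkM z : 0 < z < 1 -> `|derive1n 1 (derive1n k w) z| <= M.
  by move=> z01; rewrite -[derive1n 1 _]/(derive1n k.+1 w); apply: wM => //; lia.
have hl : `|derive1n k w y| <= M * y.
  rewrite -[X in M * X]expr1; apply: (vanish_order sk wkM _ y01).
  by move=> i; rewrite ltnS leqn0 => /eqP ->; exact: w0.
have hr : `|derive1n k w y| <= M * (1 - y).
  apply: vanish_right (w1 _ ks) _ y01 => z z01.
    by apply: (smooth_derivable sk (ltn0Sn 0)); rewrite /= in_itv.
  exact: wkM.
by case: (leP y (1 - y)) => _.
Qed.

(** The bound on the derivative of order s is propagated down by the boundary
    conditions at 0. *)
Lemma admissible_vanish_order M w : admissible s M w ->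
  forall y, 0 < y < 1 -> `|w y| <= M * y ^+ s.
Proof.
move=> [sw wM w0]; apply: vanish_order.
- by apply: smooth_le sw; lia.
- by move=> y y01; apply: wM => //; lia.
move=> k ks; apply/cvgrPdist_le => e e0.
have M0 : 0 <= M.
  have h01 : 0 < (2^-1 : R) < 1 by apply/andP; split; lra.
  by apply: le_trans (wM 0%N _ _ h01) => //; lia.
near=> y; rewrite sub0r normrN.
have y0 : 0 < y by near: y; exact: nbhs_right_gt.
have y1 : y < 1 by near: y; exact: nbhs_right_lt.
apply: le_trans (w0 _ _ ks _) _; first by rewrite y0.
apply: (@le_trans _ _ ((M + 1) * y)).
  by apply: ler_pM => //; rewrite ?lerDl// ?ge_min ?lexx// le_min ltW// subr_ge0 ltW.
rewrite mulrC -ler_pdivlMr ?ltr_wpDl//; apply: ltW.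
by near: y; apply: nbhs_right_lt; rewrite divr_gt0// ltr_wpDl.
Unshelve. all: by end_near. Qed.

Hypothesis hp : forall j, (j < s)%N -> contdiff_in I01 j (p j).

Lemma smooth_coefficients j : (j < s)%N -> smooth `]0, 1[ j (p j).
Proof.
move=> js; apply: contdiff_in_smooth (hp js); first exact: interval_open.
exact: subset_itv_oo_cc.
Qed.

Lemma coefficients_bound : exists2 A, 1 <= A &
  forall j k y, (j < s)%N -> (k <= j)%N -> 0 < y < 1 -> `|derive1n k (p j) y| <= A.
Proof.
have [|j js|A hA] := @uniform_bound s (fun j A => forall k y, (k <= j)%N -> 0 < y < 1 -> `|derive1n k (p j) y| <= A).
- by move=> j M M' MM' h k y kj y01; exact: le_trans (h _ _ kj y01) MM'.
- have [|k kj|A hA] := @uniform_bound j.+1 (fun k A => forall y, 0 < y < 1 -> `|derive1n k (p j) y| <= A).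
  + by move=> k M M' MM' h y y01; exact: le_trans (h _ y01) MM'.
  + apply: derive1n_itv_bounded => //; exact: contdiff_in_continuous (hp js) kj.
  + by exists A => k y kj; exact: hA.
exists (Num.max 1 A); first by rewrite le_max lexx.
by move=> j k y js kj y01; rewrite le_max hA ?orbT.
Qed.

Variable G : R -> R -> R.
Hypothesis hG : green_function s p G.

(** The error terms depend on xi and M only, so that the estimate can be
    integrated over the slices of a solution. *)
Lemma green_estimate M xi : 0 <= M -> 0 < xi < 1 -> exists eta : R -> R,
  [/\ eta y @[y --> 0^'+] --> 0, eta y @[y --> 1^'-] --> 0 &
  forall w a b, admissible s M w -> 0 < a -> a < xi -> xi < b -> b < 1 ->
    `|\int[mu]_(y in `]a, b[) (Lop s p w y * G y xi) - w xi| <= eta a + eta b].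
Proof.
move=> M0 xi01; have /andP[xi0 xi1] := xi01.
have [_ /(_ xi)] := hG; rewrite /O01/= in_itv/= => /(_ xi01) /=.
set g := fun y => G y xi; move=> [cg [cgl cgr] [Lgl Lgr] jump bc].
have [A A1 pA] := coefficients_bound.
have openL : open (`]0, xi[%classic : set R) by exact: interval_open.
have openR : open (`]xi, 1[%classic : set R) by exact: interval_open.
have sl : smooth `]0, xi[ s.*2 g.
  by apply: contdiff_in_smooth cgl => //; exact: subset_itv_oo_cc.
have sr : smooth `]xi, 1[ s.*2 g.
  by apply: contdiff_in_smooth cgr => //; exact: subset_itv_oo_cc.
have sg : smooth `]0, 1[ s.*2.-2 g.
  by apply: contdiff_in_smooth cg; [exact: interval_open|exact: subset_itv_oo_cc].
have [|k ks|B hB] := @uniform_bound s.*2 (fun k B => forall y, 0 < y < 1 -> y != xi -> `|derive1n k g y| <= B).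
- by move=> k B B' BB' h y y01 yxi; exact: le_trans (h _ y01 yxi) BB'.
- have [B1 h1] := derive1n_itv_bounded xi0 (contdiff_in_continuous cgl (ltnW ks)).
  have [B2 h2] := derive1n_itv_bounded xi1 (contdiff_in_continuous cgr (ltnW ks)).
  exists (Num.max B1 B2) => y /andP[y0 y1] yxi; rewrite le_max.
  have [yl|yr|E] := ltgtP y xi; last by rewrite E eqxx in yxi.
    by rewrite h1 ?y0.
  by rewrite h2 ?orbT// yr.
have B0 : 0 <= B.
  apply: le_trans (hB 0%N _ (xi / 2) _ _) => //; first by rewrite double_gt0.
    by apply/andP; split; lra.
  by rewrite lt_eqF//; lra.
have Lg y : 0 < y < 1 -> y != xi -> Lop s p g y = 0.
  move=> /andP[y0 y1] yxi; have [yl|yr|E] := ltgtP y xi; last by rewrite E eqxx in yxi.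
    rewrite -(lexpr_Lop p s1 g openL (@subset_itv_oo_cc _ _ _ _)) ?Lgl//= ?in_itv/= ?y0//.
    by rewrite ltW// ltW.
  rewrite -(lexpr_Lop p s1 g openR (@subset_itv_oo_cc _ _ _ _)) ?Lgr//= ?in_itv/= ?yr//.
  by rewrite ltW// ltW.
have ls : (s.*2.-1 <= s.*2)%N by exact: leq_pred.
have [_ gl] := derive1n_itv_lim xi0 (contdiff_in_continuous cgl ls).
have [gr _] := derive1n_itv_lim xi1 (contdiff_in_continuous cgr ls).
have lim01 k : (k < s)%N -> derive1n k g y @[y --> 0^'+] --> 0 /\ derive1n k g y @[y --> 1^'-] --> 0.
  move=> ks; have [b0 b1] := bc k ks.
  have ks2 : (k <= s.*2.-2)%N by lia.
  have := derive1n_itv_lim ltr01 (contdiff_in_continuous cg ks2).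
  by rewrite -/I01 b0 b1.
exists (bracket_bound s A B M g); split.
- by apply: bracket_bound_right => k /lim01[].
- by apply: bracket_bound_left => k /lim01[].
move=> w a b aw a0 axi xib b1.
apply: (green_identity_le s1 smooth_coefficients A1 B0 M0 xi01 pA sg sl sr (fun k y ks => hB k ks y) Lg gl gr jump) => //.
Qed.

(** * Comparison with sqrt K *)

Lemma derive1n_horner n (q : {poly R}) : derive1n n (horner q) = horner q^`(n).
Proof.
elim: n => [|n IH]; first by rewrite derivn0.
by rewrite derive1nS IH -derivE derivnS.
Qed.

Lemma smooth_horner O n (q : {poly R}) : smooth O n (horner q).
Proof.
split=> k y _ _; rewrite derive1n_horner; first exact: continuous_horner.
exact: derivable_horner.
Qed.

Lemma horner_bounded (q : {poly R}) : exists M, forall y, 0 < y < 1 -> `|q.[y]| <= M.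
Proof.
have cq : {within `[0, 1], continuous (horner q)}.
  by apply: continuous_subspaceT => y; exact: continuous_horner.
have [M [_ hM]] := compact_bounded (continuous_compact cq (@segment_compact _ 0 1)).
exists (M + 1) => y /andP[y0 y1]; apply: (hM (M + 1)); first by rewrite ltrDl.
by exists y => //=; rewrite in_itv/= !ltW.
Qed.

(** Each differentiation removes at most one factor r. *)
Lemma derivn_exp_factor (r q : {poly R}) n k : (k <= n)%N ->
  exists q', (r ^+ n * q)^`(k) = r ^+ (n - k) * q'.
Proof.
elim: k n q => [|k IH] n q kn; first by exists q; rewrite derivn0 subn0.
case: n kn => // n kn.
have E : (r ^+ n.+1 * q)^`() = r ^+ n * (r^`() * q *+ n.+1 + r * q^`()).
  rewrite derivM deriv_exp /= -mulrnAl mulrDr mulrA -exprSr; congr (_ + _).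
  by rewrite !mulrnAl mulrnAr [in RHS]mulrCA mulrA.
have [q' hq'] := IH n (r^`() * q *+ n.+1 + r * q^`()) kn.
by exists q'; rewrite derivSn E hq' subSS.
Qed.

(** A function that vanishes at both ends exactly to the order of the boundary
    conditions. *)
Definition bump : {poly R} := 'X ^+ s * (1 - 'X) ^+ s.

Lemma admissible_bump : exists M, 0 <= M /\ admissible s M (horner bump).
Proof.
have [|k _|M hM] := @uniform_bound s.*2 (fun k M => forall y, 0 < y < 1 -> `|derive1n k (horner bump) y| <= M).
- by move=> k M M' MM' h y y01; exact: le_trans (h _ y01) MM'.
- by have [M hM] := horner_bounded bump^`(k); exists M => y; rewrite derive1n_horner; exact: hM.
exists M; split.
  have h01 : 0 < (2^-1 : R) < 1 by apply/andP; split; lra.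
  by apply: le_trans (hM 0%N _ _ h01) => //; rewrite double_gt0.
(* both ends are zeros of order s of the polynomial *)
have root k (t : R) : (k < s)%N -> t = 0 \/ t = 1 -> bump^`(k).[t] = 0.
  move=> ks tE; have sk : (s - k)%N = (s - k).-1.+1 by lia.
  case: tE => ->.
    have [q ->] := derivn_exp_factor 'X ((1 - 'X) ^+ s) (ltnW ks).
    by rewrite hornerM sk exprS hornerM hornerX !mul0r.
  have [q] := derivn_exp_factor (1 - 'X) ('X ^+ s) (ltnW ks); rewrite mulrC -/bump => ->.
  by rewrite hornerM sk exprS hornerM !hornerE subrr !mul0r.
apply: admissible_intro; first exact: smooth_horner.
- by move=> k y ks; exact: hM.
- move=> k ks; rewrite derive1n_horner -[X in _ --> X](root k 0 ks (or_introl erefl)).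
  by apply: cvg_at_right_filter; exact: continuous_horner.
- move=> k ks; rewrite derive1n_horner -[X in _ --> X](root k 1 ks (or_intror erefl)).
  by apply: cvg_at_left_filter; exact: continuous_horner.
Qed.

Lemma Lop_bounded C w : smooth `]0, 1[ s.*2 w ->
  (forall k y, (k <= s.*2)%N -> 0 < y < 1 -> `|derive1n k w y| <= C) ->
  exists L, forall y, 0 < y < 1 -> `|Lop s p w y| <= L.
Proof.
move=> sw wC; have [A A1 pA] := coefficients_bound.
have A0 : 0 <= A by exact: le_trans A1.
exists (\sum_(j < s) 2 ^+ j.+1 * A * C + A * C) => y y01.
apply: le_trans (ler_normD _ _) _; apply: lerD; last first.
  by rewrite normrM ler_pM//; [exact: (pA 0%N 0%N)|exact: (wC 0%N)].
apply: le_trans (ler_norm_sum _ _ _) _; apply: ler_sum => j _; have js := ltn_ord j.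
rewrite normrM normrX normrN1 expr1n mul1r.
apply: (@derive1nM_bound R `]0, 1[ j.+1 (coef s p j.+1) (derive1n j.+1 w) A C).
- exact: interval_open.
- exact: (smooth_coef smooth_coefficients).
- by apply: smooth_derive1n; apply: smooth_le sw; lia.
- move=> k z kj; rewrite /= in_itv/= => z01; rewrite /coef; case: ifP => js'; first exact: pA.
  by rewrite derive1n_cst; case: k {kj} => [|k]; rewrite ?normr1 ?normr0.
- move=> k z kj; rewrite /= in_itv/= => z01; rewrite /derive1n -(iterD k j.+1); apply: wC => //; lia.
- by rewrite /= in_itv.
Qed.

Variables (K : R -> R) (N : R) (Gb : R -> R -> R).
Hypothesis Kcont : {within `[0, 1], continuous K}.
Hypothesis Kpos : forall y, 0 < y <= 1 -> 0 < K y.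
Hypothesis GbE : forall y xi, 0 < y <= 1 -> 0 < xi <= 1 -> Gb y xi = G y xi / Num.sqrt (K y * K xi).
Hypothesis GbN : forall y xi, 0 <= y <= 1 -> 0 <= xi <= 1 -> `|Gb y xi| <= N.

Let kap y := Num.sqrt (K y).

Lemma kap_gt0 y : 0 < y <= 1 -> 0 < kap y.
Proof. by move=> y01; rewrite sqrtr_gt0 Kpos. Qed.

Lemma weighted_kernelE y xi : 0 < y <= 1 -> 0 < xi <= 1 -> G y xi = kap y * kap xi * Gb y xi.
Proof.
move=> y01 xi01; rewrite GbE// sqrtrM ?ltW ?Kpos// /kap.
by rewrite mulrC mulfVK// mulf_neq0// gt_eqF// kap_gt0.
Qed.

(** In the Green representation of the bump, the bound N * sqrt (K y) * sqrt
    (K xi) on the Green function provides the factor sqrt (K xi). This is how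
    the boundedness of the weighted kernel limits the decay of K at 0. *)
Lemma bump_le_kap : exists C, forall y, 0 < y < 1 -> `|bump.[y]| <= C * kap y.
Proof.
have [M [M0 aw]] := admissible_bump; have [sw _ _] := aw.
have [|k _|C hC] := @uniform_bound s.*2.+1 (fun k M => forall y, 0 < y < 1 -> `|derive1n k (horner bump) y| <= M).
- by move=> k M1 M2 MM' h y y01; exact: le_trans (h _ y01) MM'.
- by have [M1 hM] := horner_bounded bump^`(k); exists M1 => y; rewrite derive1n_horner; exact: hM.
have [L hL] := Lop_bounded sw (fun k y (ks : (k <= s.*2)%N) => hC k ks y).
have [k1 [_ hk1]] := compact_bounded (continuous_compact Kcont (@segment_compact _ 0 1)).
have KM y : 0 <= y <= 1 -> kap y <= Num.sqrt (k1 + 1).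
  move=> y01; apply: ler_wsqrtr; apply: le_trans (ler_norm _) _.
  by apply: (hk1 (k1 + 1)); [rewrite ltrDl|exists y => //=; rewrite in_itv].
exists (L * (Num.sqrt (k1 + 1) * N)) => xi xi01; have /andP[xi0 xi1] := xi01.
have [eta [eta0 eta1 est]] := green_estimate M0 xi01.
have L0 : 0 <= L by exact: le_trans (hL _ xi01).
have xi01' : 0 < xi <= 1 by rewrite xi0 ltW.
set B := L * _ * kap xi.
have B0 : 0 <= B.
  have xic : 0 <= xi <= 1 by rewrite !ltW.
  have N0 : 0 <= N by exact: le_trans (normr_ge0 _) (GbN xic xic).
  by rewrite /B !mulr_ge0// ?sqrtr_ge0.
have bnd a b : 0 < a -> a < xi -> xi < b -> b < 1 -> `|bump.[xi]| <= B + (eta a + eta b).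
  move=> a0 axi xib b1; rewrite -[X in `|X|](subrK (\int[mu]_(y in `]a, b[) (Lop s p (horner bump) y * G y xi))).
  apply: le_trans (ler_normD _ _) _; rewrite addrC; apply: lerD; last by rewrite distrC; exact: est.
  apply: (@le_trans _ _ (\int[mu]_(y in `]a, b[) B)); last first.
    rewrite Rintegral_cst//= lebesgue_measure_itv/= lte_fin (lt_trans axi xib)/=.
    by apply: ler_piMr => //; rewrite lerBlDl (le_trans (ltW b1))// lerDr ltW.
  apply: Rint_dom => //; last 2 first.
  - exact: integrable_cst_itv.
  - move=> y /=; rewrite in_itv/= => /andP[ay yb].
    have y0 := lt_trans a0 ay; have y1 := lt_trans yb b1.
    rewrite normrM /B -mulrA; apply: ler_pM => //; first by apply: hL; rewrite y0.
    have y01 : 0 < y <= 1 by rewrite y0 ltW.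
    rewrite (weighted_kernelE y01 xi01') !normrM !(ger0_norm (sqrtr_ge0 _)) mulrAC.
    rewrite ler_wpM2r ?sqrtr_ge0//; apply: ler_pM => //; rewrite ?sqrtr_ge0//.
      by apply: KM; rewrite !ltW.
    by apply: GbN; rewrite !ltW.
  apply/measurable_EFinP; apply: (measurable_int mu).
  apply: (@open_itv_continuous_integrable R _ a b 0 1) => // y y01; apply: cvgM.
    exact: (Lop_continuous s1 smooth_coefficients sw y01).
  have [_ /(_ xi)] := hG; rewrite /O01/= in_itv/= => /(_ xi01)[/= cg _ _ _ _].
  have sg : smooth `]0, 1[ s.*2.-2 (G^~ xi).
    by apply: contdiff_in_smooth cg; [exact: interval_open|exact: subset_itv_oo_cc].
  by apply: (smooth_continuous sg (leq0n _)); rewrite /= in_itv.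
have lim_a b : xi < b -> b < 1 -> `|bump.[xi]| <= B + (0 + eta b).
  move=> xib b1.
  have : B + (eta a + eta b) @[a --> 0^'+] --> B + (0 + eta b).
    by apply: cvgD; [exact: cvg_cst|apply: cvgD; [exact: eta0|exact: cvg_cst]].
  by apply: (closed_cvg _ (@closed_ge _ _)); near=> a; apply: bnd.
have : B + (0 + eta b) @[b --> 1^'-] --> B + (0 + 0).
  by apply: cvgD; [exact: cvg_cst|apply: cvgD; [exact: cvg_cst|exact: eta1]].
rewrite !addr0; apply: (closed_cvg _ (@closed_ge _ _)); near=> b; exact: lim_a.
Unshelve. all: by end_near. Qed.

(** On the left half of the interval the functions vanish to the same order as
    the bump; on the right half K is bounded away from 0. *)
Lemma admissible_le_kap M : 0 <= M -> exists C, forall w y, admissible s M w -> 0 < y < 1 ->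
  `|w y| <= C * kap y.
Proof.
move=> M0; have [C hC] := bump_le_kap.
have Kc : {within `[2^-1, 1], continuous K}.
  by apply: continuous_subspaceW Kcont => y /=; rewrite !in_itv/= => /andP[y2 ->]; rewrite (le_trans _ y2).
have [c /= c01 hc] := @EVT_min _ K 2^-1 1 ltac:(lra) Kc.
rewrite in_itv/= in c01; case/andP: c01 => c2 c1.
have c0 : 0 < c by apply: lt_le_trans c2; lra.
have kc : 0 < kap c by apply: kap_gt0; rewrite c0.
exists (Num.max (M * 2 ^+ s * C) (M / kap c)) => w y aw y01; have /andP[y0 y1] := y01.
have ky : 0 <= kap y by exact: sqrtr_ge0.
have [y2|y2] := leP y 2^-1.
  apply: (@le_trans _ _ (M * 2 ^+ s * C * kap y)); last by rewrite ler_wpM2r// le_max lexx.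
  apply: le_trans (admissible_vanish_order aw y01) _; rewrite -!mulrA ler_wpM2l//.
  apply: le_trans (_ : _ <= 2 ^+ s * `|bump.[y]|) _; last first.
    by rewrite ler_wpM2l ?exprn_ge0//; exact: hC.
  rewrite /bump hornerM !horner_exp !hornerE normrM !normrX (gtr0_norm y0) gtr0_norm ?subr_gt0//.
  rewrite mulrCA -exprMn ler_peMr ?exprn_ge0 ?(ltW y0)//.
  by apply: exprn_ege1; lra.
apply: (@le_trans _ _ (M / kap c * kap y)); last by rewrite ler_wpM2r// le_max lexx orbT.
apply: (@le_trans _ _ M).
  have [_ /(_ 0%N) wM _] := aw; apply: wM => //; by rewrite double_gt0.
rewrite mulrAC ler_pdivlMr// ler_wpM2l// ler_wsqrtr//.
by apply: hc; rewrite in_itv/= !ltW.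
Qed.

End operator.
End estimates.

(** * Solutions of the boundary value problem *)

Section solutions.
Context {R : realType}.
Notation mu := (@lebesgue_measure R).
Notation RT := (measurableTypeR R).
Variables (alpha beta : R) (s : nat) (p : nat -> R -> R) (K : R -> R) (phi : R -> R).
Hypothesis s1 : (1 <= s)%N.
Implicit Types (u : R -> R -> R) (x y t r : R).

Let openO : open (`]0, 1[%classic : set R). Proof. exact: interval_open. Qed.
Let subO : `]0, 1[%classic `<=` (I01 : set R). Proof. exact: subset_itv_oo_cc. Qed.

Lemma open_rect (A B : set R) : open A -> open B -> open (A `*` B).
Proof.
move=> oA oB; rewrite openE => -[a b] [/= Aa Bb].
by exists (A, B) => //=; split; exact: open_nbhs_nbhs.
Qed.

Lemma square_interior_continuous (f : R * R -> R) (D : set (R * R)) x y :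
  `]0, 1[ `*` `]0, 1[ `<=` D -> {within D, continuous f} ->
  0 < x < 1 -> 0 < y < 1 -> {for (x, y), continuous f}.
Proof.
move=> OD cf x01 y01.
have oO2 : open (`]0, 1[ `*` `]0, 1[ : set (R * R)) by exact: open_rect.
have xyO : (`]0, 1[ `*` `]0, 1[ : set (R * R)) (x, y) by split; rewrite /= in_itv.
exact: (within_continuous_interior oO2 OD xyO cf).
Qed.

Lemma within_fst_slice (f : R -> R -> R) (A B : set R) y : B y ->
  {within A `*` B, continuous (fun q : R * R => f q.1 q.2)} -> {within A, continuous (f ^~ y)}.
Proof.
move=> By /subspace_continuousP cf; apply/subspace_continuousP => t At.
have At_y : (fun r => (r, y)) r @[r --> within A (nbhs t)] --> within (A `*` B) (nbhs (t, y)).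
  move=> P [[/= S T] [/= nS nT] ST]; rewrite /= /within/=.
  by apply: filterS nS => r Sr Ar; apply: (ST (r, y)); split => //; exact: nbhs_singleton nT.
exact: (cvg_comp _ _ At_y (cf (t, y) (conj At By))).
Qed.

Lemma problemA_smooth u x : problemA alpha beta s p K phi u -> 0 < x < 1 ->
  smooth `]0, 1[ s.*2 (u x).
Proof.
move=> [_ _ [du cu] [d2u c2u] _] x01; have xI : I01 x by case/andP: x01 => ? ?; rewrite /I01/= in_itv/= !ltW.
have xO : O01 x by rewrite /O01/= in_itv.
have der k y : (k < s.*2)%N -> `]0, 1[%classic y -> derivable_in I01 (derive_in_n I01 k (u x)) y.
  move=> ks yO; have [k1|k1] := ltnP k s.*2.-1; first by apply: du => //; exact: subO.
  by rewrite (_ : k = s.*2.-1); [exact: d2u|lia].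
have der1 k y : (k < s.*2)%N -> `]0, 1[%classic y -> derivable (derive1n k (u x)) y 1.
  move=> ks yO; apply: (@eq_derivable _ (derive_in_n I01 k (u x))).
    by apply: (near_open openO yO) => z zO; exact: derive_in_nE openO subO zO.
  exact: derivable_in_derivable openO subO yO (der _ _ ks yO).
split=> // k y; rewrite leq_eqVlt => /predU1P[->|ks] yO; last first.
  by apply: derivable1_continuous; exact: der1.
apply: (@eq_continuous_at _ (derive_in_n I01 s.*2 (u x))).
  by apply: (near_open openO yO) => z zO; exact: derive_in_nE openO subO zO.
apply: (@continuous_snd_slice R (fun x y => derive_in_n I01 s.*2 (u x) y)).
by apply: square_interior_continuous c2u _ _ => //; rewrite in_itv/= in yO.
Qed.

(** The solution and its derivative of order 2s - 1 are bounded, being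
    continuous on the closed square; the derivatives in between are bounded by
    interpolation. *)
Lemma problemA_admissible u : problemA alpha beta s p K phi u ->
  exists M, 0 <= M /\ forall x, 0 < x < 1 -> admissible s M (u x).
Proof.
move=> hu; have [_ c0u [du cu] _ [_ bc _]] := hu.
have [M1 h1] := within_rect_bounded c0u.
have [M2 h2] := @within_rect_bounded R 0 1 0 1 (fun x y => derive_in_n I01 s.*2.-1 (u x) y) cu.
have [C hC] := @intermediate_derivatives_bound R s.*2.-1.
pose M := Num.max M1 M2.
have bnd x k y : 0 < x < 1 -> (k < s.*2)%N -> 0 < y < 1 -> `|derive1n k (u x) y| <= C * M.
  move=> x01 ks y01; have /andP[x0 x1] := x01.
  apply: hC => //; [|move=> z /andP[z0 z1]|move=> z /andP[z0 z1]|lia].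
  - by apply: smooth_le (problemA_smooth hu x01); exact: leq_pred.
  - by rewrite le_max; apply/orP; left; apply: h1; rewrite !ltW.
  - rewrite -(derive_in_nE _ _ openO subO); last by rewrite /= in_itv/= z0.
    by rewrite le_max; apply/orP; right; apply: h2; rewrite !ltW.
exists (C * M); split.
  have h01 : 0 < (2^-1 : R) < 1 by apply/andP; split; lra.
  by apply: le_trans (bnd _ 0%N _ h01 _ h01) => //; rewrite double_gt0.
move=> x x01; have xI : I01 x by case/andP: x01 => ? ?; rewrite /I01/= in_itv/= !ltW.
have lim k : (k < s)%N -> derive1n k (u x) y @[y --> 0^'+] --> 0 /\ derive1n k (u x) y @[y --> 1^'-] --> 0.
  move=> ks; have [b0 b1] := bc x xI k ks.
  have cw : {within `[0, 1], continuous (derive_in_n `[0, 1] k (u x))}.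
    apply/subspace_continuousP => y yI; apply: derivable_in_continuous => //.
    by apply: du => //; lia.
  by have := derive1n_itv_lim ltr01 cw; rewrite -/I01 b0 b1.
apply: (admissible_intro s1).
- exact: problemA_smooth hu x01.
- by move=> k y; exact: bnd.
- by move=> k /lim[].
- by move=> k /lim[].
Qed.

Hypothesis alpha01 : 0 < alpha < 1.
Hypothesis Kpos : forall y, 0 < y <= 1 -> 0 < K y.

Lemma problemA_Lop u x y : problemA alpha beta s p K phi u -> 0 < x < 1 -> 0 < y < 1 ->
  Lop s p (u x) y = - caputo alpha u x y / (x `^ beta * K y).
Proof.
move=> [_ _ _ _ [pde _ _]] x01 y01.
have xO : O01 x by rewrite /O01/= in_itv.
have yO : O01 y by rewrite /O01/= in_itv.
have := pde x y xO yO; rewrite (lexpr_Lop p s1 (u x) openO subO yO) => /eqP.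
rewrite addr_eq0 => /eqP ->; rewrite opprK mulrAC mulfV ?mul1r//.
have /andP[x0 _] := x01; have /andP[y0 y1] := y01.
by rewrite mulf_neq0// gt_eqF// ?powR_gt0// Kpos// y0 ltW.
Qed.

Variables (u1 u2 : R -> R -> R).
Hypotheses (hu1 : problemA alpha beta s p K phi u1) (hu2 : problemA alpha beta s p K phi u2).

Let h x y := Lop s p (u1 x) y - Lop s p (u2 x) y.

(** By the equation l(u) is the Caputo derivative divided by a continuous
    function without zeros in the open square. *)
Lemma Lop_difference_continuous x y : 0 < x < 1 -> 0 < y < 1 -> {within I01, continuous K} ->
  {for (x, y), continuous (fun q : R * R => h q.1 q.2)}.
Proof.
move=> x01 y01 Kcont; have /andP[x0 _] := x01; have /andP[y0 y1] := y01.
pose f (q : R * R) := (caputo alpha u2 q.1 q.2 - caputo alpha u1 q.1 q.2) / (q.1 `^ beta * K q.2).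
have cf : {for (x, y), continuous f}.
  have cq u : problemA alpha beta s p K phi u -> {for (x, y), continuous (fun q : R * R => caputo alpha u q.1 q.2)}.
    by move=> [[_ c1] _ _ _ _]; exact: square_interior_continuous c1 _ _.
  apply: cvgM; first by apply: cvgB; exact: cq.
  apply: cvgV; first by rewrite mulf_neq0// gt_eqF// ?powR_gt0// Kpos// y0 ltW.
  apply: cvgM.
    apply: (@continuous_comp _ _ _ (@fst R R) (fun x => x `^ beta)); first exact: cvg_fst.
    exact: continuous_powR.
  apply: (@continuous_comp _ _ _ (@snd R R) K); first exact: cvg_snd.
  by apply: (within_continuous_interior openO subO) Kcont; rewrite /= in_itv.
have fE q : (`]0, 1[ `*` `]0, 1[)%classic q -> f q = h q.1 q.2.
  move=> [/=]; rewrite !in_itv/= => q1 q2.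
  have key (a b c : R) : (b - a) / c = - a / c - (- b / c) by rewrite -mulrBl opprK addrC.
  by rewrite /h (problemA_Lop hu1 q1 q2) (problemA_Lop hu2 q1 q2); exact: key.
have E : \forall q \near (x, y), f q = h q.1 q.2.
  apply: filterS (open_nbhs_nbhs _); first exact: fE.
  by split; [exact: open_rect|split; rewrite /= in_itv].
have : (fun q : R * R => h q.1 q.2) q @[q --> (x, y)] --> f (x, y).
  by apply: cvg_trans cf; apply: near_eq_cvg.
by rewrite (fE (x, y))//; split; rewrite /= in_itv.
Qed.

(** By the equation the integrand is a multiple of the Caputo derivative of
    the difference, which vanishes at time 0. *)
Lemma Lop_difference_primitive x y : 0 < x < 1 -> 0 < y < 1 ->
  mu.-integrable `]0, x[ (fun t => (t `^ beta * h t y)%:E) /\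
  \int[mu]_(t in `]0, x[) (t `^ beta * h t y) =
  - (Gamma (1 - alpha))^-1 / K y * conv (pow (- alpha)) (fun t => u1 t y - u2 t y) x.
Proof.
move=> x01 y01; have /andP[x0 x1] := x01; have /andP[y0 y1] := y01.
have yO : O01 y by rewrite /O01/= in_itv.
have tO t : 0 < t <= x -> O01 t by move=> /andP[t0 tx]; rewrite /O01/= in_itv/= t0 (le_lt_trans tx).
set c0 := (Gamma (1 - alpha))^-1.
pose f t := u1 t y - u2 t y.
have ce u t : problemA alpha beta s p K phi u -> 0 < t <= x -> caputo_exists alpha u t y.
  by move=> [[ce _] _ _ _ _] tx; apply: ce => //; exact: tO.
have du u t : problemA alpha beta s p K phi u -> 0 < t <= x -> derivable (fun r => u r y) t 1.
  move=> hu tx; have [+ _] := ce u t hu tx; apply; case/andP: tx => -> _ /=; exact: lexx.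
have df t : 0 < t <= x -> derivable f t 1.
  by move=> tx; exact: (derivableB (du _ _ hu1 tx) (du _ _ hu2 tx)).
have df' t : 0 < t <= x -> derive1 f t = derive1 (fun r => u1 r y) t - derive1 (fun r => u2 r y) t.
  by move=> tx; exact: (derive1B (du _ _ hu1 tx) (du _ _ hu2 tx)).
have f0 : f 0 = 0.
  have [_ _ _ _ [_ _ i1]] := hu1; have [_ _ _ _ [_ _ i2]] := hu2.
  have yI : I01 y by exact: subO.
  by rewrite /f i1// i2// subrr.
have cont0 u : problemA alpha beta s p K phi u -> u t y @[t --> 0^'+] --> u 0 y.
  move=> [_ cu _ _ _].
  have cuy : {within `[0, 1], continuous (u^~ y)}.
    exact: (within_fst_slice (subO yO) cu).
  by have /(continuous_within_itvP _ ltr01)[] := cuy.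
have fr0 : f t @[t --> 0^'+] --> f 0 by apply: cvgB; exact: cont0.
have ie u t (hu : problemA alpha beta s p K phi u) (tx : 0 < t <= x) := (ce u t hu tx).2.
have fI t r : 0 < t <= x -> 0 < r < t -> derive1 f r / (t - r) `^ alpha =
    caputo_integrand alpha u1 t y r - caputo_integrand alpha u2 t y r.
  move=> /andP[t0 tx] /andP[r0 rt]; rewrite /caputo_integrand -mulrBl df'//.
  by rewrite r0 ltW// (lt_le_trans rt).
have id t : 0 < t <= x -> mu.-integrable `]0, t[ (fun r => (derive1 f r / (t - r) `^ alpha)%:E).
  move=> tx; apply: eq_integrable (integrable_subr (measurable_itv _) (ie _ _ hu1 tx) (ie _ _ hu2 tx)) => // r.
  by rewrite inE/= in_itv/= => r0t; rewrite fI.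
have [dI dE] := conv_pow_caputo alpha01 x0 f0 fr0 df id.
have hE t : 0 < t < x -> t `^ beta * h t y =
    - c0 / K y * \int[mu]_(r in `]0, t[) (derive1 f r / (t - r) `^ alpha).
  move=> /andP[t0 tx]; have tx' : 0 < t <= x by rewrite t0 ltW.
  have t01 : 0 < t < 1 by rewrite t0 (lt_trans tx).
  have -> : \int[mu]_(r in `]0, t[) (derive1 f r / (t - r) `^ alpha) =
      \int[mu]_(r in `]0, t[) caputo_integrand alpha u1 t y r -
      \int[mu]_(r in `]0, t[) caputo_integrand alpha u2 t y r.
    rewrite -(Rint_sub (measurable_itv _) (ie _ _ hu1 tx') (ie _ _ hu2 tx')).
    by apply: eq_Rintegral => r; rewrite inE/= in_itv/= => r0t; rewrite fI.
  rewrite /h (problemA_Lop hu1 t01 y01) (problemA_Lop hu2 t01 y01) /caputo -/c0.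
  have K0 : K y != 0 by rewrite gt_eqF// Kpos// y0 ltW.
  have t0' : t `^ beta != 0 by rewrite gt_eqF// powR_gt0.
  move: (Rintegral _ _ _) (Rintegral _ _ _) (t `^ beta) t0' (K y) K0 => I1 I2 tb tb0 ky ky0.
  by field; rewrite tb0 ky0.
split.
  apply: eq_integrable (integrable_mull (- c0 / K y) (measurable_itv _) dI) => // t.
  by rewrite inE/= in_itv/= => t0x; rewrite hE.
rewrite dE -(Rint_scale _ (measurable_itv _) dI).
by apply: eq_Rintegral => t; rewrite inE/= in_itv/= => t0x; rewrite hE.
Qed.

End solutions.

(** Each point of the closed square is the limit of interior points along the
    segment to the centre. *)
Lemma square_closure_eq0 (R : realType) (z : R -> R -> R) :
  {within I01 `*` I01, continuous (fun q : R * R => z q.1 q.2)} ->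
  (forall x y, 0 < x < 1 -> 0 < y < 1 -> z x y = 0) ->
  forall x y, 0 <= x <= 1 -> 0 <= y <= 1 -> z x y = 0.
Proof.
move=> /subspace_continuousP cz z0 x y x01 y01.
(* the segment from a to the centre 1/2 *)
pose c (a t : R) := a + t * (2^-1 - a).
have cI a t : 0 <= a <= 1 -> 0 < t < 1 -> 0 < c a t < 1.
  by move=> /andP[a0 a1] /andP[t0 t1]; rewrite /c; apply/andP; split; nra.
have ccvg a : c a t @[t --> 0^'+] --> a.
  rewrite -[X in _ --> X](_ : a + 0 * (2^-1 - a) = a); last by rewrite mul0r addr0.
  apply: cvgD; first exact: cvg_cst.
  by apply: cvgM; [apply: cvg_at_right_filter; exact: cvg_id|exact: cvg_cst].
have path : (fun t => (c x t, c y t)) t @[t --> 0^'+] --> within (I01 `*` I01) (nbhs (x, y)).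
  move=> P [[/= S T] [/= nS nT] ST].
  change (\forall t \near 0^'+, P (c x t, c y t)); near=> t.
  have t01 : 0 < t < 1.
    by apply/andP; split; near: t; [exact: nbhs_right_gt|exact: nbhs_right_lt].
  apply: (ST (c x t, c y t)).
    by split => /=; near: t; [exact: (ccvg x)|exact: (ccvg y)].
  have /andP[h1 h2] := cI x t x01 t01; have /andP[h3 h4] := cI y t y01 t01.
  by split; rewrite /I01/= in_itv/= !ltW.
have xyI : (I01 `*` I01) (x, y) by split; rewrite /I01/= in_itv.
have h1 := cvg_comp _ _ path (cz (x, y) xyI).
have h2 : (fun t => z (c x t) (c y t)) t @[t --> 0^'+] --> (0 : R).
  apply: cvg_near_cst; near=> t; apply: z0; apply: cI => //.
    by apply/andP; split; near: t; [exact: nbhs_right_gt|exact: nbhs_right_lt].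
  by apply/andP; split; near: t; [exact: nbhs_right_gt|exact: nbhs_right_lt].
exact: (cvg_unique _ h1 h2).
Unshelve. all: by end_near. Qed.

Theorem theorem3 (R : realType) (alpha beta : R) (s : nat)
  (p : nat -> R -> R) (K : R -> R) (NK : nat) (m : R)
  (G : R -> R -> R) (phi : R -> R) (Nphi : nat)
  (halpha : 0 < alpha < 1) (hbeta : - alpha < beta) (hs : (1 <= s)%N)
  (hp : forall j, (j < s)%N -> contdiff_in I01 j (p j))
  (hKcont : {within I01, continuous K})
  (hKsmooth : contdiff_in `]0, 1] NK K)
  (hKpos : forall y, 0 < y <= 1 -> 0 < K y)
  (hK0 : K 0 = 0)
  (hm : 0 <= m < s%:R)
  (hKO : forall i, (i <= NK)%N ->
     (derive_in_n `]0, 1] i K : R -> R^o)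
       =O_ (0^'+) (fun y => y `^ (m - i%:R) : R^o))
  (heig : forall lam : R, eigenvalue_of s p K lam -> 0 < lam)
  (hG : green_function s p G)
  (hGsym : forall y xi, I01 y -> I01 xi -> G y xi = G xi y)
  (hGbar : weighted_kernel_continuous K G)
  (hNphi : (s.-1 <= Nphi)%N)
  (hphi : contdiff_in I01 Nphi phi)
  (hphi_match : boundary_cond s phi)
  (u1 u2 : R -> R -> R)
  (hu1 : problemA alpha beta s p K phi u1)
  (hu2 : problemA alpha beta s p K phi u2) :
  forall x y : R, 0 <= x <= 1 -> 0 <= y <= 1 -> u1 x y = u2 x y.
Proof.
move=> x y x01 y01; apply/eqP; rewrite -subr_eq0; apply/eqP; move: x y x01 y01.
have [_ cu1 _ _ _] := hu1; have [_ cu2 _ _ _] := hu2.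
apply: (@square_closure_eq0 R (fun x y => u1 x y - u2 x y)).
  by move=> q; apply: cvgB; [exact: cu1|exact: cu2].
have [Gb [GbE Gsym Gbc]] := hGbar.
have [N GbN] := within_rect_bounded Gbc.
have [M1 [M10 adm1]] := problemA_admissible hs hu1.
have [M2 [M20 adm2]] := problemA_admissible hs hu2.
have [C1 hC1] := admissible_le_kap hs hp hG hKcont hKpos GbE GbN M10.
have [C2 hC2] := admissible_le_kap hs hp hG hKcont hKpos GbE GbN M20.
pose kap y := Num.sqrt (K y).
have c01 y : 0 < y < 1 -> 0 <= y <= 1 by move=> /andP[? ?]; rewrite !ltW.
have h01 y : 0 < y < 1 -> 0 < y <= 1 by move=> /andP[-> ?]; rewrite ltW.
have O01sub : (`]0, 1[ `*` `]0, 1[ : set (R * R)) `<=` I01 `*` I01.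
  by move=> [a b] [/= a0 b0]; split; exact: subset_itv_oo_cc.
have kap0 y : 0 < y < 1 -> 0 < kap y by move=> y01; rewrite sqrtr_gt0 hKpos// h01.
have Kc y : 0 < y < 1 -> {for y, continuous K}.
  move=> y01; have oO : open (`]0, 1[%classic : set R) by exact: interval_open.
  have yO : (`]0, 1[%classic : set R) y by rewrite /= in_itv.
  exact: (within_continuous_interior oO (@subset_itv_oo_cc _ _ _ _) yO hKcont).
have kapc y : 0 < y < 1 -> {for y, continuous kap}.
  by move=> y01; apply: (@continuous_comp _ _ _ K (@Num.sqrt R)); [exact: Kc|exact: sqrt_continuous].
pose v x y := (u1 x y - u2 x y) / kap y.
have vE x y : 0 < y < 1 -> u1 x y - u2 x y = kap y * v x y.
  by move=> y01; rewrite /v mulrC mulfVK// gt_eqF// kap0.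
have vM x y : 0 < x < 1 -> 0 < y < 1 -> `|v x y| <= C1 + C2.
  move=> x01 y01; rewrite /v normrM normfV (gtr0_norm (kap0 _ y01)) ler_pdivrMr ?kap0// mulrDl.
  apply: le_trans (ler_normB _ _) _; apply: lerD.
    by apply: hC1 => //; exact: adm1.
  by apply: hC2 => //; exact: adm2.
have vc x y : 0 < x < 1 -> 0 < y < 1 -> {for (x, y), continuous (fun q : R * R => v q.1 q.2)}.
  move=> x01 y01; apply: cvgM.
    by apply: cvgB; [exact: square_interior_continuous O01sub cu1 _ _|exact: square_interior_continuous O01sub cu2 _ _].
  apply: cvgV; first by rewrite gt_eqF// kap0.
  by apply: (@continuous_comp _ _ _ (@snd R R) kap); [exact: cvg_snd|exact: kapc].
have Gbcont y xi : 0 < y < 1 -> 0 < xi < 1 -> {for (y, xi), continuous (fun q : R * R => Gb q.1 q.2)}.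
  exact: square_interior_continuous O01sub Gbc.
have Gbsym y xi : 0 < y < 1 -> 0 < xi < 1 -> Gb y xi = Gb xi y.
  by move=> y01 xi01; apply: Gsym; rewrite /I01/= in_itv/= c01.
have GbN' y xi : 0 < y < 1 -> 0 < xi < 1 -> `|Gb y xi| <= N.
  by move=> y01 xi01; apply: GbN; exact: c01.
pose c0 := (Gamma (1 - alpha))^-1.
pose h x y := Lop s p (u1 x) y - Lop s p (u2 x) y.
have hc x y : 0 < x < 1 -> 0 < y < 1 -> {for (x, y), continuous (fun q : R * R => h q.1 q.2)}.
  by move=> x01 y01; exact: (Lop_difference_continuous hs hKpos hu1 hu2 x01 y01 hKcont).
have hprim x y : 0 < x < 1 -> 0 < y < 1 ->
    \int[lebesgue_measure]_(t in `]0, x[) (t `^ beta * h t y) =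
    - c0 / kap y * conv (pow (- alpha)) (v^~ y) x.
  move=> x01 y01; have [_ ->] := Lop_difference_primitive hs halpha hKpos hu1 hu2 x01 y01.
  have /andP[al0 al1] := halpha; have /andP[x0 x1] := x01.
  have mv : measurable_fun (`]0, x[ : set (measurableTypeR R)) (v^~ y).
    apply: (@measurable_funS _ _ _ _ (`]0, 1[ : set (measurableTypeR R))) => //.
      by move=> t /=; rewrite !in_itv/= => /andP[-> tx]; exact: lt_trans x1.
    apply: open_continuous_measurable_fun; first exact: interval_open.
    by move=> t; rewrite inE/= in_itv/= => t01; exact: (continuous_fst_slice (vc _ _ t01 y01)).
  have iv : convable (pow (- alpha)) (v^~ y) x.
    apply: (@convable_dom R (- alpha) _ 0 (C1 + C2)) => //; [lra|].
    by move=> t /andP[t0 tx]; rewrite powRr0 mulr1; apply: vM => //; rewrite t0 (lt_trans tx).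
  have -> : conv (pow (- alpha)) (fun t => u1 t y - u2 t y) x = kap y * conv (pow (- alpha)) (v^~ y) x.
    rewrite /conv -(Rint_scale _ (measurable_itv _) iv); apply: eq_Rintegral => t _.
    by rewrite vE// mulrCA.
  have KE : K y = kap y * kap y by rewrite -expr2 sqr_sqrtr// ltW// hKpos// h01.
  rewrite -/c0 KE; move: (conv _ _ _) (kap y) (kap0 y y01) => q k k0.
  by field; rewrite gt_eqF.
have evol x xi : 0 < x < 1 -> 0 < xi < 1 ->
    c0 * \int[lebesgue_measure]_(y in `]0, 1[) (Gb y xi * conv (pow (- alpha)) (v^~ y) x) =
    - \int[lebesgue_measure]_(t in `]0, x[) (t `^ beta * v t xi).
  move=> x01 xi01.
  pose M := Num.max M1 M2.
  have [eta1 [e10 e11 est1]] := green_estimate hs hp hG M10 xi01.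
  have [eta2 [e20 e21 est2]] := green_estimate hs hp hG M20 xi01.
  apply: (@evolution_identity R alpha beta c0 N (C1 + C2) xi x Gb v h kap (fun a => eta1 a + eta2 a)) => //.
  - by move=> y y01; exact: (continuous_fst_slice (Gbcont _ _ y01 xi01)).
  - by move=> y y01; exact: GbN'.
  - by move=> t y t01 y01; have [] := Lop_difference_primitive hs halpha hKpos hu1 hu2 t01 y01.
  - move=> t a b t01 a0 axi xib b1.
    pose W y := kap y * kap xi * Gb y xi.
    have /andP[xi0 xi1] := xi01.
    have iL u : problemA alpha beta s p K phi u ->
        (@lebesgue_measure R).-integrable `]a, b[ (fun y => (Lop s p (u t) y * W y)%:E).
      move=> hu; apply: (open_itv_continuous_integrable a0 b1) => y y01; apply: cvgM.
        exact: (Lop_continuous hs (smooth_coefficients hp) (problemA_smooth hs hu t01) y01).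
      apply: cvgM; last exact: (continuous_fst_slice (Gbcont _ _ y01 xi01)).
      by apply: cvgM; [exact: kapc|exact: cvg_cst].
    have GW u : \int[lebesgue_measure]_(y in `]a, b[) (Lop s p (u t) y * W y) =
        \int[lebesgue_measure]_(y in `]a, b[) (Lop s p (u t) y * G y xi).
      apply: eq_Rintegral => y; rewrite inE/= in_itv/= => /andP[ay yb].
      rewrite (weighted_kernelE hKpos GbE)//; last exact: h01.
      by rewrite (lt_trans a0 ay) (ltW (lt_trans yb b1)).
    rewrite -/W -vE//.
    have -> : \int[lebesgue_measure]_(y in `]a, b[) (h t y * W y) =
        \int[lebesgue_measure]_(y in `]a, b[) (Lop s p (u1 t) y * G y xi) -
        \int[lebesgue_measure]_(y in `]a, b[) (Lop s p (u2 t) y * G y xi).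
      rewrite -(GW u1) -(GW u2) -(Rint_sub (measurable_itv _) (iL _ hu1) (iL _ hu2)).
      by apply: eq_Rintegral => y _; rewrite -mulrBl.
    have e1 := est1 _ a b (adm1 t t01) a0 axi xib b1.
    have e2 := est2 _ a b (adm2 t t01) a0 axi xib b1.
    have key (I1 I2 w1 w2 : R) : I1 - I2 - (w1 - w2) = (I1 - w1) - (I2 - w2) by ring.
    rewrite key; apply: le_trans (ler_normB _ _) _; apply: le_trans (lerD e1 e2) _.
    by rewrite addrACA.
  - by rewrite -[X in _ --> X](addr0 0); exact: cvgD.
  - by rewrite -[X in _ --> X](addr0 0); exact: cvgD.
move=> x y x01 y01.
have v0 : v x y = 0 by apply: (evolution_eq0 halpha hbeta Gbcont GbN' Gbsym vc vM evol).
by rewrite vE// v0 mulr0.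
Qed.
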